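(* Assume $\rho_{\min}>\gamma_{\max}$. There exist a constant $\rho_0=\rho_0(\gamma_{\min},\gamma_{\max},K_0,K_1)$ and a time $t_0=t_0(\gamma_{\min},\gamma_{\max},R_1,K_0,K_1)$, depending only on the indicated quantities, such that if $\rho_{\min}>\rho_0$ and $y_t$ is the solution of $dy_t=d\omega_t-\nabla\Gamma(y_t)\,dt$, $y_0=0$, then for all $t>t_0$ $$\mathbb{E}\big[|y_t\cdot e_2|^2\big]=t^{1+\nu(t)}$$ with $$\frac{\ln \gamma_{\min}}{\ln \rho_{\max}+\ln \frac{\gamma_{\max}}{\gamma_{\min}}}-\frac{C_1}{\ln t}\ \leq\ \nu(t)\ \leq\ \frac{\ln \gamma_{\max}}{\ln \rho_{\min}+\ln \frac{\gamma_{\min}}{\gamma_{\max}}}+\frac{C_2}{\ln t},$$ where the constants $C_1$ and $C_2$ depend only on $\rho_{\min},\gamma_{\min},\gamma_{\max},\rho_{\max},K_0,K_1$.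
   Context: Let $(r_n)_{n\ge 0}$ be integers with $r_0=1$, $\rho_{\min}=\inf_{n\ge1}r_n\ge 2$, $\rho_{\max}=\sup_{n\ge1}r_n<\infty$, and $R_n=\prod_{k=0}^n r_k$. Let $(\gamma_n)_{n\ge0}$ be reals with $\gamma_0=1$, $\gamma_{\min}=\inf_{n\ge0}\gamma_{n+1}/\gamma_n>1$, $\gamma_{\max}=\sup_{n\ge0}\gamma_{n+1}/\gamma_n<\infty$. Let $h_n:\mathbb{R}\to\mathbb{R}$ ($n\ge 0$) be smooth functions of period $1$ with $h_n(0)=0$, $\int_0^1\big(h_n(x)-\int_0^1h_n(y)dy\big)^2dx=1$, $K_0=\sup_n(\sup h_n-\inf h_n)<\infty$ and $K_1=\sup_n\|h_n'\|_\infty<\infty$. Put $h(x_1)=\sum_{n=0}^\infty\gamma_nh_n(x_1/R_n)$ (under $\rho_{\min}>\gamma_{\max}$ this is a well-defined $C^1$ function with bounded derivative), and $\Gamma(x_1,x_2)=\begin{pmatrix}0&h(x_1)\\-h(x_1)&0\end{pmatrix}$. Let $\omega_t$ be a standard Brownian motion in $\mathbb{R}^2$ started at $0$, and let $(e_1,e_2)$ be the canonical basis. In the equation $dy_t=d\omega_t-\nabla\Gamma(y_t)\,dt$, $y_0=0$, $\nabla\Gamma$ denotes the divergence of the matrix $\Gamma$; explicitly $y_t\cdot e_1=\omega_t\cdot e_1$ and $y_t\cdot e_2=\omega_t\cdot e_2+\int_0^t h'(\omega_s\cdot e_1)\,ds$. *)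

(* Defs.v *)
From HB Require Import structures.
From mathcomp Require Import all_boot all_order all_algebra.
From mathcomp Require Import all_classical all_reals all_analysis.

Set Implicit Arguments.
Unset Strict Implicit.
Unset Printing Implicit Defensive.

Import Order.TTheory GRing.Theory Num.Theory.
Import numFieldNormedType.Exports.

Local Open Scope classical_set_scope.
Local Open Scope ring_scope.

(* The infima and suprema below are the real-valued [inf] and [sup], which are
   0 on sets without a finite infimum or supremum.  In [shear_data] a lower
   bound such as [2 <= rho_min r] therefore also says that the infimum is
   finite, while finiteness of a supremum is stated with [has_ubound]. *)

Section ShearFlow.
Variable R : realType.
Implicit Types (r : nat -> int) (gamma : nat -> R) (hn : nat -> R -> R).

Definition scale_ratios r : set R := range (fun n => (r n.+1)%:~R : R).
Definition rho_min r : R := inf (scale_ratios r).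
Definition rho_max r : R := sup (scale_ratios r).

Definition scale r (n : nat) : R := (\prod_(0 <= k < n.+1) r k)%:~R.

Definition amplitude_ratios gamma : set R :=
  range (fun n => gamma n.+1 / gamma n).
Definition gamma_min gamma : R := inf (amplitude_ratios gamma).
Definition gamma_max gamma : R := sup (amplitude_ratios gamma).

Definition oscillations hn : set R :=
  range (fun n => sup (range (hn n)) - inf (range (hn n))).
Definition K0 hn : R := sup (oscillations hn).

Definition sup_norm (f : R -> R) : R := sup (range (fun x => `|f x|)).
Definition derivative_norms hn : set R :=
  range (fun n => sup_norm (derive1 (hn n))).
Definition K1 hn : R := sup (derivative_norms hn).

Definition smooth (f : R -> R) : Prop :=
  forall (k : nat) (x : R), derivable (derive1n k f) x 1.

Definition unit_integral (f : R -> R) : R :=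
  \int[lebesgue_measure]_(x in `[0, 1]) f x.

Record shear_data r gamma hn : Prop := ShearData {
  scale_ratio0 : r 0%N = 1;
  rho_min_ge2 : 2 <= rho_min r;
  rho_max_fin : has_ubound (scale_ratios r);
  amplitude0 : gamma 0%N = 1;
  gamma_min_gt1 : 1 < gamma_min gamma;
  gamma_max_fin : has_ubound (amplitude_ratios gamma);
  profile_smooth : forall n, smooth (hn n);
  profile_periodic : forall n x, hn n (x + 1) = hn n x;
  profile_at0 : forall n, hn n 0 = 0;
  profile_variance : forall n,
    unit_integral (fun x => (hn n x - unit_integral (hn n)) ^+ 2) = 1;
  K0_fin : has_ubound (oscillations hn);
  K1_fin : has_ubound (derivative_norms hn)
}.

Definition shear_profile r gamma hn (x1 : R) : R :=
  limn (series (fun n => gamma n * hn n (x1 / scale r n))).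

Definition shear_stream_matrix r gamma hn (x : 'rV[R]_2) : 'M[R]_2 :=
  \matrix_(i, j) if (i == 0) && (j == 1) then shear_profile r gamma hn (x 0 0)
                 else if (i == 1) && (j == 0) then
                   - shear_profile r gamma hn (x 0 0)
                 else 0.

(* Row-wise divergence, (div G)_i = sum_j d_j G_ij.  With this convention the
   drift - div G of the shear stream matrix is (0, h'(x_1)). *)
Definition mx_divergence (d : nat) (G : 'rV[R]_d -> 'M[R]_d) (x : 'rV[R]_d) :
    'rV[R]_d :=
  \row_i \sum_(j < d) 'D_(delta_mx 0 j) (fun z => G z i j) x.

End ShearFlow.

Section Processes.
Context (d : measure_display) (T : measurableType d) (R : realType).
Variable P : probability T R.

(* As [A i = setT] is allowed, the product rule over the whole finite index
   type implies the product rule over all of its subfamilies. *)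
Definition mutually_independent (I : finType) (X : I -> T -> R) : Prop :=
  forall A : I -> set R, (forall i, measurable (A i)) ->
    P (\bigcap_(i in setT) (X i @^-1` A i)) =
    (\prod_(i : I) P (X i @^-1` A i))%E.

(* Processes are indexed by all of R, but only the times t >= 0 matter. *)
Definition vector_process (n : nat) (X : R -> T -> 'rV[R]_n) : Prop :=
  forall (t : R) (i : 'I_n), 0 <= t ->
    measurable_fun setT (fun w => X t w 0 i).

Definition increment (n : nat) (X : R -> T -> 'rV[R]_n) (s t : R) (i : 'I_n)
    (w : T) : R := X t w 0 i - X s w 0 i.

(* The second argument of [normal_prob] is the standard deviation.  The
   coordinates of all increments are jointly independent, which includes both
   independence of increments in time and independence of the coordinates. *)
Record brownian_motion (n : nat) (W : R -> T -> 'rV[R]_n) : Prop :=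
  BrownianMotion {
  bm_measurable : vector_process W;
  bm_start0 : {ae P, forall w, W 0 w = 0};
  bm_continuous :
    {ae P, forall w, {within `[0, +oo[, continuous (fun t => W t w)}};
  bm_gaussian : forall (s t : R) (i : 'I_n), 0 <= s -> s < t ->
    forall A : set R, measurable A ->
      P (increment W s t i @^-1` A) = normal_prob 0 (Num.sqrt (t - s)) A;
  bm_independent : forall (m : nat) (tau : nat -> R), 0 <= tau 0%N ->
    (forall k, tau k <= tau k.+1) ->
    mutually_independent (fun ki : 'I_m * 'I_n =>
      increment W (tau ki.1) (tau ki.1.+1) ki.2)
}.

(* Solutions of dy_t = dW_t - div G(y_t) dt, y_0 = 0.  The noise is additive,
   so the integral form of the equation makes sense path by path. *)
Record sde_solution (n : nat) (G : 'rV[R]_n -> 'M[R]_n)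
    (W y : R -> T -> 'rV[R]_n) : Prop := SdeSolution {
  sol_measurable : vector_process y;
  sol_continuous :
    {ae P, forall w, {within `[0, +oo[, continuous (fun t => y t w)}};
  sol_start0 : {ae P, forall w, y 0 w = 0};
  sol_equation : {ae P, forall w, forall (t : R) (i : 'I_n), 0 <= t ->
    y t w 0 i = W t w 0 i
      - \int[lebesgue_measure]_(s in `[0, t]) mx_divergence G (y s w) 0 i}
}.

End Processes.

(* Main.v *)
Require Import Defs.
From HB Require Import structures.
From mathcomp Require Import all_boot all_order all_algebra.
From mathcomp Require Import all_classical all_reals all_analysis.
From mathcomp Require Import measurable_realfun.
From mathcomp Require Import ring lra.

Set Implicit Arguments.
Unset Strict Implicit.
Unset Printing Implicit Defensive.

Import Order.TTheory GRing.Theory Num.Theory.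
Import numFieldNormedType.Exports.

Local Open Scope classical_set_scope.
Local Open Scope ring_scope.

(* Write b for the first coordinate of the Brownian motion and Z for the time
   integral of h'(b).  The second coordinate of the noise is independent of Z,
   so E |y_t.e_2|^2 = t + E Z^2, and it suffices to compare E Z^2 with
   gamma_N^2 t, where N is the scale at which R_N is of order sqrt t; taking
   logarithms gives the exponents.

   Let h_N be the sum of the layers up to N and H an antiderivative of h_N.
   Ito's formula reads (integral of h_N'(b)) = 2 (H(b_t) - H(b_0))
   - 2 (stochastic integral of h_N(b)), and the remaining layers contribute to
   h' a geometric tail of order gamma_N / R_N.  This bounds E Z^2 from above.

   For the lower bound, pair Z with the stochastic integral X of phi(b), where
   phi is the centred N-th profile: E Z^2 >= (E Z X)^2 / E X^2 and
   E X^2 <= K0^2 t.  By Gaussian integration by parts E Z X is twice the time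
   integral of E phi(b_u) h(b_u) - E phi(b_u) h(b_t).  In it the N-th layer
   contributes gamma_N, by the variance normalisation, and all the other terms
   are averaged out by integration by parts against the Gaussian law of b_u or
   of b_t - b_u, up to a factor made small by the separation of scales.

   Stochastic integrals are replaced by sums over the uniform grid with n + 1
   steps, and the errors vanish in mean square as n tends to infinity. *)


(** * Antiderivatives *)

(** The grid form of Ito's formula needs a Lipschitz second derivative, and the series for h' need
    not be Lipschitz: [K1] bounds the first derivatives of the profiles uniformly, while the bounds
    on the second derivatives depend on the layer. So only finite sums of layers enter Ito's
    formula. For the upper bound the sum may stop at N, because the tail slope gamma_N / R_N times t
    is at most of order gamma_N sqrt t when R_N >= sqrt t. For the lower bound R_N is below a small
    multiple of sqrt t and the same tail could dominate; the layers above N are therefore kept up to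
    a level that tends to infinity, and are averaged against phi instead of being bounded in
    absolute value. Integration by parts leaves errors gamma_N R_N / sqrt u and gamma_N R_N / sqrt
    (t - u), whose time integrals are small against gamma_N t by the choice of N. The other errors
    are of order gamma_N t times K0 K1 / (rm - 1) or K0 K1 gM / (rm - gM). They do not improve with
    time, and the threshold on rho_min serves to make both ratios at most 1/20. *)

Section Antiderivative.
Context (R : realType).
Notation mu := (@lebesgue_measure R).
Implicit Types (F G f g : R -> R) (a b x y C : R).

(** Derivability and the value of the derivative in one relation, so that derivatives are combined
    without being named through [derive1]. *)
Definition antiderivative F f := forall x : R, is_derive x 1 F (f x).

Lemma eq_antiderivative F f g : f =1 g -> antiderivative F f -> antiderivative F g.
Proof. by move=> fg FF x; rewrite -fg. Qed.

Lemma antiderivative_continuous F f : antiderivative F f -> continuous F.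
Proof.
move=> FF x; apply/differentiable_continuous/derivable1_diffP.
by have [] := FF x.
Qed.

Lemma antiderivative_MVT F f a b : antiderivative F f -> a <= b ->
  exists2 c, a <= c <= b & F b - F a = f c * (b - a).
Proof.
move=> FF ab; have [c] := @MVT_segment R F f a b ab (fun x _ => FF x)
  (continuous_subspaceT (antiderivative_continuous FF)).
by rewrite in_itv /=; exists c.
Qed.

Lemma antiderivative_bound F f a b C : antiderivative F f ->
  (forall c, Num.min a b <= c <= Num.max a b -> `|f c| <= C) ->
  `|F b - F a| <= C * `|b - a|.
Proof.
move=> FF fC; have [ab|/ltW ba] := leP a b.
  have [c cab ->] := antiderivative_MVT FF ab.
  rewrite normrM ler_wpM2r//; apply: fC.
  by rewrite (min_idPl ab) (max_idPr ab).
have [c cab e] := antiderivative_MVT FF ba.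
rewrite distrC e normrM (distrC b) ler_wpM2r//; apply: fC.
by rewrite (min_idPr ba) (max_idPl ba).
Qed.

Lemma antiderivative_lip F f C : antiderivative F f ->
  (forall c, `|f c| <= C) -> forall a b, `|F b - F a| <= C * `|b - a|.
Proof. by move=> FF fC a b; apply: antiderivative_bound FF _ => c _. Qed.

Lemma antiderivative_cst c : antiderivative (fun=> c) (fun=> 0).
Proof. by move=> x; exact: is_derive_cst. Qed.

Lemma antiderivative_id : antiderivative id (fun=> 1).
Proof. by move=> x; exact: is_derive_id. Qed.

Lemma antiderivativeD F G f g : antiderivative F f -> antiderivative G g ->
  antiderivative (fun x => F x + G x) (fun x => f x + g x).
Proof. by move=> FF GG x; exact: is_deriveD. Qed.

Lemma antiderivativeB F G f g : antiderivative F f -> antiderivative G g ->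
  antiderivative (fun x => F x - G x) (fun x => f x - g x).
Proof. by move=> FF GG x; exact: is_deriveB. Qed.

Lemma antiderivativeM F G f g : antiderivative F f -> antiderivative G g ->
  antiderivative (fun x => F x * G x) (fun x => f x * G x + F x * g x).
Proof.
move=> FF GG x; have := is_deriveM (FF x) (GG x).
by rewrite /GRing.scale/= addrC (mulrC (G x)).
Qed.

Lemma antiderivativeZ c F f : antiderivative F f ->
  antiderivative (fun x => c * F x) (fun x => c * f x).
Proof.
move=> FF; apply: eq_antiderivative (antiderivativeM (antiderivative_cst c) FF).
by move=> x; rewrite mul0r add0r.
Qed.

Lemma antiderivative_affine F f a b : antiderivative F f ->
  antiderivative (fun x => F (a * x + b)) (fun x => a * f (a * x + b)).
Proof.
move=> FF x; rewrite mulrC.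
have := antiderivativeD (antiderivativeZ a antiderivative_id)
  (antiderivative_cst b).
move/(_ x); rewrite mulr1 addr0 => h.
exact: (is_derive1_comp (FF _) h).
Qed.

Lemma antiderivativeX F f n : antiderivative F f ->
  antiderivative (fun x => F x ^+ n.+1) (fun x => n.+1%:R * F x ^+ n * f x).
Proof.
move=> FF; elim: n => [|n ih].
  by apply: eq_antiderivative FF => x; rewrite expr0 mulr1 mul1r.
have e : (fun x => F x * F x ^+ n.+1) = (fun x => F x ^+ n.+2).
  by apply/funext => x; rewrite [RHS]exprS.
rewrite -e.
apply: eq_antiderivative (antiderivativeM FF ih) => x.
by rewrite !exprS -[n.+2%:R]natr1; ring.
Qed.

Lemma antiderivative_sum (I : Type) (s : seq I) (F f : I -> R -> R) :
  (forall i, antiderivative (F i) (f i)) ->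
  antiderivative (fun x => \sum_(i <- s) F i x) (fun x => \sum_(i <- s) f i x).
Proof.
move=> FF; elim: s => [|i s ih].
  have -> : (fun x => \sum_(i <- [::]) F i x) = (fun=> 0).
    by apply/funext => x; rewrite big_nil.
  by apply: eq_antiderivative (antiderivative_cst 0) => x; rewrite big_nil.
have -> : (fun x => \sum_(j <- i :: s) F j x) =
    (fun x => F i x + \sum_(j <- s) F j x).
  by apply/funext => x; rewrite big_cons.
by apply: eq_antiderivative (antiderivativeD (FF i) ih) => x; rewrite big_cons.
Qed.

Lemma continuous_integrable_itv f a b : continuous f ->
  mu.-integrable `[a, b] (EFin \o f).
Proof.
move=> cf; apply: continuous_compact_integrable; first exact: segment_compact.
exact: continuous_subspaceT.
Qed.

Lemma antiderivative_FTC2 F f a b : a <= b -> continuous f ->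
  antiderivative F f -> \int[mu]_(x in `[a, b]) f x = F b - F a.
Proof.
rewrite le_eqVlt => /predU1P[<-|ab] cf FF.
  by rewrite set_itv1 Rintegral_set1 subrr.
have cF := antiderivative_continuous FF.
rewrite /Rintegral (@continuous_FTC2 _ _ F)//.
- exact: continuous_subspaceT.
- split=> [x _||]; first by have [] := FF x.
  + by apply: cvg_at_right_filter; exact: cF.
  + by apply: cvg_at_left_filter; exact: cF.
- by move=> x _; rewrite derive1E; have [] := FF x.
Qed.

Lemma Rintegral_itv_chasles f a x y : a <= x -> x <= y -> continuous f ->
  \int[mu]_(z in `[a, y]) f z - \int[mu]_(z in `[a, x]) f z =
  \int[mu]_(z in `[x, y]) f z.
Proof.
move=> ax xy cf.
have i1 := @continuous_integrable_itv f a y cf.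
rewrite (@Rintegral_itvB R f (BLeft a) (BRight y) x i1) ?bnd_simp//.
rewrite Rintegral_itv_obnd_cbnd//.
by apply: integrableS (continuous_integrable_itv x y cf) => //;
  exact: subset_itv_oc_cc.
Qed.

Lemma continuous_antiderivative f : continuous f ->
  exists2 F, antiderivative F f & F 0 = 0.
Proof.
move=> cf.
(* One of the two integrals runs over an empty set or a single point, so this is the oriented
   integral from 0. *)
pose F x := \int[mu]_(y in `[0, x]) f y - \int[mu]_(y in `[x, 0]) f y.
exists F; last by rewrite /F subrr.
(* Starting from a point [a] to the left of both [x] and 0, the oriented integral is [G y - G 0]
   near [x] whatever the sign of [y]. *)
move=> x; have [a ax a0] : exists2 a, a < x & a < 0.
  exists (Num.min x 0 - 1); rewrite ltrBlDr.
    by rewrite (@le_lt_trans _ _ x)// ?ge_min ?lexx// ltrDl.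
  by rewrite (@le_lt_trans _ _ 0)// ?ge_min ?lexx ?orbT// ltrDl.
pose G y := \int[mu]_(z in `[a, y]) f z.
have FG y : a < y -> F y = G y - G 0.
  have i0 u v : v < u -> \int[mu]_(z in `[u, v]) f z = 0.
    by move=> vu; rewrite set_itv_ge ?Rintegral_set0// bnd_simp -ltNge.
  move=> ay; rewrite /F /G; have [y0|y0] := leP 0 y.
    rewrite (Rintegral_itv_chasles (ltW a0) y0 cf).
    move: y0; rewrite le_eqVlt => /predU1P[<-|y0].
      by rewrite set_itv1 Rintegral_set1 subrr.
    by rewrite (i0 _ _ y0) subr0.
  by rewrite -[RHS]opprB (Rintegral_itv_chasles (ltW ay) (ltW y0) cf) i0// sub0r.
have [Gd GE] : derivable G x 1 /\ G^`()%classic x = f x.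
  apply: (@continuous_FTC1_closed _ f a x (x + 1)) => //; last exact: cf.
    by rewrite ltrDl.
  exact: continuous_integrable_itv.
have GG : is_derive x 1 (fun y => G y - G 0) (f x).
  rewrite -[f x]subr0; apply: is_deriveB; rewrite -GE derive1E; exact: derivableP.
apply: (near_eq_is_derive _ GG).
near=> y; rewrite FG//.
by near: y; exact: lt_nbhsr.
Unshelve. all: by end_near. Qed.

(** The Lipschitz bound on [g] controls the derivative of the first-order remainder [r1], and [r1]
    is the derivative of [r0]. Two mean value bounds then give the cube, without the optimal factor
    1/6. *)
Lemma antiderivative_taylor2 (H h g : R -> R) C a x :
  antiderivative H h -> antiderivative h g ->
  (forall y z, `|g y - g z| <= C * `|y - z|) ->
  `|H (a + x) - H a - h a * x - g a * x ^+ 2 / 2| <= C * `|x| ^+ 3.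
Proof.
move=> HH hh gC.
have C0 : 0 <= C.
  by have := gC 1 0; rewrite subr0 normr1 mulr1; exact: le_trans.
have sh (F f : R -> R) : antiderivative F f ->
    antiderivative (fun y => F (a + y)) (fun y => f (a + y)).
  move=> /(antiderivative_affine 1 a) h0 y; have := h0 y.
  rewrite !mul1r [y + a]addrC; congr is_derive.
  by apply/funext => z; rewrite mul1r addrC.
pose r1 y := h (a + y) - h a - g a * y.
pose r0 y := H (a + y) - H a - h a * y - g a / 2 * y ^+ 2.
have d1 : antiderivative r1 (fun y => g (a + y) - g a).
  apply: eq_antiderivative (antiderivativeB (antiderivativeB (sh _ _ hh)
    (antiderivative_cst (h a))) (antiderivativeZ (g a) antiderivative_id)) => y.
  by rewrite subr0 mulr1.
have d0 : antiderivative r0 r1.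
  apply: eq_antiderivative (antiderivativeB (antiderivativeB (antiderivativeB
    (sh _ _ HH) (antiderivative_cst (H a))) (antiderivativeZ (h a) antiderivative_id))
    (antiderivativeZ (g a / 2) (antiderivativeX 1 antiderivative_id))) => y.
  by rewrite /r1 /=; field.
have b1 y : `|r1 y| <= C * `|y| * `|y|.
  have -> : r1 y = r1 y - r1 0 by rewrite /r1 addr0 subrr mulr0 !subr0.
  have := @antiderivative_bound r1 _ 0 y (C * `|y|) d1; rewrite subr0; apply.
  move=> c cy; apply: (le_trans (gC _ _)); rewrite addrAC subrr add0r.
  apply: ler_wpM2l => //; rewrite ler_norml; move: cy.
  rewrite ge_min le_max => /andP[/orP[] h1 /orP[] h2];
  have := ler_norm y; have := ler_norm (- y); rewrite normrN; have := normr_ge0 y; lra.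
have -> : H (a + x) - H a - h a * x - g a * x ^+ 2 / 2 = r0 x - r0 0.
  by rewrite /r0 addr0 !subrr expr0n/= !mulr0 !subr0; ring.
rewrite (_ : C * _ = C * `|x| * `|x| * `|x|); last by ring.
have := @antiderivative_bound r0 _ 0 x (C * `|x| * `|x|) d0; rewrite subr0; apply.
move=> c cy; apply: (le_trans (b1 c)).
have cx : `|c| <= `|x|.
  rewrite ler_norml; move: cy.
  rewrite ge_min le_max => /andP[/orP[] h1 /orP[] h2];
  have := ler_norm x; have := ler_norm (- x); rewrite normrN; have := normr_ge0 x; lra.
by rewrite -!mulrA ler_wpM2l// ler_pM.
Qed.

Lemma periodic_intz f (z : int) x : (forall y, f (y + 1) = f y) ->
  f (x + z%:~R) = f x.
Proof.
move=> per; have pern n y : f (y + n%:R) = f y.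
  by elim: n y => [|n ih] y; rewrite ?addr0// -natr1 addrA per ih.
case: z => n; first exact: pern.
by rewrite NegzE mulrNz -[LHS](pern n.+1) subrK.
Qed.

Lemma periodic_bounded f : continuous f -> (forall x, f (x + 1) = f x) ->
  exists C, forall x, `|f x| <= C.
Proof.
move=> cf pf; have cnf : {within `[0, 1], continuous (fun x => `|f x|)}.
  apply: continuous_subspaceT => x; apply: continuous_comp; first exact: cf.
  exact: norm_continuous.
have [c _ hc] := EVT_max ler01 cnf; exists `|f c| => x.
pose y := x - (Num.floor x)%:~R.
have -> : x = y + (Num.floor x)%:~R by rewrite subrK.
rewrite periodic_intz//; apply: hc; rewrite in_itv /= subr_ge0 floor_le /=.
by rewrite lerBlDl; have := floorD1_gt x; rewrite intrD => /ltW.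
Qed.

(** Mean zero makes the primitive from 0 vanish at 1. Its increment over one period has derivative
    zero, so the primitive is periodic and its values are those on the unit interval, where it moves
    by at most [C]. *)
Lemma periodic_antiderivative f C : continuous f ->
  (forall x, f (x + 1) = f x) -> \int[mu]_(x in `[0, 1]) f x = 0 ->
  (forall x, `|f x| <= C) ->
  exists2 F, antiderivative F f & forall x, `|F x| <= C.
Proof.
move=> cf pf if0 fC; have [F FF F0] := continuous_antiderivative cf.
exists F => //.
have F1 : F 1 = 0.
  by move: if0; rewrite (antiderivative_FTC2 _ cf FF)// F0 subr0.
have per x : F (x + 1) = F x.
  have dF : antiderivative (fun y => F (1 * y + 1) - F y) (fun=> 0).
    apply: eq_antiderivative (antiderivativeB (antiderivative_affine 1 1 FF) FF) => y.
    by rewrite !mul1r pf subrr.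
  have := antiderivative_lip dF (fun=> le_refl _) 0 x.
  rewrite normr0 mul0r mulr0 add0r F1 F0 subrr subr0 mul1r normr_le0 subr_eq0.
  by move/eqP.
move=> x; pose y := x - (Num.floor x)%:~R.
have -> : x = y + (Num.floor x)%:~R by rewrite subrK.
rewrite (periodic_intz _ _ per); have y0 : 0 <= y by rewrite subr_ge0 floor_le.
have y1 : y <= 1 by rewrite lerBlDl; have := floorD1_gt x; rewrite intrD => /ltW.
have := antiderivative_lip FF fC 0 y; rewrite F0 !subr0 => /le_trans; apply.
by rewrite ger0_norm// ler_piMr//; exact: le_trans (fC 0).
Qed.

End Antiderivative.

(** * Expectations of variables with all moments *)

Section Expectation.
Context (d : measure_display) (T : measurableType d) (R : realType).
Variable P : probability T R.
Implicit Types X Y : T -> R.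

Definition Ex X : R := \int[P]_w X w.

(** All absolute moments are required because this class is stable under sums and products:
    integrability side conditions then reduce to closure lemmas. *)
Definition mom X := measurable_fun setT X /\
  forall p : nat, P.-integrable setT (EFin \o (fun w => `|X w| ^+ p)).

Lemma mom_meas X : mom X -> measurable_fun setT X.
Proof. by case. Qed.

Lemma mom_int X : mom X -> P.-integrable setT (EFin \o X).
Proof.
move=> [mX /(_ 1%N) iX]; apply: le_integrable iX => //.
  exact/measurable_EFinP.
by move=> x _ /=; rewrite lee_fin expr1 normr_id.
Qed.

Lemma mom_le X Y : measurable_fun setT X -> mom Y ->
  (forall w, `|X w| <= `|Y w|) -> mom X.
Proof.
move=> mX [mY iY] XY; split => // p; apply: le_integrable (iY p) => //.
  apply/measurable_EFinP/measurable_funX.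
  exact: measurableT_comp.
move=> x _ /=; rewrite lee_fin !normrX !normr_id.
by apply: lerXn2r; rewrite ?nnegrE.
Qed.

Lemma mom_cst c : mom (fun=> c).
Proof.
split; first exact: measurable_cst.
by move=> p; apply: finite_measure_integrable_cst.
Qed.

Lemma integrable_addle X p (f g : T -> R) : measurable_fun setT X ->
  P.-integrable setT (EFin \o f) -> P.-integrable setT (EFin \o g) ->
  (forall w, `|X w| ^+ p <= f w + g w) ->
  P.-integrable setT (EFin \o (fun w => `|X w| ^+ p)).
Proof.
move=> mX iF iG le.
have := integrableD measurableT iF iG; apply: le_integrable => //.
  apply/measurable_EFinP/measurable_funX.
  exact: measurableT_comp.
move=> x _ /=; rewrite lee_fin ger0_norm ?exprn_ge0//.
exact: le_trans (le x) (ler_norm _).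
Qed.

Lemma momD X Y : mom X -> mom Y -> mom (fun w => X w + Y w).
Proof.
move=> [mX iX] [mY iY]; split; first exact: measurable_funD.
move=> p; apply: (@integrable_addle _ p (fun w => 2 ^+ p * `|X w| ^+ p)
    (fun w => 2 ^+ p * `|Y w| ^+ p)).
- exact: measurable_funD.
- exact: (integrableZl measurableT (2 ^+ p) (iX p)).
- exact: (integrableZl measurableT (2 ^+ p) (iY p)).
move=> w; wlog XY : X Y {mX iX mY iY} / `|X w| <= `|Y w|.
  move=> h; have [/h //|/ltW/h] := leP `|X w| `|Y w|.
  by rewrite addrC [leRHS]addrC.
apply: (@le_trans _ _ (2 ^+ p * `|Y w| ^+ p)); last first.
  by rewrite lerDr mulr_ge0 ?exprn_ge0.
rewrite -exprMn lerXn2r ?nnegrE ?mulr_ge0//.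
by rewrite (le_trans (ler_normD _ _))// mulr_natl mulr2n lerD2r.
Qed.

Lemma momM X Y : mom X -> mom Y -> mom (fun w => X w * Y w).
Proof.
move=> [mX iX] [mY iY]; split; first exact: measurable_funM.
move=> p; apply: (@integrable_addle _ p (fun w => `|X w| ^+ (p * 2))
    (fun w => `|Y w| ^+ (p * 2))) => //.
  exact: measurable_funM.
move=> w; rewrite normrM exprMn !exprM.
set x := `|X w| ^+ p; set y := `|Y w| ^+ p.
have := sqr_ge0 (x - y); have := sqr_ge0 x; have := sqr_ge0 y; nra.
Qed.

Lemma momN X : mom X -> mom (fun w => - X w).
Proof.
move=> mX; apply: (mom_le _ mX); last by move=> w; rewrite normrN.
by apply: measurableT_comp => //; exact: mom_meas.
Qed.

Lemma momB X Y : mom X -> mom Y -> mom (fun w => X w - Y w).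
Proof. by move=> mX mY; apply: momD => //; exact: momN. Qed.

Lemma momZ c X : mom X -> mom (fun w => c * X w).
Proof. by move=> mX; apply: momM => //; exact: mom_cst. Qed.

Lemma momX X n : mom X -> mom (fun w => X w ^+ n).
Proof.
move=> mX; elim: n => [|n ih]; first exact: mom_cst.
by under eq_fun do rewrite exprS; exact: momM.
Qed.

Lemma mom_norm X : mom X -> mom (fun w => `|X w|).
Proof.
move=> mX; apply: (mom_le _ mX); last by move=> w; rewrite normr_id.
by apply: measurableT_comp => //; exact: mom_meas.
Qed.

Lemma mom_bounded X C : measurable_fun setT X -> (forall w, `|X w| <= C) -> mom X.
Proof.
move=> mX XC; apply: (mom_le mX (mom_cst C)) => w.
exact: le_trans (XC w) (ler_norm _).
Qed.

Lemma mom_sum (I : Type) (s : seq I) (F : I -> T -> R) :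
  (forall i, mom (F i)) -> mom (fun w => \sum_(i <- s) F i w).
Proof.
move=> mF; elim: s => [|i s ih].
  by under eq_fun do rewrite big_nil; exact: mom_cst.
by under eq_fun do rewrite big_cons; exact: momD.
Qed.

Lemma ExD X Y : mom X -> mom Y -> Ex (fun w => X w + Y w) = Ex X + Ex Y.
Proof. by move=> mX mY; apply: RintegralD => //; exact: mom_int. Qed.

Lemma ExB X Y : mom X -> mom Y -> Ex (fun w => X w - Y w) = Ex X - Ex Y.
Proof. by move=> mX mY; apply: RintegralB => //; exact: mom_int. Qed.

Lemma ExZ c X : mom X -> Ex (fun w => c * X w) = c * Ex X.
Proof. by move=> mX; apply: RintegralZl => //; exact: mom_int. Qed.

Lemma Ex_cst c : Ex (fun=> c) = c.
Proof.
rewrite /Ex Rintegral_cst// -[RHS]mulr1; congr (_ * _).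
exact: (congr1 fine (probability_setT P)).
Qed.

Lemma Ex_ge0 X : (forall w, 0 <= X w) -> 0 <= Ex X.
Proof. by move=> X0; apply: Rintegral_ge0 => w _; exact: X0. Qed.

Lemma Ex_le X Y : mom X -> mom Y -> (forall w, X w <= Y w) -> Ex X <= Ex Y.
Proof. by move=> mX mY XY; apply: le_Rintegral => //; exact: mom_int. Qed.

Lemma Ex_norm X : mom X -> `|Ex X| <= Ex (fun w => `|X w|).
Proof. by move=> mX; apply: le_normr_Rintegral => //; exact: mom_int. Qed.

Lemma eq_Ex X Y : X =1 Y -> Ex X = Ex Y.
Proof. by move=> XY; apply: eq_Rintegral => w _; exact: XY. Qed.

Lemma Ex_sum (I : Type) (s : seq I) (F : I -> T -> R) :
  (forall i, mom (F i)) ->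
  Ex (fun w => \sum_(i <- s) F i w) = \sum_(i <- s) Ex (F i).
Proof.
move=> mF; elim: s => [|i s ih].
  by rewrite big_nil; under eq_Ex do rewrite big_nil; exact: Ex_cst.
rewrite big_cons; under eq_Ex do rewrite big_cons.
by rewrite ExD ?ih//; exact: mom_sum.
Qed.

(* The discriminant of the nonnegative quadratic [c |-> E (X - c Y)^2]. *)
Lemma Ex_CS X Y : mom X -> mom Y ->
  Ex (fun w => X w * Y w) ^+ 2 <=
  Ex (fun w => X w ^+ 2) * Ex (fun w => Y w ^+ 2).
Proof.
move=> mX mY; set a := Ex (fun w => X w ^+ 2); set b := Ex (fun w => Y w ^+ 2).
set c := Ex _.
have mXX := momX 2 mX; have mYY := momX 2 mY; have mXY := momM mX mY.
have quad s r : 0 <= s ^+ 2 * a - 2 * s * r * c + r ^+ 2 * b.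
  have -> : s ^+ 2 * a - 2 * s * r * c + r ^+ 2 * b =
      Ex (fun w => (s * X w - r * Y w) ^+ 2).
    transitivity (Ex (fun w => s ^+ 2 * X w ^+ 2
        - (2 * s * r) * (X w * Y w) + r ^+ 2 * Y w ^+ 2)).
      rewrite ExD ?ExB ?ExZ//; do ?[apply: momB|apply: momZ]; by [].
    by apply: eq_Ex => w; ring.
  by apply: Ex_ge0 => w; exact: sqr_ge0.
have a0 : 0 <= a by apply: Ex_ge0 => w; exact: sqr_ge0.
have b0 : 0 <= b by apply: Ex_ge0 => w; exact: sqr_ge0.
have [b00|] := eqVneq b 0.
  rewrite b00 mulr0.
  rewrite leNgt; apply/negP => cgt0.
  (* With [b = 0] the form is affine in [r], and this value of [r] makes it equal to -1. *)
  have := quad 1 ((a + 1) / (2 * c ^+ 2) * c).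
  have c2 : c ^+ 2 != 0 by rewrite gt_eqF.
  rewrite b00 mulr0 addr0 expr1n mul1r mulr1.
  have -> : 2 * ((a + 1) / (2 * c ^+ 2) * c) * c = a + 1 by field; rewrite -sqrf_eq0.
  lra.
move=> bn0; have bp : 0 < b by rewrite lt0r bn0.
(* The minimising ratio, cleared of its denominator [b]. *)
have := quad b c.
have -> : b ^+ 2 * a - 2 * b * c * c + c ^+ 2 * b = b * (a * b - c ^+ 2) by ring.
by rewrite pmulr_rge0// subr_ge0.
Qed.

End Expectation.

(** * Gaussian moments and integration by parts *)

Section GaussianDensity.
Context (d : measure_display) (T : measurableType d) (R : realType).
Variable P : probability T R.
Notation mu := (@lebesgue_measure R).

Definition gaussian (s : R) (xi : T -> R) := measurable_fun setT xi /\
  forall A : set R, measurable A -> P (xi @^-1` A) = normal_prob 0 s A.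

(** The Radon-Nikodym derivative of the normal law and [normal_pdf] have the same integral over
    every measurable set, hence agree almost everywhere. *)
Lemma ge0_integral_normal_prob (s : R) (f : R -> R) :
  measurable_fun setT f -> (forall x, 0 <= f x) ->
  (\int[normal_prob 0%R s]_x (f x)%:E = \int[mu]_x (f x * normal_pdf 0 s x)%:E)%E.
Proof.
move=> mf f0.
have dom := @normal_prob_dominates R 0 s.
have mEf : measurable_fun setT (EFin \o f) by exact/measurable_EFinP.
have Ef0 x : (0 <= (EFin \o f) x)%E by rewrite lee_fin.
have <- := @Radon_Nikodym_SigmaFinite.change_of_variables _ _ _ _ _ dom _ _
  Ef0 measurableT mEf.
under [RHS]eq_integral do rewrite EFinM.
have iRN := Radon_Nikodym_SigmaFinite.f_integrable dom.
apply: ae_eq_integral => //.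
- by apply: emeasurable_funM => //; exact: (measurable_int mu).
- apply: emeasurable_funM; apply/measurable_EFinP => //.
  exact: measurable_normal_pdf.
- apply: ae_eqe_mul2l => /=.
  apply: integral_ae_eq => //=.
  + by apply/measurable_EFinP; exact: measurable_normal_pdf.
  + by move=> E ET mE; rewrite -Radon_Nikodym_SigmaFinite.f_integral.
Qed.

Variables (s : R) (xi : T -> R).
Hypothesis gxi : gaussian s xi.

Lemma ge0_integral_gaussian (f : R -> R) :
  measurable_fun setT f -> (forall x, 0 <= f x) ->
  (\int[P]_w (f (xi w))%:E = \int[mu]_x (f x * normal_pdf 0 s x)%:E)%E.
Proof.
move=> mf f0; rewrite -ge0_integral_normal_prob//.
have [mxi lxi] := gxi.
have mxi' : @measurable_fun _ _ T (measurableTypeR R) setT xi by exact: mxi.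
pose X : {RV P >-> measurableTypeR R} :=
  @mfun_Sub _ _ T (measurableTypeR R) xi (mem_set mxi').
have <- := @ge0_integral_distribution _ _ T (measurableTypeR R) R P X (EFin \o f).
- by apply: eq_measure_integral => A mA _; exact: lxi.
- exact/measurable_EFinP.
- by move=> x; rewrite lee_fin.
Qed.

Lemma integrable_gaussian (f : R -> R) : measurable_fun setT f ->
  mu.-integrable setT (fun x => (f x * normal_pdf 0 s x)%:E) ->
  P.-integrable setT (EFin \o (f \o xi)).
Proof.
move=> mf /integrableP[_ fin].
apply/integrableP; split.
  by apply/measurable_EFinP; apply: measurableT_comp => //; exact: gxi.1.
rewrite /= (@ge0_integral_gaussian (fun x => `|f x|))//=; last first.
  exact: measurableT_comp.
apply: le_lt_trans fin; apply: ge0_le_integral => //=.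
- by move=> x _; rewrite lee_fin mulr_ge0// normal_pdf_ge0.
- apply/measurable_EFinP/measurable_funM.
    exact: measurableT_comp.
  exact: measurable_normal_pdf.
- apply/measurable_EFinP; apply: measurableT_comp => //.
  by apply: measurable_funM => //; exact: measurable_normal_pdf.
by move=> x _; rewrite lee_fin normrM (ger0_norm (normal_pdf_ge0 _ _ _)).
Qed.

(** The transfer for nonnegative functions is applied to [f + |f|] and to [|f|], and the second is
    cancelled. *)
Lemma Ex_gaussian (f : R -> R) : measurable_fun setT f ->
  mu.-integrable setT (fun x => (f x * normal_pdf 0 s x)%:E) ->
  Ex P (f \o xi) = \int[mu]_x (f x * normal_pdf 0 s x).
Proof.
move=> mf ifp.
have mnf : measurable_fun setT (fun x => `|f x|) by exact: measurableT_comp.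
have inf : mu.-integrable setT (fun x => (`|f x| * normal_pdf 0 s x)%:E).
  apply: le_integrable ifp => //.
    by apply/measurable_EFinP/measurable_funM => //; exact: measurable_normal_pdf.
  by move=> x _; rewrite lee_fin !normrM normr_id.
have e1 : Ex P (fun w => `|f (xi w)|) = \int[mu]_x (`|f x| * normal_pdf 0 s x).
  by congr fine; rewrite (@ge0_integral_gaussian (fun x => `|f x|)).
have e2 : Ex P (fun w => f (xi w) + `|f (xi w)|) =
    \int[mu]_x ((f x + `|f x|) * normal_pdf 0 s x).
  congr fine; rewrite (@ge0_integral_gaussian (fun x => f x + `|f x|))//.
    exact: measurable_funD.
  by move=> x; rewrite -lerBlDl sub0r -normrN ler_norm.
apply: (@addIr _ (Ex P (fun w => `|f (xi w)|))).
rewrite [in RHS]e1 -(RintegralD measurableT ifp inf).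
transitivity (Ex P (fun w => f (xi w) + `|f (xi w)|)).
  rewrite /Ex RintegralD//; first exact: integrable_gaussian.
  exact: (@integrable_gaussian (fun x => `|f x|)).
by rewrite e2; apply: eq_Rintegral => x _; rewrite mulrDl.
Qed.

End GaussianDensity.

(** * Polynomial moments of the Gaussian density *)

Section GaussianMoments.
Context (R : realType).
Notation mu := (@lebesgue_measure R).

Lemma exprn_le_expR (x : R) n : 0 <= x -> x ^+ n <= n%:R ^+ n * expR x.
Proof.
move=> x0; case: n => [|n].
  by rewrite !expr0 mul1r -expR0 ler_expR.
have n0 : 0 < n.+1%:R :> R by [].
have h : x / n.+1%:R <= expR (x / n.+1%:R).
  by apply: le_trans (expR_ge1Dx _); rewrite lerDr.
rewrite -ler_pdivrMl ?exprn_gt0// -exprVn -exprMn mulrC.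
have -> : expR x = expR (x / n.+1%:R) ^+ n.+1.
  by rewrite -expRM_natl mulrC divfK// gt_eqF.
by rewrite lerXn2r ?nnegrE ?expR_ge0// divr_ge0// ltW.
Qed.

(** Doubling the standard deviation multiplies the Gaussian exponential by exp (a x^2), which
    absorbs every power of [x]. *)
Lemma normal_moment_bound (s : R) p : 0 < s ->
  exists2 C, 0 <= C & forall x,
   `|x| ^+ p * normal_pdf 0 s x <= C * normal_pdf 0 (s * 2) x + normal_pdf 0 s x.
Proof.
move=> s0; have s20 : 0 < s * 2 by rewrite mulr_gt0.
(* The difference between 1 / (2 s^2) and 1 / (8 s^2), the rates of the two densities. *)
pose a := 3 / 8 / s ^+ 2.
have a0 : 0 < a by rewrite !divr_gt0// ?mulr_gt0// exprn_gt0.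
exists (a ^- p * p%:R ^+ p * normal_peak s / normal_peak (s * 2)).
  rewrite !mulr_ge0// ?invr_ge0 ?exprn_ge0// ?normal_peak_ge0//. exact: ltW.
move=> x.
have pk0 := normal_peak_gt0 (lt0r_neq0 s20).
(* Passing to even powers matches the square in the exponential; the added 1 is the origin of the
   second density in the bound. *)
have p2 : `|x| ^+ p <= (x ^+ 2) ^+ p + 1.
  have -> : (x ^+ 2) ^+ p = `|x| ^+ p * `|x| ^+ p.
    by rewrite -exprMn -expr2 real_normK// num_real.
  have := exprn_ge0 p (normr_ge0 x); set y := `|x| ^+ p => y0.
  have := sqr_ge0 (y - 1); nra.
have e : (x ^+ 2) ^+ p * normal_fun 0 s x <=
    a ^- p * p%:R ^+ p * normal_fun 0 (s * 2) x.
  rewrite -mulrA ler_pdivlMl ?exprn_gt0// mulrA -exprMn.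
  have := @exprn_le_expR (a * x ^+ 2) p; rewrite (mulr_ge0 (ltW a0) (sqr_ge0 x)) => /(_ isT) h.
  have -> : normal_fun 0 (s * 2) x = expR (a * x ^+ 2) * normal_fun 0 s x.
    rewrite /normal_fun -expRD; congr expR; rewrite !subr0 /a.
    by field; rewrite gt_eqF.
  by rewrite [leRHS]mulrA ler_wpM2r// normal_fun_ge0.
rewrite !normal_pdfE ?gt_eqF//.
have -> : a ^- p * p%:R ^+ p * normal_peak s / normal_peak (s * 2) *
   (normal_peak (s * 2) * normal_fun 0 (s * 2) x) =
   normal_peak s * (a ^- p * p%:R ^+ p * normal_fun 0 (s * 2) x).
  by field; apply/andP; split; rewrite gt_eqF// exprn_gt0.
rewrite -mulrDr mulrCA ler_wpM2l ?normal_peak_ge0//.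
have := normal_fun_ge0 0 s x; move: e p2; set u := normal_fun 0 s x; nra.
Qed.

Lemma integrable_normal_moment (s : R) p : 0 < s ->
  mu.-integrable setT (fun x => (`|x| ^+ p * normal_pdf 0 s x)%:E).
Proof.
move=> s0; have [C C0 hC] := normal_moment_bound p s0.
have i1 := integrableZl measurableT C (@integrable_normal_pdf R 0 (s * 2)).
have i2 := @integrable_normal_pdf R 0 s.
apply: le_integrable (integrableD measurableT i1 i2) => //.
  apply/measurable_EFinP/measurable_funM; last exact: measurable_normal_pdf.
  by apply: measurable_funX; exact: normr_measurable.
move=> x _; rewrite lee_fin ger0_norm ?mulr_ge0 ?exprn_ge0 ?normal_pdf_ge0//.
by rewrite (le_trans (hC x))//= ler_norm.
Qed.

End GaussianMoments.

(** * Stein's identity against the Gaussian density *)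

Section Stein.
Context (R : realType).
Notation mu := (@lebesgue_measure R).
Implicit Types (F f : R -> R) (s x C : R).

(** A class on which the Gaussian integrals converge. The base [1 + |x|] is at least 1, so that
    products only add exponents. *)
Definition poly_growth F := exists (C : R) (p : nat), forall x, `|F x| <= C * (1 + `|x|) ^+ p.

Lemma poly_growth_bounded F C : (forall x, `|F x| <= C) -> poly_growth F.
Proof. by move=> FC; exists C, 0%N => x; rewrite expr0 mulr1. Qed.

Lemma exprD1_le x p : 0 <= x -> (1 + x) ^+ p <= 2 ^+ p * (1 + x ^+ p).
Proof.
move=> x0; have [x1|/ltW x1] := leP x 1.
  apply: (@le_trans _ _ (2 ^+ p)).
    by rewrite lerXn2r ?nnegrE ?addr_ge0// -[2]/(1 + 1) lerD2l.
  by rewrite ler_peMr ?exprn_ge0// lerDl exprn_ge0.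
apply: (@le_trans _ _ (2 ^+ p * x ^+ p)).
  rewrite -exprMn lerXn2r ?nnegrE ?addr_ge0 ?mulr_ge0//.
  by rewrite mulr_natl mulr2n lerD2r.
by rewrite ler_wpM2l ?exprn_ge0// lerDr.
Qed.

Lemma poly_growthE F : poly_growth F ->
  exists (C : R) (p : nat), 0 <= C /\ forall x, `|F x| <= C * (1 + `|x| ^+ p).
Proof.
move=> [C [p FC]]; exists (`|C| * 2 ^+ p), p; split.
  by rewrite mulr_ge0 ?exprn_ge0.
move=> x; apply: (le_trans (FC x)).
rewrite -mulrA; apply: (@le_trans _ _ (`|C| * (1 + `|x|) ^+ p)).
  by rewrite ler_wpM2r ?exprn_ge0 ?addr_ge0 ?ler_norm.
by rewrite ler_wpM2l ?exprD1_le.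
Qed.

Lemma poly_growthM F f : poly_growth F -> poly_growth f ->
  poly_growth (fun x => F x * f x).
Proof.
move=> [C [p FC]] [D [q fD]]; exists (C * D), (p + q)%N => x.
by rewrite normrM exprD mulrACA ler_pM.
Qed.

Lemma poly_growth_id : poly_growth (@id R).
Proof. by exists 1, 1%N => x; rewrite mul1r expr1 lerDr. Qed.

Lemma poly_growthX n : poly_growth (fun x : R => x ^+ n).
Proof.
elim: n => [|n ih]; first by apply: (@poly_growth_bounded _ 1) => x; rewrite expr0 normr1.
under eq_fun do rewrite exprS.
exact: poly_growthM poly_growth_id ih.
Qed.

Lemma poly_growthZ c F : poly_growth F -> poly_growth (fun x => c * F x).
Proof. by apply: poly_growthM; exact: (@poly_growth_bounded _ `|c|). Qed.

Lemma poly_growth_lip F C : (forall x y, `|F x - F y| <= C * `|x - y|) ->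
  poly_growth F.
Proof.
move=> FC; have C0 : 0 <= C.
  by have := FC 1 0; rewrite subr0 normr1 mulr1; exact: le_trans.
exists (`|F 0| + C), 1%N => x; rewrite expr1.
have := FC x 0; rewrite subr0 => h.
have : `|F x| <= `|F 0| + `|F x - F 0|.
  by rewrite -{1}[F x](subrK (F 0)) addrC ler_normD.
have := normr_ge0 (F 0); have := normr_ge0 x; nra.
Qed.

Lemma integrable_poly_growth F s : 0 < s -> measurable_fun setT F -> poly_growth F ->
  mu.-integrable setT (fun x => (F x * normal_pdf 0 s x)%:E).
Proof.
move=> s0 mF /poly_growthE[C [p [C0 FC]]].
have i1 := integrableZl measurableT C (integrable_normal_moment p s0).
have i2 := integrableZl measurableT C (@integrable_normal_pdf R 0 s).
apply: le_integrable (integrableD measurableT i1 i2) => //.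
  by apply/measurable_EFinP/measurable_funM => //; exact: measurable_normal_pdf.
move=> x _; rewrite lee_fin normrM (ger0_norm (normal_pdf_ge0 _ _ _)) /=.
apply: le_trans (ler_norm _).
rewrite [leRHS](_ : _ = C * (1 + `|x| ^+ p) * normal_pdf 0 s x); last by ring.
by rewrite ler_wpM2r ?normal_pdf_ge0.
Qed.

Lemma normal_pdf_is_derive s x : s != 0 ->
  is_derive x 1 (normal_pdf 0 s) (- x / s ^+ 2 * normal_pdf 0 s x).
Proof.
move=> s0; rewrite normal_pdfE// /normal_fun.
have d1 : is_derive x 1 (fun y : R => - (y - 0) ^+ 2 / (s ^+ 2 *+ 2)) (- x / s ^+ 2).
  have := antiderivativeZ (- (s ^+ 2 *+ 2)^-1) (antiderivativeX 1 (@antiderivative_id R)).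
  move/(_ x); congr is_derive.
    by apply/funext => y; rewrite subr0 mulrC mulNr mulrN.
  by rewrite expr1 mulr1; field.
have d2 := is_derive1_comp (is_derive_expR _) d1.
have := is_deriveZ (normal_peak s) d2.
congr is_derive; rewrite /GRing.scale/=; ring.
Qed.

(** Using the moment bound with one extra power, n times the absolute value of the sequence stays
    below the constant [B]. *)
Lemma poly_growth_pdf_cvg0 F s : 0 < s -> poly_growth F ->
  (fun n : nat => F n%:R * normal_pdf 0 s n%:R) @ \oo --> (0 : R).
Proof.
move=> s0 /poly_growthE[C [p [C0 FC]]].
have s20 : 0 < s * 2 by rewrite mulr_gt0.
have [D D0 hD] := normal_moment_bound p.+1 s0.
have [D' D'0 hD'] := normal_moment_bound 1 s0.
pose B := C * (D + D') * normal_peak (s * 2) + C * normal_peak s + C * normal_peak s.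
apply/cvgr0Pnorm_le => e e0.
have B0 : 0 <= B.
  by rewrite !addr_ge0 ?mulr_ge0 ?addr_ge0 ?normal_peak_ge0.
near=> n.
have n0 : 0 < n%:R :> R by rewrite ltr0n; near: n; exact: nbhs_infty_gt.
have Bn : B / e <= n%:R by near: n; exact: nbhs_infty_ger.
rewrite ler_pdivrMr// mulrC in Bn.
rewrite normrM (ger0_norm (normal_pdf_ge0 _ _ _)).
have h1 := hD n%:R; have h2 := hD' n%:R.
rewrite ger0_norm ?ler0n// expr1 in h2.
rewrite ger0_norm ?ler0n// in h1.
have h3 := FC n%:R; rewrite normr_nat in h3.
have pk1 := @normal_pdf_ub R 0 (s * 2) n%:R (lt0r_neq0 s20).
have pk2 := @normal_pdf_ub R 0 s n%:R (lt0r_neq0 s0).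
rewrite -(ler_pM2l n0); apply: le_trans (_ : B <= _); last by rewrite mulrC.
apply: le_trans (_ : n%:R * (C * (1 + n%:R ^+ p) * normal_pdf 0 s n%:R) <= _).
  apply: ler_wpM2l; first exact: ler0n.
  by apply: ler_wpM2r => //; exact: normal_pdf_ge0.
have -> : n%:R * (C * (1 + n%:R ^+ p) * normal_pdf 0 s n%:R) =
  C * (n%:R ^+ p.+1 * normal_pdf 0 s n%:R + n%:R * normal_pdf 0 s n%:R).
  by rewrite exprS; ring.
apply: le_trans (_ : C * (D * normal_pdf 0 (s * 2) n%:R + normal_pdf 0 s n%:R +
   (D' * normal_pdf 0 (s * 2) n%:R + normal_pdf 0 s n%:R)) <= _).
  by rewrite ler_wpM2l// lerD.
apply: le_trans (_ : C * (D * normal_peak (s * 2) + normal_peak s +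
   (D' * normal_peak (s * 2) + normal_peak s)) <= _).
  by rewrite ler_wpM2l// !lerD// ler_wpM2l.
by rewrite /B le_eqVlt; apply/orP; left; apply/eqP; ring.
Unshelve. all: by end_near. Qed.

Lemma Rintegral_centered_cvg (g : R -> R) : continuous g ->
  mu.-integrable setT (EFin \o g) ->
  (fun n : nat => \int[mu]_(x in `[- n%:R, n%:R]) g x) @ \oo --> \int[mu]_x g x.
Proof.
move=> cg ig.
pose A (n : nat) : set R := `[- n%:R, n%:R]%classic.
pose fn n := EFin \o (g \_ (A n)).
have mfn n : measurable_fun setT (fn n).
  apply/measurable_EFinP/(measurable_restrictT _ _).1 => //.
    exact: measurable_itv.
  exact: measurable_funTS (continuous_measurable_fun cg).
have := @dominated_convergence _ _ R mu setT measurableT fn (EFin \o g)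
  (fun x => `|g x|%:E) mfn (measurable_int mu ig).
case.
- apply: aeW => x _; apply: cvg_near_cst.
  near=> n; rewrite /fn /= patchE mem_set//; rewrite /A /= in_itv/= -ler_norml.
  by near: n; exact: nbhs_infty_ger.
- by apply: integrable_norm.
- apply: aeW => x n _; rewrite /fn/= lee_fin patchE.
  by case: ifPn => _; rewrite ?normr0.
move=> _ _ h.
have := h; rewrite -[X in _ --> X]fineK; last exact: integrable_fin_num.
move/fine_cvg; apply: cvg_trans; apply: near_eq_cvg; near=> n.
rewrite /= /Rintegral [in RHS]integral_mkcond; congr fine.
by apply: eq_integral => x _; rewrite /fn /= !patchE; case: ifPn.
Unshelve. all: by end_near. Qed.

(** Up to the factor s^2, the difference of the two integrands is the derivative of [F] times the
    density, and the boundary terms at n and -n vanish. *)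
Lemma stein_lebesgue F f s : 0 < s -> antiderivative F f -> continuous f ->
  poly_growth F -> poly_growth f ->
  \int[mu]_x (F x * x * normal_pdf 0 s x) =
  s ^+ 2 * \int[mu]_x (f x * normal_pdf 0 s x).
Proof.
move=> s0 FF cf gF gf; have sn0 := lt0r_neq0 s0.
have cF := antiderivative_continuous FF.
have mF := continuous_measurable_fun cF.
have mf := continuous_measurable_fun cf.
have cq := @continuous_normal_pdf R 0 s sn0.
have i1 := integrable_poly_growth s0 mf gf.
have mFx : measurable_fun setT (fun x => F x * x) by exact: measurable_funM.
have i2 := integrable_poly_growth s0 mFx (poly_growthM gF poly_growth_id).
pose g x := f x * normal_pdf 0 s x - s ^- 2 * (F x * x * normal_pdf 0 s x).
have i3 := integrableZl measurableT (s ^- 2) i2.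
have ig : mu.-integrable setT (EFin \o g) by exact: (integrableB measurableT i1 i3).
have Gg : antiderivative (fun x => F x * normal_pdf 0 s x) g.
  apply: eq_antiderivative (antiderivativeM FF (fun x => normal_pdf_is_derive x sn0)).
  by move=> x; rewrite /g; field.
have cg : continuous g.
  move=> x; apply: cvgB; first by apply: cvgM; [exact: cf|exact: cq].
  apply: cvgM; first exact: cvg_cst.
  by apply: cvgM; [apply: cvgM; [exact: cF|exact: cvg_id]|exact: cq].
have e : \int[mu]_x g x = 0.
  have h1 := Rintegral_centered_cvg cg ig.
  have h2 : (fun n : nat => \int[mu]_(x in `[- n%:R, n%:R]) g x) @ \oo --> (0 : R).
    rewrite (_ : (fun n : nat => _) = (fun n : nat => F n%:R * normal_pdf 0 s n%:R
       - F (- n%:R) * normal_pdf 0 s n%:R)); last first.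
      apply/funext => n; rewrite (antiderivative_FTC2 _ cg Gg); last first.
        by rewrite -subr_ge0 opprK addr_ge0.
      by rewrite {2}/normal_pdf (negbTE sn0) /normal_fun !subr0 sqrrN
        !normal_pdfE // /normal_fun subr0.
    rewrite -[X in _ --> X]subr0; apply: cvgB; first exact: poly_growth_pdf_cvg0.
    apply: (@poly_growth_pdf_cvg0 (fun x => F (- x))) => //.
    by case: gF => C [p FC]; exists C, p => x; rewrite -(normrN x); exact: FC.
  exact: cvg_unique h1 h2.
move: e; rewrite RintegralB// RintegralZl// => /eqP; rewrite subr_eq0 => /eqP ->.
by rewrite mulrA divff ?mul1r// expf_neq0.
Qed.

End Stein.

Section SteinRV.
Context (d : measure_display) (T : measurableType d) (R : realType).
Variable P : probability T R.
Variables (s : R) (xi : T -> R).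
Hypotheses (s0 : 0 < s) (gxi : gaussian P s xi).

Lemma mom_gaussian (F : R -> R) : measurable_fun setT F -> poly_growth F ->
  mom P (F \o xi).
Proof.
move=> mF gF; split; first exact: measurableT_comp (gxi.1).
move=> p; have := @integrable_gaussian _ _ _ P s xi gxi (fun x => `|F x| ^+ p).
apply; first exact/measurable_funX/measurableT_comp.
apply: integrable_poly_growth => //; first exact/measurable_funX/measurableT_comp.
case: gF => C [q FC]; exists (`|C| ^+ p), (q * p)%N => x.
rewrite normrX normr_id exprM -exprMn lerXn2r ?nnegrE ?mulr_ge0 ?exprn_ge0 ?addr_ge0//.
by rewrite (le_trans (FC x))// ler_wpM2r ?exprn_ge0 ?addr_ge0 ?ler_norm.
Qed.

Lemma mom_gaussian_id : mom P xi.
Proof. exact: (@mom_gaussian id _ (@poly_growth_id R)). Qed.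

Lemma stein (F f : R -> R) : antiderivative F f -> continuous f ->
  poly_growth F -> poly_growth f ->
  Ex P (fun w => F (xi w) * xi w) = s ^+ 2 * Ex P (fun w => f (xi w)).
Proof.
move=> FF cf gF gf.
have mF := continuous_measurable_fun (antiderivative_continuous FF).
have mf := continuous_measurable_fun cf.
have mFx : measurable_fun setT (fun x => F x * x) by exact: measurable_funM.
have i2 := integrable_poly_growth s0 mFx (poly_growthM gF (@poly_growth_id R)).
rewrite (@Ex_gaussian _ _ _ P s xi gxi f)//; last exact: integrable_poly_growth.
rewrite -(stein_lebesgue s0 FF cf gF gf).
exact: (@Ex_gaussian _ _ _ P s xi gxi (fun x => F x * x)).
Qed.

(** Stein's identity for the power n + 1. The recursion yields the second, fourth and sixth moments
    used on the grid. *)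
Lemma gaussian_moment n :
  Ex P (fun w => xi w ^+ n.+2) = s ^+ 2 * (n.+1%:R * Ex P (fun w => xi w ^+ n)).
Proof.
have FF := antiderivativeX n (@antiderivative_id R).
have e x : n.+1%:R * id x ^+ n * 1 = n.+1%:R * x ^+ n :> R by rewrite mulr1.
have := stein (eq_antiderivative e FF); rewrite /= => h.
rewrite -(ExZ n.+1%:R); last first.
  exact: (@mom_gaussian (fun x => x ^+ n) _ (poly_growthX _ n)).
rewrite -h.
- by apply: eq_Ex => w; rewrite [LHS]exprS mulrC.
- by move=> x; apply: cvgM; [exact: cvg_cst|exact: exprn_continuous].
- exact: (@poly_growthX R n.+1).
- exact/poly_growthZ/poly_growthX.
Qed.

Lemma gaussian_variance : Ex P (fun w => xi w ^+ 2) = s ^+ 2.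
Proof.
rewrite (gaussian_moment 0) mul1r (eq_Ex _ (Y := fun=> 1)) ?Ex_cst ?mulr1//.
Qed.

End SteinRV.

(** * Independence *)

Section Independence.
Context (d : measure_display) (T : measurableType d) (R : realType).
Variable P : probability T R.

Definition indep (d' : measure_display) (E : measurableType d') (U : T -> E)
    (xi : T -> R) := [/\ measurable_fun setT U, measurable_fun setT xi &
  forall A B, measurable A -> measurable B ->
    P (U @^-1` A `&` xi @^-1` B) = (P (U @^-1` A) * P (xi @^-1` B))%E].

(** The joint law is the product of the marginals, so by Fubini [xi] can be integrated out with [u]
    frozen. In this zero-mean form the inner integral is identically 0, and no regularity in [u] of
    a partial expectation has to be discussed. *)
Lemma indep_Ex0 (d' : measure_display) (E : measurableType d') (U : T -> E)
    (xi : T -> R) (F : E * R -> R) : indep U xi -> measurable_fun setT F ->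
  P.-integrable setT (EFin \o (fun w => F (U w, xi w))) ->
  (forall u, Ex P (fun w => F (u, xi w)) = 0) ->
  (forall u, P.-integrable setT (EFin \o (fun w => F (u, xi w)))) ->
  Ex P (fun w => F (U w, xi w)) = 0.
Proof.
move=> [mU mxi ind] mF iF F0 iFu.
pose XU : {RV P >-> E} := mfun_Sub (mem_set mU).
pose Xxi : {RV P >-> R} := mfun_Sub (mem_set mxi).
have mpair : measurable_fun setT (fun w => (U w, xi w)).
  exact: measurable_fun_pair.
pose XP : {RV P >-> (E * R)%type} := mfun_Sub (mem_set mpair).
have law X : measurable X ->
    (distribution P XU \x distribution P Xxi)%E X = distribution P XP X.
  apply: product_measure_unique => A B mA mB.
  by rewrite /distribution /pushforward /= -ind.
have mEF : measurable_fun setT (EFin \o F) by exact/measurable_EFinP.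
have e : (\int[distribution P XU \x distribution P Xxi]_z (EFin \o F) z =
    \int[P]_w (F (U w, xi w))%:E)%E.
  rewrite (eq_measure_integral (distribution P XP)); last by move=> A mA _; exact: law.
  exact: (@integral_distribution _ _ _ _ _ P XP (EFin \o F)).
have iprod : (distribution P XU \x distribution P Xxi)%E.-integrable setT (EFin \o F).
  apply/integrableP; split => //.
  rewrite (eq_measure_integral (distribution P XP)); last by move=> A mA _; exact: law.
  rewrite (@ge0_integral_distribution _ _ _ _ _ P XP (abse \o (EFin \o F)))//.
    by case/integrableP : iF.
    exact: measurableT_comp.
  by move=> y /=.
transitivity (fine (\int[distribution P XU \x distribution P Xxi]_z (EFin \o F) z)%E).
  by rewrite e.
rewrite -integral12_prod_meas1// /fubini_F.
rewrite [X in fine X](_ : _ = 0)%E// -[RHS](integral0 (distribution P XU) setT).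
apply: eq_integral => u _.
rewrite (@integral_distribution _ _ _ _ _ P Xxi (fun y => (EFin \o F) (u, y))) //=.
- rewrite -[LHS]fineK ?integrable_fin_num//; last exact: iFu.
  by congr EFin; exact: (F0 u).
- by apply: (measurableT_comp mEF); exact: pair1_measurable.
- exact: iFu.
Qed.

(** Stein's identity holds for each frozen [u], and [indep_Ex0] applied to
    [F z * z.2 - s ^+ 2 * f z] carries it over to the random [U]. Every later integration by parts
    is an instance of this. *)
Lemma indep_stein (d' : measure_display) (E : measurableType d') (U : T -> E)
    (xi : T -> R) (s : R) (F f : E * R -> R) : 0 < s ->
  gaussian P s xi -> indep U xi ->
  measurable_fun setT F -> measurable_fun setT f ->
  (forall u, antiderivative (fun x => F (u, x)) (fun x => f (u, x))) ->
  (forall u, continuous (fun x => f (u, x))) ->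
  (forall u, poly_growth (fun x => F (u, x))) ->
  (forall u, poly_growth (fun x => f (u, x))) ->
  mom P (fun w => F (U w, xi w)) -> mom P (fun w => f (U w, xi w)) ->
  Ex P (fun w => F (U w, xi w) * xi w) = s ^+ 2 * Ex P (fun w => f (U w, xi w)).
Proof.
move=> s0 gxi ind mF mf FF cf gF gf momF momf.
have mxi := mom_gaussian_id s0 gxi.
have mFx : measurable_fun setT (fun z : E * R => F z * z.2) by exact: measurable_funM.
have mfs : measurable_fun setT (fun z : E * R => s ^+ 2 * f z) by exact: measurable_funM.
have mu u : mom P (fun w => F (u, xi w) * xi w).
  apply: momM => //; apply: (mom_gaussian s0 gxi) (gF u).
  exact: continuous_measurable_fun (antiderivative_continuous (FF u)).
have mu' u : mom P (fun w => s ^+ 2 * f (u, xi w)).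
  apply: momZ; apply: (mom_gaussian s0 gxi) (gf u).
  exact: continuous_measurable_fun (cf u).
have h := @indep_Ex0 _ _ U xi (fun z => F z * z.2 - s ^+ 2 * f z) ind.
apply/eqP; rewrite -subr_eq0 -ExZ// -ExB//; last 2 first.
- exact: momM.
- exact: momZ.
apply/eqP/h.
- exact: measurable_funB.
- by apply: mom_int; apply: momB; [exact: momM|exact: momZ].
- move=> u; rewrite ExB// ExZ; last first.
    exact: (mom_gaussian s0 gxi (continuous_measurable_fun (cf u)) (gf u)).
  by rewrite (stein s0 gxi (FF u) (cf u) (gF u) (gf u)) subrr.
- by move=> u; apply: mom_int; exact: momB.
Qed.

(** Dynkin's pi-lambda argument: the events that factor with [S] form a lambda-system. *)
Lemma indep_g_sigma_algebra (G : set (set T)) (S : set T) :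
  setI_closed G -> G `<=` measurable -> measurable S ->
  (forall A, G A -> P (A `&` S) = (P A * P S)%E) ->
  forall A, <<s G >> A -> P (A `&` S) = (P A * P S)%E.
Proof.
move=> GI Gm mS GS A; rewrite -setI_closed_g_dynkin_g_sigma_algebra// => dA.
pose L := [set A | measurable A /\ P (A `&` S) = (P A * P S)%E].
suff : L A by case.
apply: dA; split; last by move=> B GB; split; [exact: Gm|exact: GS].
have fS B : measurable B -> P B \is a fin_num by move=> mB; exact: fin_num_measure.
split.
- by split => //; rewrite setTI probability_setT mul1e.
- move=> B [mB BS]; split; first exact: measurableC.
  rewrite probability_setC// muleBl ?fS// mul1e -BS.
  have := @measureU _ _ _ P (~` B `&` S) (B `&` S).
  rewrite -setIUl setUC setUv setTI => -> //; last 3 first.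
  + by apply: measurableI => //; exact: measurableC.
  + exact: measurableI.
  + by rewrite -setIIl setICl set0I.
  by rewrite addeK// fS//; exact: measurableI.
- move=> F tF LF; split; first by apply: bigcupT_measurable => n; have [] := LF n.
  rewrite setI_bigcupl !measure_bigcup//=; last first.
    + exact: trivIset_setIr.
    + by move=> n _; apply: measurableI => //; have [] := LF n.
    + by move=> n _; have [] := LF n.
  rewrite muleC -(fineK (fS _ mS)) -nneseriesZl//.
  by apply: eq_eseriesr => n _; have [_ ->] := LF n; rewrite fineK ?fS// muleC.
Qed.

Variables (J : finType) (X : J -> T -> R) (i0 : J).

(** Cylinders left free at [i0]: a pi-system for the sigma-algebra of all the variables except
    [X i0]. *)
Definition other_events : set (set T) := [set S | exists A : J -> set R,
  [/\ forall i, measurable (A i), A i0 = setT & S = \bigcap_(i in setT) (X i @^-1` A i)]].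

Hypothesis mX : forall i, measurable_fun setT (X i).
Hypothesis indX : mutually_independent P X.

Lemma measurable_bigcap_preimage (A : J -> set R) : (forall i, measurable (A i)) ->
  measurable (\bigcap_(i in setT) (X i @^-1` A i)).
Proof.
move=> mA; apply: fin_bigcap_measurable => // i _.
by rewrite -[X in measurable X]setTI; exact: mX.
Qed.

Lemma other_events_indep (d' : measure_display) (E : measurableType d')
    (U : T -> E) :
  @measurable_fun _ _ (g_sigma_algebraType other_events) E setT U ->
  indep U (X i0).
Proof.
move=> mU.
have GI : setI_closed other_events.
  move=> _ _ [A [mA A0 ->]] [B [mB B0 ->]].
  exists (fun i => A i `&` B i); split.
  - by move=> i; exact: measurableI.
  - by rewrite A0 B0 setTI.
  - by rewrite -bigcapI.
have Gm : other_events `<=` measurable.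
  by move=> _ [A [mA A0 ->]]; exact: measurable_bigcap_preimage.
have sGm : <<s other_events>> `<=` @measurable _ T.
  by apply: smallest_sub => //; exact: sigma_algebra_measurable.
split => //.
  by move=> mT A mA; apply: sGm; exact: mU.
move=> A B mA mB.
have mS : measurable (X i0 @^-1` B) by rewrite -[X in measurable X]setTI; exact: mX.
apply: (indep_g_sigma_algebra GI Gm mS); last first.
  by rewrite -[X in <<s _ >> X]setTI; exact: mU.
move=> _ [C [mC C0 ->]].
(* Putting [B] into the free slot makes the intersection a single cylinder, to which mutual
   independence applies. *)
pose C' i := if i == i0 then B else C i.
have mC' i : measurable (C' i) by rewrite /C'; case: ifP.
have -> : \bigcap_(i in setT) (X i @^-1` C i) `&` (X i0 @^-1` B) =
    \bigcap_(i in setT) (X i @^-1` C' i).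
  apply/seteqP; split => w.
    move=> [h1 h2] i _; rewrite /C'; have [->//|_] := eqVneq i i0.
    exact: h1.
  move=> h; split.
    move=> i _; have := h i I; rewrite /C'; have [->|_//] := eqVneq i i0.
    by rewrite C0.
  by have := h i0 I; rewrite /C' eqxx.
rewrite !indX// (bigD1 i0)//= [in RHS](bigD1 i0)//= C0 preimage_setT probability_setT.
rewrite mul1e muleC /C' eqxx; congr (_ * _)%E.
by apply: eq_bigr => i /negbTE ->.
Qed.

Lemma measurable_other (i : J) : i != i0 ->
  @measurable_fun _ _ (g_sigma_algebraType other_events) R setT (X i).
Proof.
move=> ii0 _ B mB; rewrite setTI; apply: sub_sigma_algebra.
exists (fun j => if j == i then B else setT); split.
- by move=> j; case: ifP.
- by rewrite eq_sym (negbTE ii0).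
- apply/seteqP; split => w.
    by move=> h j _; have [->|] := eqVneq j i.
  by move=> h; have := h i I; rewrite /= eqxx.
Qed.

End Independence.

(** * Brownian motion *)

Section BrownianCoordinate.
Context (d : measure_display) (T : measurableType d) (R : realType).
Variable P : probability T R.

(** Two past positions, the position at [u], and the displacement after [v]: all that the estimates
    need of the path besides the increment from [u] to [v], and independent of it. *)
Definition path_data (b : R -> T -> R) (s1 s2 u v t : R) (w : T) :
  (R * R) * (R * R) := ((b s1 w, b s2 w), (b u w, b t w - b v w)).

(** The facts about one coordinate that the estimates use. The start is 0 for every [w], not almost
    every: in the instance below [b] is the increment from time 0, which vanishes identically
    there. *)
Record scalar_bm (b : R -> T -> R) : Prop := ScalarBM {
  sbm_0 : forall w, b 0 w = 0;
  sbm_gaussian : forall u v, 0 <= u -> u < v ->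
    gaussian P (Num.sqrt (v - u)) (fun w => b v w - b u w);
  sbm_indep : forall s1 s2 u v t, 0 <= s1 -> s1 <= s2 -> s2 <= u -> u < v ->
    v <= t -> indep P (path_data b s1 s2 u v t) (fun w => b v w - b u w)
}.

Variable W : R -> T -> 'rV[R]_2.
Hypothesis hW : brownian_motion P W.

Lemma increment_measurable (s t : R) (i : 'I_2) : 0 <= s -> 0 <= t ->
  measurable_fun setT (increment W s t i).
Proof. by move=> s0 t0; apply: measurable_funB; exact: (bm_measurable hW). Qed.

Lemma increment_gaussian (s t : R) (i : 'I_2) : 0 <= s -> s < t ->
  gaussian P (Num.sqrt (t - s)) (increment W s t i).
Proof.
move=> s0 st; split; last exact: (bm_gaussian hW).
by apply: increment_measurable => //; exact: le_trans (ltW st).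
Qed.

Lemma increment_others (m : nat) (tau : nat -> R) (i0 : 'I_m * 'I_2) :
  0 <= tau 0%N -> (forall k, tau k <= tau k.+1) ->
  let X := fun ki : 'I_m * 'I_2 =>
    increment W (tau ki.1) (tau ki.1.+1) ki.2 in
  (forall (d' : measure_display) (E : measurableType d') (U : T -> E),
    @measurable_fun _ _ (g_sigma_algebraType (other_events X i0)) E setT U ->
    indep P U (X i0)) /\
  (forall i, i != i0 ->
    @measurable_fun _ _ (g_sigma_algebraType (other_events X i0)) R setT (X i)).
Proof.
move=> tau0 taun X.
have tauP k : 0 <= tau k.
  by elim: k => // k ih; exact: le_trans ih (taun k).
split; last by move=> i ii0; exact: measurable_other.
move=> d' E U mU; apply: other_events_indep => //.
- by move=> i; exact: increment_measurable.
- exact: (bm_independent hW).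
Qed.

Lemma bm_coordinate_scalar_bm (i : 'I_2) : scalar_bm (fun t => increment W 0 t i).
Proof.
have incE u v : (fun w => increment W 0 v i w - increment W 0 u i w) = increment W u v i.
  by apply/funext => w; rewrite /increment opprB addrA subrK.
split.
- by move=> w; rewrite /increment subrr.
- by move=> u v u0 uv; rewrite incE; exact: increment_gaussian.
move=> s1 s2 u v t h1 h2 h3 h4 h5.
(* The default [t] keeps [tau] constant after its last entry, hence nondecreasing. Block 3 is the
   increment from [u] to [v]; the path data are sums of the other four. *)
pose tau k := nth t [:: 0; s1; s2; u; v; t] k.
have taun k : tau k <= tau k.+1.
  by do 6?[case: k => [|k]; first by rewrite /tau //= ltW]; rewrite /tau /= !nth_default.
pose e k (hk : (k < 5)%N) : 'I_5 * 'I_2 := (Ordinal hk, i).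
have [ind meas] := @increment_others 5 tau (e 3%N isT) (lexx 0) taun.
rewrite incE; apply: ind.
have := meas (e 0%N isT) isT; have := meas (e 1%N isT) isT.
have := meas (e 2%N isT) isT; have := meas (e 4%N isT) isT.
rewrite /= /tau /= => m4 m2 m1 m0.
have m1' := measurable_funD m0 m1; have m2' := measurable_funD m1' m2.
have es1 : increment W 0 s2 i = (increment W 0 s1 i \+ increment W s1 s2 i).
  by apply/funext => w /=; rewrite /increment; ring.
have eu : increment W 0 u i =
    ((increment W 0 s1 i \+ increment W s1 s2 i) \+ increment W s2 u i).
  by apply/funext => w /=; rewrite /increment; ring.
apply: measurable_fun_pair; apply: measurable_fun_pair.
- exact: m0.
- by rewrite es1.
- by rewrite eu.
- by rewrite incE.
Qed.

(** Stein's identity for a function that is constant in the increment. *)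
Lemma indep_mean0 (d' : measure_display) (E : measurableType d') (U : T -> E)
    (xi : T -> R) (s : R) (K : E -> R) : 0 < s -> gaussian P s xi -> indep P U xi ->
  measurable_fun setT K -> mom P (K \o U) ->
  Ex P (fun w => K (U w) * xi w) = 0.
Proof.
move=> s0 gxi ind mK momK.
have gc c : poly_growth (fun=> c : R) by exact: (@poly_growth_bounded _ _ `|c|).
have mK1 : measurable_fun setT (fun z : E * R => K z.1) by exact: measurableT_comp.
have := @indep_stein _ _ _ P _ E U xi s (fun z => K z.1) (fun=> 0) s0 gxi ind mK1
  (@measurable_cst _ _ _ _ _ _) (fun u => antiderivative_cst (K u))
  (fun u => @cst_continuous _ _ 0) (fun u => gc (K u)) (fun u => gc 0) momK (mom_cst P 0).
by rewrite Ex_cst mulr0.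
Qed.

Lemma indep_square (d' : measure_display) (E : measurableType d') (U : T -> E)
    (xi : T -> R) (s : R) (K : E -> R) : 0 < s -> gaussian P s xi -> indep P U xi ->
  measurable_fun setT K -> mom P (K \o U) ->
  Ex P (fun w => K (U w) * xi w ^+ 2) = s ^+ 2 * Ex P (fun w => K (U w)).
Proof.
move=> s0 gxi ind mK momK.
have gc c : poly_growth (fun=> c : R) by exact: (@poly_growth_bounded _ _ `|c|).
have mK1 : measurable_fun setT (fun z : E * R => K z.1) by exact: measurableT_comp.
have mK2 : measurable_fun setT (fun z : E * R => K z.1 * z.2) by exact: measurable_funM.
have mxi := mom_gaussian_id s0 gxi.
have FF u : antiderivative (fun x => K u * x) (fun=> K u).
  apply: eq_antiderivative (antiderivativeZ (K u) (@antiderivative_id R)) => x.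
  by rewrite mulr1.
have gF u : poly_growth (fun x => K u * x) by apply: poly_growthZ; exact: poly_growth_id.
rewrite -(@indep_stein _ _ _ P _ E U xi s (fun z => K z.1 * z.2) (fun z => K z.1)
  s0 gxi ind mK2 mK1 FF (fun u => @cst_continuous _ _ (K u)) gF (fun u => gc (K u))
  (momM momK mxi) momK).
by apply: eq_Ex => w /=; rewrite expr2 mulrA.
Qed.

(** This gives the orthogonality of the noise in the second coordinate and the drift driven by the
    first. Independence is available for increments over a common partition, so the second
    coordinate is cut at [s] and each piece is treated separately. *)
Lemma increment_cross0 (s t : R) (phi : R -> R) C : 0 <= s -> s <= t ->
  measurable_fun setT phi -> (forall x, `|phi x| <= C) ->
  Ex P (fun w => phi (increment W 0 s 0 w) * increment W 0 t 1 w) = 0.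
Proof.
move=> s0 st mphi phiC.
have t0 : 0 <= t by exact: le_trans st.
pose tau k := nth t [:: 0; s; t] k.
have taun k : tau k <= tau k.+1.
  by do 3?[case: k => [|k]; first by rewrite /tau]; rewrite /tau /= !nth_default.
pose e k (hk : (k < 2)%N) i : 'I_2 * 'I_2 := (Ordinal hk, i).
have mb : measurable_fun setT (increment W 0 s 0) by exact: increment_measurable.
have mphib : mom P (fun w => phi (increment W 0 s 0 w)).
  by apply: (@mom_bounded _ _ _ P _ C) => //; exact: measurableT_comp.
have zero u v : 0 <= u -> u <= v -> indep P (increment W 0 s 0) (increment W u v 1) ->
    mom P (increment W u v 1) /\
    Ex P (fun w => phi (increment W 0 s 0 w) * increment W u v 1 w) = 0.
  move=> u0; rewrite le_eqVlt => /predU1P[<- _|uv ind].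
    have z w : increment W u u 1 w = 0 by rewrite /increment subrr.
    split; first by rewrite (_ : increment W u u 1 = fun=> 0); [exact: mom_cst|exact/funext].
    by under eq_Ex do rewrite z mulr0; rewrite Ex_cst.
  have sg : 0 < Num.sqrt (v - u) by rewrite sqrtr_gt0 subr_gt0.
  have gx := increment_gaussian 1 u0 uv.
  split; first exact: mom_gaussian_id sg gx.
  exact: indep_mean0 sg gx ind mphi mphib.
have [i1 m1] := @increment_others 2 tau (e 0%N isT 1) (lexx 0) taun.
have [i2 m2] := @increment_others 2 tau (e 1%N isT 1) (lexx 0) taun.
have [mo1 z1] := zero 0 s (lexx 0) s0 (i1 _ _ _ (m1 (e 0%N isT 0) isT)).
have [mo2 z2] := zero s t s0 st (i2 _ _ _ (m2 (e 0%N isT 0) isT)).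
transitivity (Ex P (fun w => phi (increment W 0 s 0 w) * increment W 0 s 1 w +
    phi (increment W 0 s 0 w) * increment W s t 1 w)).
  by apply: eq_Ex => w; rewrite -mulrDr; congr (_ * _); rewrite /increment; ring.
by rewrite ExD; [rewrite z1 z2 addr0|exact: momM..].
Qed.

End BrownianCoordinate.

(** * Orthogonality and moments of Brownian increments *)

Section DiscreteIto.
Context (d : measure_display) (T : measurableType d) (R : realType).
Variable P : probability T R.
Variable b : R -> T -> R.
Hypothesis hb : scalar_bm P b.

Notation Exp := (Ex P).

Definition bounded_coef (a : R -> R) := measurable_fun setT a /\
  exists C, forall x, `|a x| <= C.

Lemma sbm_increment_mom u v : 0 <= u -> u <= v -> mom P (fun w => b v w - b u w).
Proof.
move=> u0; rewrite le_eqVlt => /predU1P[<-|uv].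
  by under eq_fun do rewrite subrr; exact: mom_cst.
have sg : 0 < Num.sqrt (v - u) by rewrite sqrtr_gt0 subr_gt0.
exact: mom_gaussian_id sg (sbm_gaussian hb u0 uv).
Qed.

Lemma sbm_mom v : 0 <= v -> mom P (b v).
Proof.
move=> v0; have := sbm_increment_mom (lexx 0) v0.
by under eq_fun do rewrite (sbm_0 hb) subr0.
Qed.

Lemma sbm_sq v : 0 < v -> Exp (fun w => b v w ^+ 2) = v.
Proof.
move=> v0; have := sbm_gaussian hb (lexx 0) v0; rewrite subr0 => g.
have sg : 0 < Num.sqrt v by rewrite sqrtr_gt0.
have := gaussian_variance sg g; rewrite sqr_sqrtr ?ltW// => {2}<-.
by apply: eq_Ex => w; rewrite (sbm_0 hb) subr0.
Qed.

Lemma coef_mom a v : bounded_coef a -> 0 <= v -> mom P (fun w => a (b v w)).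
Proof.
move=> [ma [C aC]] v0; apply: (@mom_bounded _ _ _ P _ C) => //.
by apply: measurableT_comp => //; exact: mom_meas (sbm_mom v0).
Qed.

Lemma bounded_coefM a c : bounded_coef a -> bounded_coef c ->
  bounded_coef (fun x => a x * c x).
Proof.
move=> [ma [C aC]] [mc [D cD]]; split; first exact: measurable_funM.
by exists (C * D) => x; rewrite normrM ler_pM.
Qed.

Lemma bounded_coef_cst c : bounded_coef (fun=> c).
Proof. by split; [exact: measurable_cst|exists `|c|]. Qed.

Lemma path_mean0 (K : (R * R) * (R * R) -> R) s1 s2 u v t :
  0 <= s1 -> s1 <= s2 -> s2 <= u -> u < v -> v <= t ->
  measurable_fun setT K -> mom P (K \o path_data b s1 s2 u v t) ->
  Exp (fun w => K (path_data b s1 s2 u v t w) * (b v w - b u w)) = 0.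
Proof.
move=> h1 h2 h3 h4 h5; have u0 : 0 <= u by rewrite (le_trans h1)// (le_trans h2).
have sg : 0 < Num.sqrt (v - u) by rewrite sqrtr_gt0 subr_gt0.
exact: indep_mean0 sg (sbm_gaussian hb u0 h4) (sbm_indep hb h1 h2 h3 h4 h5).
Qed.

Lemma path_square (K : (R * R) * (R * R) -> R) s1 s2 u v t :
  0 <= s1 -> s1 <= s2 -> s2 <= u -> u < v -> v <= t ->
  measurable_fun setT K -> mom P (K \o path_data b s1 s2 u v t) ->
  Exp (fun w => K (path_data b s1 s2 u v t w) * (b v w - b u w) ^+ 2) =
  (v - u) * Exp (fun w => K (path_data b s1 s2 u v t w)).
Proof.
move=> h1 h2 h3 h4 h5; have u0 : 0 <= u by rewrite (le_trans h1)// (le_trans h2).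
have vu : 0 < v - u by rewrite subr_gt0.
have sg : 0 < Num.sqrt (v - u) by rewrite sqrtr_gt0.
rewrite -[X in X * _]sqr_sqrtr ?ltW//.
exact: indep_square sg (sbm_gaussian hb u0 h4) (sbm_indep hb h1 h2 h3 h4 h5).
Qed.

Lemma measurable_proj11 : measurable_fun setT (fun z : (R * R) * (R * R) => z.1.1).
Proof. exact: (measurableT_comp (@measurable_fst _ _ R R)). Qed.
Lemma measurable_proj12 : measurable_fun setT (fun z : (R * R) * (R * R) => z.1.2).
Proof. exact: (measurableT_comp (@measurable_snd _ _ R R)). Qed.
Lemma measurable_proj21 : measurable_fun setT (fun z : (R * R) * (R * R) => z.2.1).
Proof. exact: (measurableT_comp (@measurable_fst _ _ R R)). Qed.
Lemma measurable_proj22 : measurable_fun setT (fun z : (R * R) * (R * R) => z.2.2).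
Proof. exact: (measurableT_comp (@measurable_snd _ _ R R)). Qed.

Lemma martingale_cross a c s1 s2 u v : bounded_coef a -> bounded_coef c ->
  0 <= s1 -> s1 <= s2 -> s2 <= u -> u < v ->
  Exp (fun w => (a (b s1 w) * (b s2 w - b s1 w)) * (c (b u w) * (b v w - b u w))) = 0.
Proof.
move=> ba bc h1 h2 h3 h4.
pose K (z : (R * R) * (R * R)) := a z.1.1 * (z.1.2 - z.1.1) * c z.2.1.
have s20 : 0 <= s2 := le_trans h1 h2; have u0 : 0 <= u := le_trans s20 h3.
rewrite -[RHS](@path_mean0 K s1 s2 u v v)//.
- by apply: eq_Ex => w; rewrite /K /=; ring.
- apply: measurable_funM; [apply: measurable_funM|].
  + exact: measurableT_comp ba.1 measurable_proj11.
  + exact: measurable_funB measurable_proj12 measurable_proj11.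
  + exact: measurableT_comp bc.1 measurable_proj21.
- apply: momM; last exact: coef_mom.
  by apply: momM; [exact: coef_mom|exact: sbm_increment_mom].
Qed.

Lemma martingale_diag a u v : bounded_coef a -> 0 <= u -> u < v ->
  Exp (fun w => a (b u w) * (b v w - b u w) ^+ 2) =
  (v - u) * Exp (fun w => a (b u w)).
Proof.
move=> ba h1 h4.
apply: (@path_square (fun z => a z.2.1) u u u v v) => //.
- exact: measurableT_comp ba.1 measurable_proj21.
- exact: coef_mom.
Qed.

(** Compensated squares on disjoint intervals are orthogonal, so the mean square of their sum over
    the grid is of order 1 / n instead of order 1. *)
Lemma square_cross a c s1 s2 u v : bounded_coef a -> bounded_coef c ->
  0 <= s1 -> s1 <= s2 -> s2 <= u -> u < v ->
  Exp (fun w => (a (b s1 w) * ((b s2 w - b s1 w) ^+ 2 - (s2 - s1))) *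
    (c (b u w) * ((b v w - b u w) ^+ 2 - (v - u)))) = 0.
Proof.
move=> ba bc h1 h2 h3 h4.
pose K (z : (R * R) * (R * R)) :=
  a z.1.1 * ((z.1.2 - z.1.1) ^+ 2 - (s2 - s1)) * c z.2.1.
have s20 : 0 <= s2 := le_trans h1 h2; have u0 : 0 <= u := le_trans s20 h3.
have mK : measurable_fun setT K.
  apply: measurable_funM; [apply: measurable_funM|].
  + exact: measurableT_comp ba.1 measurable_proj11.
  + apply: measurable_funB => //; apply: measurable_funX.
    exact: measurable_funB measurable_proj12 measurable_proj11.
  + exact: measurableT_comp bc.1 measurable_proj21.
have momK : mom P (K \o path_data b s1 s2 u v v).
  apply: momM; last exact: coef_mom.
  apply: momM; first exact: coef_mom.
  by apply: momB; [apply: momX; exact: sbm_increment_mom|exact: mom_cst].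
have e := path_square h1 h2 h3 h4 (lexx v) mK momK.
have mu2 : mom P (fun w => (b v w - b u w) ^+ 2).
  by apply: momX; apply: sbm_increment_mom => //; exact: ltW.
transitivity (Exp (fun w => K (path_data b s1 s2 u v v w) * (b v w - b u w) ^+ 2 -
  (v - u) * K (path_data b s1 s2 u v v w))).
  by apply: eq_Ex => w; rewrite /K /=; ring.
rewrite ExB; [|exact: (momM momK mu2)|exact: (momZ (v - u) momK)].
by rewrite e ExZ// subrr.
Qed.

Lemma increment_moment4 u v : 0 <= u -> u < v ->
  Exp (fun w => (b v w - b u w) ^+ 4) = 3 * (v - u) ^+ 2.
Proof.
move=> u0 uv; have vu : 0 < v - u by rewrite subr_gt0.
have sg : 0 < Num.sqrt (v - u) by rewrite sqrtr_gt0.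
have g := sbm_gaussian hb u0 uv.
rewrite (gaussian_moment sg g 2) (gaussian_variance sg g) sqr_sqrtr ?ltW//; ring.
Qed.

Lemma increment_moment6 u v : 0 <= u -> u < v ->
  Exp (fun w => (b v w - b u w) ^+ 6) = 15 * (v - u) ^+ 3.
Proof.
move=> u0 uv; have vu : 0 < v - u by rewrite subr_gt0.
have sg : 0 < Num.sqrt (v - u) by rewrite sqrtr_gt0.
have g := sbm_gaussian hb u0 uv.
rewrite (gaussian_moment sg g 4) (increment_moment4 u0 uv) sqr_sqrtr ?ltW//; ring.
Qed.

(** Once [a] is bounded, what remains is the variance of the square of a Gaussian, which is 3 - 1 =
    2 times the squared variance. *)
Lemma square_diag (a : R -> R) (C u v : R) : measurable_fun setT a -> (forall x, `|a x| <= C) ->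
  0 <= u -> u < v ->
  Exp (fun w => (a (b u w) * ((b v w - b u w) ^+ 2 - (v - u))) ^+ 2) <=
  C ^+ 2 * (2 * (v - u) ^+ 2).
Proof.
move=> ma aC u0 uv.
have ba : bounded_coef a by split => //; exists C.
have mxi := sbm_increment_mom u0 (ltW uv).
have vu : 0 < v - u by rewrite subr_gt0.
have sg : 0 < Num.sqrt (v - u) by rewrite sqrtr_gt0.
have g := sbm_gaussian hb u0 uv.
have := gaussian_variance sg g; rewrite (sqr_sqrtr (ltW vu)) => e2.
have mq : mom P (fun w => ((b v w - b u w) ^+ 2 - (v - u)) ^+ 2).
  by apply: momX; apply: momB; [exact: momX|exact: mom_cst].
have -> : 2 * (v - u) ^+ 2 = Exp (fun w => ((b v w - b u w) ^+ 2 - (v - u)) ^+ 2).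
  transitivity (Exp (fun w => (b v w - b u w) ^+ 4 -
    2 * (v - u) * (b v w - b u w) ^+ 2 + (v - u) ^+ 2)); last first.
    by apply: eq_Ex => w; ring.
  rewrite ExD; [|apply: momB|exact: mom_cst]; last 2 first.
  - exact: momX.
  - by apply: momZ; exact: momX.
  rewrite ExB; [|exact: momX|by apply: momZ; exact: momX].
  rewrite ExZ; last exact: momX.
  by rewrite e2 increment_moment4// Ex_cst; ring.
rewrite -ExZ//; apply: Ex_le.
- apply: momX; apply: momM; first exact: coef_mom.
  by apply: momB; [exact: momX|exact: mom_cst].
- exact: momZ.
move=> w; rewrite exprMn ler_wpM2r ?sqr_ge0//.
by rewrite -real_normK ?num_real// lerXn2r ?nnegrE// (le_trans _ (aC 0)).
Qed.

Lemma Ex_orthogonal_sum n (D E : 'I_n -> T -> R) :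
  (forall i, mom P (D i)) -> (forall i, mom P (E i)) ->
  (forall i j, i != j -> Exp (fun w => D i w * E j w) = 0) ->
  Exp (fun w => (\sum_i D i w) * (\sum_i E i w)) =
  \sum_i Exp (fun w => D i w * E i w).
Proof.
move=> mD mE ort.
transitivity (Exp (fun w => \sum_i \sum_j D i w * E j w)).
  by apply: eq_Ex => w; rewrite big_distrlr.
rewrite Ex_sum; last by move=> i; apply: mom_sum => j; exact: momM.
apply: eq_bigr => i _; rewrite Ex_sum; last by move=> j; exact: momM.
by rewrite (bigD1 i)//= big1 ?addr0// => j ij; apply: ort; rewrite eq_sym.
Qed.

End DiscreteIto.

(** * Ito's formula on a grid *)

Section Grid.
Context (d : measure_display) (T : measurableType d) (R : realType).
Variable P : probability T R.
Variable b : R -> T -> R.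
Hypothesis hb : scalar_bm P b.
Variables (t : R) (n : nat).
Hypothesis t0 : 0 < t.

Notation Exp := (Ex P).

Definition mesh : R := t / n.+1%:R.
Definition node (k : nat) : R := k%:R * mesh.
Definition step (k : nat) (w : T) : R := b (node k.+1) w - b (node k) w.
(* A discrete stochastic integral.  The integrand depends on the index so that
   the term at time 0, where the law of [b] is degenerate, can be dropped. *)
Definition mart (a : nat -> R -> R) (w : T) : R :=
  \sum_(k < n.+1) a k (b (node k) w) * step k w.

Lemma mesh_gt0 : 0 < mesh. Proof. by rewrite divr_gt0. Qed.
Lemma node_ge0 k : 0 <= node k. Proof. by rewrite mulr_ge0// ltW// mesh_gt0. Qed.
Lemma node_lt k : node k < node k.+1.
Proof. by rewrite ltr_pM2r ?mesh_gt0// ltr_nat. Qed.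
Lemma node_le j k : (j <= k)%N -> node j <= node k.
Proof. by move=> jk; rewrite ler_pM2r ?mesh_gt0// ler_nat. Qed.
Lemma node_step k : node k.+1 - node k = mesh.
Proof. by rewrite /node -natr1; ring. Qed.
Lemma node_last : node n.+1 = t.
Proof. by rewrite /node /mesh mulrC divfK. Qed.

Hint Resolve node_ge0 : core.

Lemma step_mom k : mom P (step k).
Proof. by apply: (sbm_increment_mom hb) => //; exact/ltW/node_lt. Qed.

Lemma mart_term_mom (a : nat -> R -> R) k : (forall k, bounded_coef (a k)) ->
  mom P (fun w => a k (b (node k) w) * step k w).
Proof. by move=> ba; apply: momM; [exact: (coef_mom hb)|exact: step_mom]. Qed.

Lemma mart_mom (a : nat -> R -> R) : (forall k, bounded_coef (a k)) -> mom P (mart a).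
Proof. by move=> ba; apply: mom_sum => k; exact: mart_term_mom. Qed.

Lemma mart_isometry (a c : nat -> R -> R) :
  (forall k, bounded_coef (a k)) -> (forall k, bounded_coef (c k)) ->
  Exp (fun w => mart a w * mart c w) =
  \sum_(k < n.+1) mesh * Exp (fun w => a k (b (node k) w) * c k (b (node k) w)).
Proof.
move=> ba bc; rewrite /mart.
rewrite (@Ex_orthogonal_sum _ _ _ P _
  (fun (k : 'I_n.+1) w => a k (b (node k) w) * step k w)
  (fun (k : 'I_n.+1) w => c k (b (node k) w) * step k w)).
- apply: eq_bigr => k _; rewrite -[in RHS](node_step k).
  rewrite -(@martingale_diag _ _ _ P _ hb (fun x => a k x * c k x)) ?node_lt//; last first.
    exact: bounded_coefM.
  by apply: eq_Ex => w; rewrite /step; ring.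
- by move=> k; exact: mart_term_mom.
- by move=> k; exact: mart_term_mom.
move=> i j; rewrite -val_eqE neq_ltn => /orP[ij|ji].
  by apply: martingale_cross; rewrite ?node_lt//; [exact/ltW/node_lt|exact: node_le].
under eq_Ex do rewrite mulrC.
by apply: martingale_cross; rewrite ?node_lt//; [exact/ltW/node_lt|exact: node_le].
Qed.

Lemma sqr_sum_le (m : nat) (x : 'I_m -> R) :
  (\sum_i x i) ^+ 2 <= m%:R * \sum_i x i ^+ 2.
Proof.
rewrite expr2 big_distrlr /=.
apply: le_trans (_ : \sum_i \sum_j (x i ^+ 2 + x j ^+ 2) / 2 <= _).
  apply: ler_sum => i _; apply: ler_sum => j _.
  have := sqr_ge0 (x i - x j); nra.
rewrite le_eqVlt; apply/orP; left; apply/eqP.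
have inner i : \sum_j (x i ^+ 2 + x j ^+ 2) / 2 =
    (m%:R * x i ^+ 2 + \sum_j x j ^+ 2) / 2.
  by rewrite -mulr_suml big_split /= sumr_const card_ord mulr_natl.
rewrite (eq_bigr _ (fun i _ => inner i)) -mulr_suml big_split /= -mulr_sumr.
by rewrite sumr_const card_ord -[in X in _ + X]mulr_natl; field.
Qed.

(** Twice the discretisation error in Ito's formula H(b_t) - H(b_0) = (integral of h db) + (integral
    of g ds) / 2, where h = H' and g = H''. The path starts at 0, whence [H 0]. *)
Definition ito_rest (H h g : R -> R) (w : T) : R :=
  \sum_(k < n.+1) g (b (node k) w) * mesh - 2 * (H (b t w) - H 0)
  + 2 * mart (fun=> h) w.

Lemma ito_rest_mom (H h g : R -> R) L : bounded_coef h -> bounded_coef g ->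
  antiderivative H h -> (forall x y, `|H x - H y| <= L * `|x - y|) ->
  mom P (ito_rest H h g).
Proof.
move=> bh bg HH HL.
have momH : mom P (fun w => H (b t w)).
  have := sbm_gaussian hb (lexx 0) t0.
  have sg : 0 < Num.sqrt (t - 0) by rewrite sqrtr_gt0 subr0.
  move=> g0; have := mom_gaussian sg g0
    (continuous_measurable_fun (antiderivative_continuous HH)) (poly_growth_lip HL).
  by rewrite /comp; under eq_fun do rewrite (sbm_0 hb) subr0.
apply: momD.
  apply: momB.
    by apply: mom_sum => k; apply: momM; [exact: (coef_mom hb)|exact: mom_cst].
  by apply: momZ; apply: momB => //; exact: mom_cst.
by apply: momZ; apply: mart_mom.
Qed.

(** The rest is minus the sum of compensated squares [q], minus twice the sum of Taylor remainders
    [r]. The first sum is small by orthogonality. The remainders are cubic in the step, and n + 1 of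
    them are controlled through the sixth moment. *)
Lemma ito_rest_bound (H h g : R -> R) L C C' : bounded_coef h ->
  measurable_fun setT g -> (forall x, `|g x| <= C) ->
  antiderivative H h -> antiderivative h g ->
  (forall x y, `|H x - H y| <= L * `|x - y|) ->
  (forall x y, `|g x - g y| <= C' * `|x - y|) ->
  Exp (fun w => ito_rest H h g w ^+ 2) <=
    (4 * C ^+ 2 * t ^+ 2 + 120 * C' ^+ 2 * t ^+ 3) / n.+1%:R.
Proof.
move=> bh mg gC HH hh HL gC'.
have bg : bounded_coef g by split => //; exists C.
pose q (k : 'I_n.+1) w := g (b (node k) w) *
  ((b (node k.+1) w - b (node k) w) ^+ 2 - (node k.+1 - node k)).
pose r k w := H (b (node k.+1) w) - H (b (node k) w) -
  h (b (node k) w) * step k w - g (b (node k) w) * step k w ^+ 2 / 2.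
have E w : ito_rest H h g w = - (\sum_k q k w) - 2 * \sum_(k < n.+1) r k w.
  rewrite /ito_rest; have -> : H (b t w) - H 0 =
      \sum_(k < n.+1) (H (b (node k.+1) w) - H (b (node k) w)).
    rewrite -(big_mkord xpredT (fun k => H (b (node k.+1) w) - H (b (node k) w))).
    by rewrite telescope_sumr// node_last /node mul0r (sbm_0 hb).
  rewrite /mart !mulr_sumr -!sumrB -big_split -!sumrN -big_split /=.
  by apply: eq_bigr => k _; rewrite /q /r /step node_step; field.
have mq k : mom P (q k).
  apply: momM; first exact: (coef_mom hb).
  by apply: momB; [apply: momX; exact: step_mom|exact: mom_cst].
have mQ : mom P (fun w => \sum_k q k w) by exact: mom_sum.
have Q2 : Exp (fun w => (\sum_k q k w) ^+ 2) <= 2 * C ^+ 2 * t ^+ 2 / n.+1%:R.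
  under eq_Ex do rewrite expr2.
  rewrite Ex_orthogonal_sum//; last first.
    move=> i j; rewrite /q -val_eqE neq_ltn => /orP[ij|ji].
      by apply: square_cross; rewrite ?node_lt//; [exact/ltW/node_lt|exact: node_le].
    under eq_Ex do rewrite mulrC.
    by apply: square_cross; rewrite ?node_lt//; [exact/ltW/node_lt|exact: node_le].
  apply: le_trans (_ : \sum_(k < n.+1) C ^+ 2 * (2 * mesh ^+ 2) <= _).
    apply: ler_sum => k _; under eq_Ex do rewrite -expr2.
    apply: le_trans (square_diag hb mg gC (node_ge0 k) (node_lt k)) _.
    by rewrite node_step.
  rewrite sumr_const card_ord -mulr_natl /mesh le_eqVlt; apply/orP; left; apply/eqP.
  by field.
have rb k w : `|r k w| <= C' * `|step k w| ^+ 3.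
  have := antiderivative_taylor2 (b (node k) w) (step k w) HH hh gC'.
  by rewrite /r /step [b (node k) w + _]addrC subrK.
have mS : mom P (fun w => n.+1%:R * \sum_(k < n.+1) C' ^+ 2 * step k w ^+ 6).
  by apply: momZ; apply: mom_sum => k; apply: momZ; apply: momX; exact: step_mom.
have mrest := ito_rest_mom bh bg HH HL.
have S2 : Exp (fun w => n.+1%:R * \sum_(k < n.+1) C' ^+ 2 * step k w ^+ 6) <=
    15 * C' ^+ 2 * t ^+ 3 / n.+1%:R.
  rewrite ExZ; last first.
    by apply: mom_sum => k; apply: momZ; apply: momX; exact: step_mom.
  rewrite Ex_sum; last by move=> k; apply: momZ; apply: momX; exact: step_mom.
  have -> : \sum_(k < n.+1) Exp (fun w => C' ^+ 2 * step k w ^+ 6) =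
      \sum_(k < n.+1) C' ^+ 2 * (15 * mesh ^+ 3).
    apply: eq_bigr => k _; rewrite ExZ; last by apply: momX; exact: step_mom.
    by rewrite (increment_moment6 hb (node_ge0 k) (node_lt k)) node_step.
  rewrite sumr_const card_ord -mulr_natl /mesh le_eqVlt; apply/orP; left; apply/eqP.
  by field.
(* From (Q + 2 r)^2 <= 2 Q^2 + 8 r^2; with the constants 2 and 15 found above this gives 4 and
   120. *)
apply: le_trans (_ : Exp (fun w => 2 * (\sum_k q k w) ^+ 2 +
   8 * (n.+1%:R * \sum_(k < n.+1) C' ^+ 2 * step k w ^+ 6)) <= _).
  apply: Ex_le; first exact: momX.
    by apply: momD; apply: momZ => //; exact: momX.
  move=> w; rewrite E.
  have h1 : (\sum_(k < n.+1) r k w) ^+ 2 <=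
      n.+1%:R * \sum_(k < n.+1) C' ^+ 2 * step k w ^+ 6.
    apply: le_trans (sqr_sum_le _) _; rewrite ler_wpM2l// ler_sum// => k _.
    have := rb k w; have := normr_ge0 (r k w).
    rewrite -[r k w ^+ 2]real_normK ?num_real// -[step k w ^+ 6]/(step k w ^+ (2 * 3)%N).
    rewrite exprM -[step k w ^+ 2]real_normK ?num_real// -exprM mulnC exprM -exprMn.
    by move=> r0 rle; rewrite lerXn2r ?nnegrE// (le_trans r0).
  set Q := \sum_k q k w in h1 *; set r' := \sum_(k < n.+1) r k w in h1 *.
  have := sqr_ge0 (Q - 2 * r'); nra.
rewrite ExD; [|by apply: momZ; exact: momX|exact: momZ].
rewrite (ExZ 2 (momX 2 mQ)) (ExZ 8 mS).
have -> : (4 * C ^+ 2 * t ^+ 2 + 120 * C' ^+ 2 * t ^+ 3) / n.+1%:R =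
  2 * (2 * C ^+ 2 * t ^+ 2 / n.+1%:R) + 8 * (15 * C' ^+ 2 * t ^+ 3 / n.+1%:R) by field.
by apply: lerD; apply: ler_wpM2l.
Qed.

(** With the rest of the path frozen, [H (b t)] is a function of the k-th step whose derivative is
    [h (b t)], and Stein's identity in that step trades the factor [step k] for its variance
    [mesh]. *)
Lemma mart_ibp (a : nat -> R -> R) (H h : R -> R) L :
  (forall k, bounded_coef (a k)) -> antiderivative H h -> continuous h ->
  (forall x, `|h x| <= L) ->
  Exp (fun w => mart a w * H (b t w)) =
  \sum_(k < n.+1) mesh * Exp (fun w => a k (b (node k) w) * h (b t w)).
Proof.
move=> ba HH ch hL; have HL := antiderivative_lip HH hL.
have HL' x y : `|H x - H y| <= L * `|x - y| by exact: HL.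
have mH := continuous_measurable_fun (antiderivative_continuous HH).
have mh := continuous_measurable_fun ch.
have momH : mom P (fun w => H (b t w)).
  have := sbm_gaussian hb (lexx 0) t0.
  have sg : 0 < Num.sqrt (t - 0) by rewrite sqrtr_gt0 subr0.
  move=> g0; have := mom_gaussian sg g0 mH (poly_growth_lip HL').
  by rewrite /comp; under eq_fun do rewrite (sbm_0 hb) subr0.
under eq_Ex do rewrite /mart mulr_suml.
rewrite Ex_sum; last by move=> k; apply: momM => //; exact: mart_term_mom.
apply: eq_bigr => k _; rewrite -(node_step k).
have k1t : node k.+1 <= t by rewrite -node_last; apply: node_le; exact: ltn_ord.
have h4 := node_lt k.
have vu : 0 < node k.+1 - node k by rewrite subr_gt0.
have sg : 0 < Num.sqrt (node k.+1 - node k) by rewrite sqrtr_gt0.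
have ind := sbm_indep hb (node_ge0 k) (lexx _) (lexx _) h4 k1t.
pose U := path_data b (node k) (node k) (node k) (node k.+1) t.
(* Rebuilds [b t] from the position at the node, the step, and the later displacement. *)
pose y (z : (R * R) * (R * R) * R) := z.1.2.1 + z.2 + z.1.2.2.
have my : measurable_fun setT y.
  apply: measurable_funD; [apply: measurable_funD|].
  - exact: measurableT_comp (@measurable_proj21 R) (@measurable_fst _ _ _ _).
  - exact: measurable_snd.
  - exact: measurableT_comp (@measurable_proj22 R) (@measurable_fst _ _ _ _).
have ma : measurable_fun setT (fun z : (R * R) * (R * R) * R => a k z.1.2.1).
  apply: (measurableT_comp (ba k).1).
  exact: measurableT_comp (@measurable_proj21 R) (@measurable_fst _ _ _ _).
have yE w : y (U w, step k w) = b t w.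
  by rewrite /y /U /path_data /step /=; ring.
have ay u x : H (y (u, x)) = H (1 * x + (u.2.1 + u.2.2)).
  by congr H; rewrite /y /= mul1r; ring.
have hy u x : h (y (u, x)) = h (1 * x + (u.2.1 + u.2.2)).
  by congr h; rewrite /y /= mul1r; ring.
have FF u : antiderivative (fun x => a k u.2.1 * H (y (u, x)))
    (fun x => a k u.2.1 * h (y (u, x))).
  apply: antiderivativeZ.
  rewrite (_ : (fun x => H _) = (fun x => H (1 * x + (u.2.1 + u.2.2)))); last exact/funext.
  apply: eq_antiderivative (antiderivative_affine 1 (u.2.1 + u.2.2) HH) => x.
  by rewrite hy mul1r.
have cf u : continuous (fun x => a k u.2.1 * h (y (u, x))).
  move=> x; apply: cvgM; first exact: cvg_cst.
  rewrite (_ : (fun x => h _) = h \o (fun x => u.2.1 + x + u.2.2))//.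
  apply: continuous_comp; last exact: ch.
  by apply: cvgD; [apply: cvgD; [exact: cvg_cst|exact: cvg_id]|exact: cvg_cst].
have gF u : poly_growth (fun x => a k u.2.1 * H (y (u, x))).
  apply/poly_growthZ/(@poly_growth_lip _ _ L) => x x'; apply: le_trans (HL' _ _) _.
  by rewrite /y /= (_ : _ - _ = x - x')//; ring.
have gf u : poly_growth (fun x => a k u.2.1 * h (y (u, x))).
  by apply/poly_growthZ/(@poly_growth_bounded _ _ L).
have momh : mom P (fun w => h (b t w)).
  by apply: (coef_mom hb _ (ltW t0)); split => //; exists L.
have momF : mom P (fun w => a k (U w).2.1 * H (y (U w, step k w))).
  under eq_fun do rewrite yE.
  by apply: momM => //; exact: (coef_mom hb).
have momf : mom P (fun w => a k (U w).2.1 * h (y (U w, step k w))).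
  under eq_fun do rewrite yE.
  by apply: momM => //; exact: (coef_mom hb).
have := @indep_stein _ _ _ P _ _ U (step k) _ (fun z => a k z.1.2.1 * H (y z))
  (fun z => a k z.1.2.1 * h (y z)) sg (sbm_gaussian hb (node_ge0 k) h4) ind
  (measurable_funM ma (measurableT_comp mH my))
  (measurable_funM ma (measurableT_comp mh my)) FF cf gF gf momF momf.
rewrite /= (sqr_sqrtr (ltW vu)) => e.
transitivity (Exp (fun w => a k (U w).2.1 * H (y (U w, step k w)) * step k w)).
  by apply: eq_Ex => w; rewrite yE mulrAC.
by rewrite e; congr (_ * _); apply: eq_Ex => w; rewrite yE.
Qed.

End Grid.

(** * Averaging of oscillating functions *)

Section Averaging.
Context (d : measure_display) (T : measurableType d) (R : realType).
Variable P : probability T R.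
Variable b : R -> T -> R.
Hypothesis hb : scalar_bm P b.
Notation Exp := (Ex P).

Lemma Ex_normM_le (X Y : T -> R) (x y : R) : 0 <= x -> 0 <= y ->
  mom P X -> mom P Y ->
  Exp (fun w => X w ^+ 2) <= x ^+ 2 -> Exp (fun w => Y w ^+ 2) <= y ^+ 2 ->
  Exp (fun w => `|X w| * `|Y w|) <= x * y.
Proof.
move=> x0 y0 mX mY hX hY.
have := Ex_CS (mom_norm mX) (mom_norm mY).
have sq (Z : T -> R) : Exp (fun w => `|Z w| ^+ 2) = Exp (fun w => Z w ^+ 2).
  by apply: eq_Ex => w; rewrite real_normK// num_real.
rewrite !sq => h; rewrite -(@ler_pXn2r _ 2) ?nnegrE ?mulr_ge0//; last first.
  by apply: Ex_ge0 => w; rewrite mulr_ge0.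
apply: (le_trans h); rewrite exprMn ler_pM//; apply: Ex_ge0 => w; exact: sqr_ge0.
Qed.

Lemma Ex_norm_le (X : T -> R) (x : R) : 0 <= x -> mom P X ->
  Exp (fun w => X w ^+ 2) <= x ^+ 2 -> Exp (fun w => `|X w|) <= x.
Proof.
move=> x0 mX hX.
have := @Ex_normM_le X (fun=> 1) x 1 x0 ler01 mX (mom_cst P 1) hX.
rewrite mulr1 => h; apply: le_trans (h _); last by rewrite Ex_cst !expr1n.
by rewrite le_eqVlt; apply/orP; left; apply/eqP/eq_Ex => w; rewrite normr1 mulr1.
Qed.

Lemma sbm_path0 v : (fun w => b v w - b 0 w) = b v.
Proof. by apply/funext => w; rewrite (sbm_0 hb) subr0. Qed.

(* Gaussian integration by parts in the variable [b u]. *)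
Lemma avg_slow (Phi phi f f' : R -> R) (B C K L u t : R) : 0 < u -> u <= t ->
  antiderivative Phi phi -> continuous phi ->
  (forall x, `|Phi x| <= B) -> (forall x, `|phi x| <= C) ->
  antiderivative f f' -> continuous f' -> (forall x, `|f' x| <= L) ->
  (forall x, `|f x| <= K + L * `|x|) ->
  `|Exp (fun w => phi (b u w) * f (b t w))| <=
    B * (L + (K + L * Num.sqrt t) / Num.sqrt u).
Proof.
move=> u0 ut PP cphi PhiB phiC ff cf' f'L fK.
have t0 : 0 < t by exact: lt_le_trans ut.
have B0 : 0 <= B by exact: le_trans (PhiB 0).
have L0 : 0 <= L by exact: le_trans (f'L 0).
have K0 : 0 <= K by have := fK 0; rewrite normr0 mulr0 addr0; exact: le_trans.
have su : 0 < Num.sqrt u by rewrite sqrtr_gt0.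
have st : 0 < Num.sqrt t by rewrite sqrtr_gt0.
have cPhi := antiderivative_continuous PP.
have cf := antiderivative_continuous ff.
have mPhi := continuous_measurable_fun cPhi.
have mphi := continuous_measurable_fun cphi.
have mf := continuous_measurable_fun cf.
have mf' := continuous_measurable_fun cf'.
have ind := sbm_indep hb (lexx 0) (lexx 0) (lexx 0) u0 ut.
have g := sbm_gaussian hb (lexx 0) u0.
rewrite sbm_path0 subr0 in ind g.
pose U := path_data b 0 0 0 u t.
pose y (z : (R * R) * (R * R) * R) := z.2 + z.1.2.2.
have my : measurable_fun setT y.
  apply: measurable_funD; first exact: measurable_snd.
  exact: measurableT_comp (@measurable_proj22 R) (@measurable_fst _ _ _ _).
have yE w : y (U w, b u w) = b t w by rewrite /y /U /path_data /=; ring.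
have m2 : measurable_fun setT (fun z : (R * R) * (R * R) * R => z.2).
  exact: measurable_snd.
have fl : forall x x', `|f x - f x'| <= L * `|x - x'|.
  by move=> x x'; exact: antiderivative_lip ff f'L _ _.
have dsh p : antiderivative (fun x => f (x + p)) (fun x => f' (x + p)).
  have := antiderivative_affine 1 p ff;
  rewrite (_ : (fun x => f (1 * x + p)) = (fun x => f (x + p))); last first.
    by apply/funext => x; rewrite mul1r.
  by apply: eq_antiderivative => x; rewrite !mul1r.
have csh (h : R -> R) p : continuous h -> continuous (fun x => h (x + p)).
  move=> ch; rewrite (_ : (fun x => h _) = h \o (fun x => x + p))//.
  move=> x; apply: continuous_comp; last exact: ch.
  by apply: cvgD; [exact: cvg_id|exact: cvg_cst].
have gsh p : poly_growth (fun x => f (x + p)).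
  apply: (@poly_growth_lip _ _ L) => x x'; apply: le_trans (fl _ _) _.
  by rewrite (_ : x + p - (x' + p) = x - x')//; ring.
have gPhi := poly_growth_bounded PhiB.
have gphi := poly_growth_bounded phiC.
have gf'sh p : poly_growth (fun x => f' (x + p)).
  by apply: (@poly_growth_bounded _ _ L).
have FF v : antiderivative (fun x => Phi x * f (x + v))
    (fun x => phi x * f (x + v) + Phi x * f' (x + v)).
  exact: antiderivativeM PP (dsh v).
have mbu := sbm_mom hb (ltW u0); have mbt := sbm_mom hb (ltW t0).
have gf : poly_growth f by exact: poly_growth_lip fl.
have gt := sbm_gaussian hb (lexx 0) t0.
rewrite sbm_path0 subr0 in gt.
have momf : mom P (fun w => f (b t w)) by exact: (mom_gaussian st gt mf gf).
have momf' : mom P (fun w => f' (b t w)).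
  exact: (mom_gaussian st gt mf' (poly_growth_bounded f'L)).
have momPhi : mom P (fun w => Phi (b u w)) by exact: (mom_gaussian su g mPhi gPhi).
have momphi : mom P (fun w => phi (b u w)) by exact: (mom_gaussian su g mphi gphi).
have momF : mom P (fun w => Phi (b u w) * f (y (U w, b u w))).
  by under eq_fun do rewrite yE; exact: momM.
have momG : mom P (fun w => phi (b u w) * f (y (U w, b u w)) +
    Phi (b u w) * f' (y (U w, b u w))).
  by under eq_fun do rewrite yE; apply: momD; exact: momM.
have polyD (F G : R -> R) : continuous F -> continuous G -> continuous (fun x => F x + G x).
  by move=> cF cG x; apply: cvgD; [exact: cF|exact: cG].
have polyM (F G : R -> R) : continuous F -> continuous G -> continuous (fun x => F x * G x).
  by move=> cF cG x; apply: cvgM; [exact: cF|exact: cG].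
have gD (F G : R -> R) : poly_growth F -> poly_growth G -> poly_growth (fun x => F x + G x).
  move=> /poly_growthE[a [p [a0 ha]]] /poly_growthE[c [q [c0 hc]]].
  exists (2 * a + 2 * c), (p + q)%N => x.
  have x1 : 1 <= 1 + `|x| by rewrite lerDl.
  have hp r s : 1 + `|x| ^+ r <= 2 * (1 + `|x|) ^+ (r + s).
    have e1 : (1 + `|x|) ^+ r <= (1 + `|x|) ^+ (r + s) by rewrite ler_weXn2l// leq_addr.
    have e2 : 1 <= (1 + `|x|) ^+ r by rewrite exprn_ege1.
    have e3 : `|x| ^+ r <= (1 + `|x|) ^+ r by rewrite lerXn2r ?nnegrE ?addr_ge0// lerDr.
    lra.
  have := hp p q; have := hp q p; rewrite (addnC q p) => h2 h1.
  have := ha x; have := hc x; have := ler_normD (F x) (G x); nra.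
have mG : measurable_fun setT (fun z : (R * R) * (R * R) * R =>
    phi z.2 * f (y z) + Phi z.2 * f' (y z)).
  apply: measurable_funD; apply: measurable_funM;
    by [apply: measurableT_comp mphi m2|apply: measurableT_comp mf my|
        apply: measurableT_comp mPhi m2|apply: measurableT_comp mf' my].
have := @indep_stein _ _ _ P _ _ U (b u) _ (fun z => Phi z.2 * f (y z))
  (fun z => phi z.2 * f (y z) + Phi z.2 * f' (y z)) su g ind
  (measurable_funM (measurableT_comp mPhi m2) (measurableT_comp mf my)) mG
  (fun z => FF z.2.2)
  (fun z => polyD _ _ (polyM _ _ cphi (csh f z.2.2 cf)) (polyM _ _ cPhi (csh f' z.2.2 cf')))
  (fun z => poly_growthM gPhi (gsh z.2.2))
  (fun z => gD _ _ (poly_growthM gphi (gsh z.2.2)) (poly_growthM gPhi (gf'sh z.2.2)))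
  momF momG.
rewrite /= (sqr_sqrtr (ltW u0)) => e.
(* Stein's identity in [b u] with [b t - b u] frozen. By the product rule the derivative falls once
   on [Phi] and once on [f], and solving for the first term gives the quantity to be bounded. *)
have {}e : Exp (fun w => Phi (b u w) * f (b t w) * b u w) =
    u * (Exp (fun w => phi (b u w) * f (b t w)) + Exp (fun w => Phi (b u w) * f' (b t w))).
  rewrite -ExD; [|exact: momM..].
  transitivity (Exp (fun w => Phi (b u w) * f (y (U w, b u w)) * b u w)).
    by apply: eq_Ex => w; rewrite yE.
  by rewrite e; congr (_ * _); apply: eq_Ex => w; rewrite yE.
have mff := momM momPhi momf; have mff' := momM momPhi momf'.
have e1 : `|Exp (fun w => Phi (b u w) * f' (b t w))| <= B * L.
  apply: le_trans (Ex_norm mff') _; rewrite -[leRHS](Ex_cst P).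
  apply: Ex_le; [exact: mom_norm|exact: mom_cst|].
  by move=> w; rewrite normrM ler_pM.
(* Linear growth of [f] leaves the means of [|b u|] and [|b t| |b u|], which Cauchy-Schwarz bounds
   by sqrt u and sqrt t sqrt u. *)
have e2 : `|Exp (fun w => Phi (b u w) * f (b t w) * b u w)| <=
    B * (K * Num.sqrt u + L * (Num.sqrt t * Num.sqrt u)).
  apply: le_trans (Ex_norm (momM mff mbu)) _.
  have mn : mom P (fun w => `|b u w|) by exact: mom_norm.
  have mnn : mom P (fun w => `|b t w| * `|b u w|) by apply: momM => //; exact: mom_norm.
  have mr : mom P (fun w => K * `|b u w| + L * (`|b t w| * `|b u w|)).
    by apply: momD; apply: momZ.
  apply: le_trans (_ : Exp (fun w => B * (K * `|b u w| + L * (`|b t w| * `|b u w|))) <= _).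
    apply: Ex_le; [apply: mom_norm; exact: momM|exact: momZ|].
    move=> w; rewrite !normrM -mulrA ler_pM ?mulr_ge0//.
    have := fK (b t w); have := normr_ge0 (b u w); nra.
  rewrite ExZ// ler_wpM2l// ExD; [|exact: momZ..].
  rewrite !ExZ// lerD// ler_wpM2l//.
    by apply: Ex_norm_le => //; rewrite (sbm_sq hb u0) sqr_sqrtr// ltW.
  apply: Ex_normM_le; rewrite ?sqrtr_ge0// ?(sbm_sq hb u0) ?(sbm_sq hb t0) sqr_sqrtr// ltW//.
move: e e1 e2; set X := Exp (fun w => phi (b u w) * f (b t w)).
set Y := Exp (fun w => Phi (b u w) * f' (b t w)); set Z := Exp _ => e e1 e2.
have -> : X = Z / u - Y by rewrite e; field; rewrite gt_eqF.
apply: le_trans (ler_normB _ _) _; rewrite mulrDr addrC lerD//.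
rewrite normrM normfV (gtr0_norm u0) ler_pdivrMr//.
apply: le_trans e2 _; rewrite -mulrA ler_wpM2l//.
have eu : u = Num.sqrt u * Num.sqrt u by rewrite -expr2 sqr_sqrtr// ltW.
rewrite [X in _ <= _ / _ * X]eu le_eqVlt; apply/orP; left; apply/eqP.
by field; rewrite gt_eqF.
Qed.

(* Gaussian integration by parts in the variable [b t - b u]. *)
Lemma avg_fast (phi F f : R -> R) (B C K u t : R) : 0 <= u -> u < t ->
  measurable_fun setT phi -> (forall x, `|phi x| <= K) ->
  antiderivative F f -> continuous f ->
  (forall x, `|F x| <= B) -> (forall x, `|f x| <= C) ->
  `|Exp (fun w => phi (b u w) * f (b t w))| <= K * B / Num.sqrt (t - u).
Proof.
move=> u0 ut mphi phiK FF cf FB fC.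
have t0 : 0 <= t by exact: le_trans u0 (ltW ut).
have tu : 0 < t - u by rewrite subr_gt0.
have B0 : 0 <= B by exact: le_trans (FB 0).
have K0 : 0 <= K by exact: le_trans (phiK 0).
have s0 : 0 < Num.sqrt (t - u) by rewrite sqrtr_gt0.
have cF := antiderivative_continuous FF.
have mF := continuous_measurable_fun cF.
have mf := continuous_measurable_fun cf.
have ind := sbm_indep hb u0 (lexx u) (lexx u) ut (lexx t).
have g := sbm_gaussian hb u0 ut.
pose U := path_data b u u u t t.
pose xi w := b t w - b u w.
pose x (z : (R * R) * (R * R) * R) := z.1.2.1.
pose y (z : (R * R) * (R * R) * R) := z.2 + z.1.2.1.
have mx : measurable_fun setT x.
  exact: measurableT_comp (@measurable_proj21 R) (@measurable_fst _ _ _ _).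
have my : measurable_fun setT y by apply: measurable_funD => //; exact: measurable_snd.
have yE w : y (U w, xi w) = b t w by rewrite /y /U /xi /path_data /=; ring.
have dsh c p : antiderivative (fun x => c * F (x + p)) (fun x => c * f (x + p)).
  apply: antiderivativeZ.
  have := antiderivative_affine 1 p FF;
  rewrite (_ : (fun x => F (1 * x + p)) = (fun x => F (x + p))); last first.
    by apply/funext => z; rewrite mul1r.
  by apply: eq_antiderivative => z; rewrite !mul1r.
have csh c p : continuous (fun x => c * f (x + p)).
  move=> z; apply: cvgM; first exact: cvg_cst.
  rewrite (_ : (fun x => f _) = f \o (fun x => x + p))//.
  apply: continuous_comp; last exact: cf.
  by apply: cvgD; [exact: cvg_id|exact: cvg_cst].
have gsh (G : R -> R) D c p : (forall x, `|G x| <= D) -> poly_growth (fun x => c * G (x + p)).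
  by move=> GD; apply/poly_growthZ/(@poly_growth_bounded _ _ D).
have momphi : mom P (fun w => phi (b u w)).
  by apply: (coef_mom hb) => //; split => //; exists K.
have momFt : mom P (fun w => F (b t w)).
  by apply: (coef_mom hb) => //; split => //; exists B.
have momft : mom P (fun w => f (b t w)).
  by apply: (coef_mom hb) => //; split => //; exists C.
have momxi : mom P xi by apply: (sbm_increment_mom hb) => //; exact: ltW.
have mom1 : mom P (fun w => phi (b u w) * F (y (U w, xi w))).
  by under eq_fun do rewrite yE; exact: momM.
have mom2 : mom P (fun w => phi (b u w) * f (y (U w, xi w))).
  by under eq_fun do rewrite yE; exact: momM.
have := @indep_stein _ _ _ P _ _ U xi _ (fun z => phi (x z) * F (y z))
  (fun z => phi (x z) * f (y z)) s0 g ind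
  (measurable_funM (measurableT_comp mphi mx) (measurableT_comp mF my))
  (measurable_funM (measurableT_comp mphi mx) (measurableT_comp mf my))
  (fun z => dsh (phi z.2.1) z.2.1) (fun z => csh (phi z.2.1) z.2.1)
  (fun z => gsh F B (phi z.2.1) z.2.1 FB) (fun z => gsh f C (phi z.2.1) z.2.1 fC)
  mom1 mom2.
rewrite /= (sqr_sqrtr (ltW tu)) => e.
have {}e : Exp (fun w => phi (b u w) * F (b t w) * xi w) =
    (t - u) * Exp (fun w => phi (b u w) * f (b t w)).
  transitivity (Exp (fun w => phi (b u w) * F (y (U w, xi w)) * xi w)).
    by apply: eq_Ex => w; rewrite yE.
  by rewrite e; congr (_ * _); apply: eq_Ex => w; rewrite yE.
have mpF := momM momphi momFt.
have e2 : `|Exp (fun w => phi (b u w) * F (b t w) * xi w)| <= K * B * Num.sqrt (t - u).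
  apply: le_trans (Ex_norm (momM mpF momxi)) _.
  apply: le_trans (_ : Exp (fun w => K * B * `|xi w|) <= _).
    apply: Ex_le; [apply: mom_norm; exact: momM|apply: momZ; exact: mom_norm|].
    by move=> w; rewrite !normrM ler_pM ?mulr_ge0// ler_pM.
  rewrite ExZ; last exact: mom_norm.
  rewrite ler_wpM2l ?mulr_ge0//; apply: Ex_norm_le => //.
  by rewrite (gaussian_variance s0 g).
move: e2; rewrite e normrM (gtr0_norm tu) => e2.
rewrite ler_pdivlMr// -(ler_pM2r s0) -mulrA -expr2 (sqr_sqrtr (ltW tu)).
by rewrite [leLHS]mulrC.
Qed.

End Averaging.

(** * Riemann sums on the uniform grid *)

Section Riemann.
Context (R : realType).
Notation mu := (@lebesgue_measure R).

(** Uniform continuity near a compact segment, with the mesh itself as modulus so that it applies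
    directly to neighbouring nodes. The second point may leave the segment. *)
Lemma heine_segment (f : R -> R) (a c t e : R) : continuous f -> 0 < e -> 0 < t ->
  \forall n \near \oo, forall x, a <= x <= c -> forall y,
    `|x - y| <= mesh t n -> `|f x - f y| <= e.
Proof.
move=> cf e0 t0.
have := @segment_compact _ a c => /compact_near_coveringP /(_ nat \oo
  (fun n x => forall y, `|x - y| <= mesh t n -> `|f x - f y| <= e) _).
move=> /(_ _)h; apply: filterS (h _).
  move=> n hn x axc; apply: hn.
  by rewrite /= in_itv.
move=> x _.
have /cvgrPdist_le := cf x => /(_ (e / 2) (divr_gt0 e0 (ltr0n _ 2))).
move=> /nbhs_ballP[d /= d0 hd].
near=> x' n => y x'y.
have xx' : `|x - x'| < d / 2.
  near: x'; apply/nbhs_ballP; exists (d / 2); rewrite /= ?divr_gt0//.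
have mn : mesh t n < d / 2.
  near: n; have d20 : 0 < d / 2 by rewrite divr_gt0.
  near=> n; rewrite /mesh ltr_pdivrMr// mulrC -ltr_pdivrMr//.
  apply: (@lt_trans _ _ n%:R); last by rewrite ltr_nat.
  by near: n; exact: nbhs_infty_gtr.
have h1 : `|f x - f x'| <= e / 2.
  by apply: hd; rewrite /ball /=; lra.
have h2 : `|f x - f y| <= e / 2.
  apply: hd; rewrite /ball /=.
  have : `|x - y| <= `|x - x'| + `|x' - y| by exact: ler_distD.
  lra.
have : `|f x' - f y| <= `|f x' - f x| + `|f x - f y| by exact: ler_distD.
rewrite (distrC (f x') (f x)); lra.
Unshelve. all: by end_near. Qed.

Lemma riemann_cvg (f : R -> R) (t : R) : 0 < t ->
  {within `[0, +oo[, continuous f} ->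
  (fun n => \sum_(k < n.+1) f (node t n k) * mesh t n) @ \oo -->
  \int[mu]_(s in `[0, t]) f s.
Proof.
(* A Brownian path is known to be continuous on nonnegative times only; its even reflection is
   continuous on the whole line and has the same values on the grid. *)
move=> t0 cf0; pose g (s : R) := f `|s|.
have cg : continuous g.
  move=> x; rewrite /g.
  have x0 : `[0, +oo[%classic `|x| by rewrite /= in_itv/= andbT.
  move/subspace_continuousP : cf0 => /(_ _ x0) hx.
  apply/cvgrPdist_le => e e0.
  move/cvgrPdist_le : hx => /(_ e e0) /nbhs_ballP[r /= r0 hr].
  apply/nbhs_ballP; exists r => // y xy; apply: hr.
    by rewrite /ball /= (le_lt_trans (ler_dist_dist _ _)).
  by rewrite /= in_itv/= andbT.
have -> : \int[mu]_(s in `[0, t]) f s = \int[mu]_(s in `[0, t]) g s.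
  apply: eq_Rintegral => s; rewrite inE/= in_itv/= => /andP[s0 _].
  by rewrite /g ger0_norm.
have -> : (fun n => \sum_(k < n.+1) f (node t n k) * mesh t n) =
    (fun n => \sum_(k < n.+1) g (node t n k) * mesh t n).
  apply/funext => n; apply: eq_bigr => k _.
  by rewrite /g ger0_norm// node_ge0.
have [F FF F0] := continuous_antiderivative cg.
rewrite (antiderivative_FTC2 (ltW t0) cg FF).
apply/cvgrPdist_le => e e0.
have et0 : 0 < e / t by rewrite divr_gt0.
near=> n.
have : forall x, 0 <= x <= t -> forall y, `|x - y| <= mesh t n -> `|g x - g y| <= e / t.
  by near: n; exact: heine_segment.
move=> hn.
have -> : F t - F 0 = \sum_(k < n.+1) (F (node t n k.+1) - F (node t n k)).
  rewrite -(big_mkord xpredT (fun k => F (node t n k.+1) - F (node t n k))).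
  by rewrite telescope_sumr// node_last /node mul0r.
rewrite -sumrB (le_trans (ler_norm_sum _ _ _))//.
apply: le_trans (_ : \sum_(k < n.+1) e / t * mesh t n <= _); last first.
  rewrite sumr_const card_ord -mulr_natl /mesh le_eqVlt; apply/orP; left; apply/eqP.
  by field; rewrite nat1r !gt_eqF.
apply: ler_sum => k _.
have kk := ltW (node_lt n t0 k).
have [c /andP[c1 c2] ->] := antiderivative_MVT FF kk.
have ms := mesh_gt0 n t0; have nk := node_step t n k.
have n0 := node_ge0 n t0 k.
have nt : node t n k.+1 <= t by rewrite -{2}(node_last t n); apply: node_le => //; exact: ltn_ord.
rewrite nk -mulrBl normrM (gtr0_norm ms) ler_wpM2r//; first exact: ltW.
apply: hn; first by apply/andP; split; lra.
by rewrite ger0_norm; lra.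
Unshelve. all: by end_near. Qed.

(** With x and y the square roots of consecutive nodes, (y^2 - x^2) / y <= 2 (y - x), so the sum
    telescopes. Node 0, where the term would be singular, is left out. *)
Lemma sum_mesh_sqrt (t : R) n : 0 < t ->
  \sum_(0 <= k < n) mesh t n / Num.sqrt (node t n k.+1) <= 2 * Num.sqrt t.
Proof.
move=> t0; have ms := mesh_gt0 n t0.
have s0 : 0 < Num.sqrt (mesh t n) by rewrite sqrtr_gt0.
have h m : \sum_(0 <= k < m) mesh t n / Num.sqrt (node t n k.+1) <=
    2 * Num.sqrt (node t n m).
  elim: m => [|m ih]; first by rewrite big_nil mulr_ge0.
  rewrite big_nat_recr//=; apply: le_trans (lerD ih (lexx _)) _.
  have a0 := node_ge0 n t0 m; have ab := node_lt n t0 m.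
  have b0 : 0 < node t n m.+1 by exact: le_lt_trans ab.
  have e := node_step t n m.
  set x := Num.sqrt (node t n m); set y := Num.sqrt (node t n m.+1).
  have x0 : 0 <= x by rewrite sqrtr_ge0.
  have y0 : 0 < y by rewrite sqrtr_gt0.
  have ex : node t n m = x * x by rewrite -expr2 sqr_sqrtr.
  have ey : node t n m.+1 = y * y by rewrite -expr2 sqr_sqrtr// ltW.
  rewrite -e ex ey -lerBrDl ler_pdivrMr//.
  have := sqr_ge0 (x - y); nra.
apply: le_trans (h n) _; rewrite ler_wpM2l// ler_wsqrtr// -{2}(node_last t n).
exact: ltW (node_lt n t0 n).
Qed.

End Riemann.

(** * Time integrals along a Brownian path *)

Section PathIntegral.
Context (d : measure_display) (T : measurableType d) (R : realType).
Variable P : probability T R.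
Variable b : R -> T -> R.
Hypothesis hb : scalar_bm P b.
Notation Exp := (Ex P).
Notation mu := (@lebesgue_measure R).
Variables (t G : R) (g : R -> R) (Z : T -> R).
Hypothesis t0 : 0 < t.
Hypothesis cg : continuous g.
Hypothesis gG : forall x, `|g x| <= G.
Hypothesis mZ : mom P Z.
Hypothesis ZG : forall w, `|Z w| <= G * t.
Hypothesis Zint : {ae P, forall w, Z w = \int[mu]_(s in `[0, t]) g (b s w)}.
Hypothesis bcont :
  {ae P, forall w, {within `[0, +oo[, continuous (fun s => b s w)}}.

Definition riemann (f : R -> R) (n : nat) (w : T) : R :=
  \sum_(k < n.+1) f (b (node t n k) w) * mesh t n.

Lemma riemann_mom (f : R -> R) n : bounded_coef f -> mom P (riemann f n).
Proof.
move=> bf; apply: mom_sum => k; apply: momM; last exact: mom_cst.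
by apply: (coef_mom hb) => //; exact: node_ge0.
Qed.

Lemma riemann_bound (f : R -> R) C n w : (forall x, `|f x| <= C) ->
  `|riemann f n w| <= C * t.
Proof.
move=> fC; rewrite /riemann (le_trans (ler_norm_sum _ _ _))//.
apply: le_trans (_ : \sum_(k < n.+1) C * mesh t n <= _).
  apply: ler_sum => k _; have ms := mesh_gt0 n t0.
  by rewrite normrM (gtr0_norm ms) ler_wpM2r// ltW.
rewrite sumr_const card_ord -mulr_natl /mesh le_eqVlt; apply/orP; left; apply/eqP.
by field; rewrite nat1r gt_eqF.
Qed.

Let bg : bounded_coef g.
Proof. by split; [exact: continuous_measurable_fun|exists G]. Qed.

(** Almost sure convergence along continuous paths, dominated by a constant because both [Z] and the
    sums are bounded by G t for every [w]. *)
Lemma riemann_L2 :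
  (fun n => Exp (fun w => (Z w - riemann g n w) ^+ 2)) @ \oo --> (0 : R).
Proof.
pose fn n w := ((Z w - riemann g n w) ^+ 2)%:E.
have m2 n : mom P (fun w => (Z w - riemann g n w) ^+ 2).
  by apply: momX; apply: momB => //; exact: riemann_mom.
have mfn n : measurable_fun setT (fn n).
  by apply/measurable_EFinP; exact: mom_meas (m2 n).
have G0 : 0 <= G by exact: le_trans (gG 0).
have := @dominated_convergence _ _ R P setT measurableT fn (fun=> 0%E)
  (fun=> ((2 * (G * t)) ^+ 2)%:E) mfn (@measurable_cst _ _ _ _ _ _).
case.
- apply: filterS2 Zint bcont => w Zw bw _.
  have cgb : {within `[0, +oo[, continuous (fun s => g (b s w))}.
    move=> x; apply: continuous_comp; first exact: bw.
    exact: cg.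
  have h := riemann_cvg t0 cgb; rewrite -Zw in h.
  apply: cvg_EFin; first by near=> n.
  have : (Z w - riemann g n w) ^+ 2 @[n --> \oo] --> (Z w - Z w) ^+ 2.
    have c1 : (Z w - riemann g n w) @[n --> \oo] --> Z w - Z w.
      by apply: cvgB; [exact: cvg_cst|exact: h].
    by rewrite expr2; under eq_fun do rewrite expr2; exact: cvgM.
  by rewrite subrr expr0n.
- exact: finite_measure_integrable_cst.
- apply: aeW => w n _; rewrite /fn /= lee_fin ger0_norm ?sqr_ge0//.
  rewrite -[leLHS]real_normK ?num_real// lerXn2r ?nnegrE ?mulr_ge0 ?(ltW t0)//.
  have := ler_normB (Z w) (riemann g n w); have := ZG w.
  have := riemann_bound n w gG; lra.
move=> _ _; rewrite integral0 => h.
exact: (fine_cvg h).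
Unshelve. all: by end_near. Qed.

(** [Z] splits into two grid errors, the contribution of [g - gs], at most L t, and the two terms 2
    (H(b_t) - H(0)) and 2 [mart] of Ito's formula. Squaring five terms costs a factor 5. The last
    two contribute 20 B^2 t each: the first because [H] has Lipschitz constant [B], the second by
    the isometry. *)
Lemma sbm_upper (H h gs : R -> R) (B L C C' : R) :
  antiderivative H h -> antiderivative h gs -> (forall x, `|h x| <= B) ->
  (forall x, `|gs x| <= C) -> (forall x y, `|gs x - gs y| <= C' * `|x - y|) ->
  continuous gs -> (forall x, `|g x - gs x| <= L) ->
  Exp (fun w => Z w ^+ 2) <= 5 * (L * t) ^+ 2 + 40 * B ^+ 2 * t.
Proof.
move=> HH hh hB gsC gsC' cgs gL.
have ch := antiderivative_continuous hh.
have bh : bounded_coef h by split; [exact: continuous_measurable_fun|exists B].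
have bgs : bounded_coef gs by split; [exact: continuous_measurable_fun|exists C].
have HL x y : `|H x - H y| <= B * `|x - y| by exact: antiderivative_lip HH hB _ _.
pose D := 4 * C ^+ 2 * t ^+ 2 + 120 * C' ^+ 2 * t ^+ 3.
have key n : Exp (fun w => Z w ^+ 2) <=
    5 * Exp (fun w => (Z w - riemann g n w) ^+ 2) + 5 * (D / n.+1%:R) +
    (5 * (L * t) ^+ 2 + 40 * B ^+ 2 * t).
  have mr := ito_rest_mom hb n t0 bh bgs HH HL.
  have rb := ito_rest_bound hb n t0 bh bgs.1 gsC HH hh HL gsC'.
  have mM : mom P (mart b t n (fun=> h)) by apply: (mart_mom hb).
  have mbt := sbm_mom hb (ltW t0).
  have ms := mesh_gt0 n t0.
  have M2 : Exp (fun w => mart b t n (fun=> h) w ^+ 2) <= B ^+ 2 * t.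
    under eq_Ex do rewrite expr2.
    rewrite (mart_isometry hb)//.
    apply: le_trans (_ : \sum_(k < n.+1) mesh t n * B ^+ 2 <= _).
      apply: ler_sum => k _; rewrite ler_wpM2l ?(ltW ms)//.
      rewrite -[leRHS](Ex_cst P); apply: Ex_le; [|exact: mom_cst|].
        by apply: momM; apply: (coef_mom hb) => //; exact: node_ge0.
      move=> w; rewrite -expr2 -[leLHS]real_normK ?num_real//.
      by rewrite lerXn2r ?nnegrE// (le_trans _ (hB 0)).
    rewrite sumr_const card_ord -mulr_natl /mesh le_eqVlt; apply/orP; left; apply/eqP.
    by field; rewrite nat1r gt_eqF.
  have mdiff : mom P (fun w => Z w - riemann g n w).
    by apply: momB => //; exact: riemann_mom.
  have E1 : Exp (fun w => 5 * (Z w - riemann g n w) ^+ 2 +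
      5 * ito_rest b t n H h gs w ^+ 2 + 20 * B ^+ 2 * b t w ^+ 2 +
      20 * mart b t n (fun=> h) w ^+ 2 + 5 * (L * t) ^+ 2) =
      5 * Exp (fun w => (Z w - riemann g n w) ^+ 2) +
      5 * Exp (fun w => ito_rest b t n H h gs w ^+ 2) + 20 * B ^+ 2 * t +
      20 * Exp (fun w => mart b t n (fun=> h) w ^+ 2) + 5 * (L * t) ^+ 2.
    have q1 := momZ 5 (momX 2 mdiff); have q2 := momZ 5 (momX 2 mr).
    have q3 := momZ (20 * B ^+ 2) (momX 2 mbt); have q4 := momZ 20 (momX 2 mM).
    have q12 := momD q1 q2; have q123 := momD q12 q3; have q1234 := momD q123 q4.
    rewrite (ExD q1234 (mom_cst P _)) (ExD q123 q4) (ExD q12 q3) (ExD q1 q2).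
    rewrite (ExZ _ (momX 2 mdiff)) (ExZ _ (momX 2 mr)) (ExZ _ (momX 2 mbt)) (ExZ _ (momX 2 mM)).
    by rewrite (sbm_sq hb t0) Ex_cst.
  apply: le_trans (_ : Exp (fun w => 5 * (Z w - riemann g n w) ^+ 2 +
      5 * ito_rest b t n H h gs w ^+ 2 + 20 * B ^+ 2 * b t w ^+ 2 +
      20 * mart b t n (fun=> h) w ^+ 2 + 5 * (L * t) ^+ 2) <= _); last first.
    rewrite E1; move: rb M2; rewrite -/D; set dn := D / _.
    set e1 := Exp (fun w => ito_rest _ _ _ _ _ _ _ ^+ 2).
    set e2 := Exp (fun w => mart _ _ _ _ _ ^+ 2).
    set e3 := Exp _; move: dn e1 e2 e3 => dn e1 e2 e3; lra.
  apply: Ex_le; first exact: momX.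
    by do ![apply: momD|apply: momZ|exact: momX|exact: mom_cst].
  move=> w.
  have dL : `|riemann g n w - riemann gs n w| <= L * t.
    rewrite /riemann -sumrB.
    have -> : \sum_(k < n.+1) (g (b (node t n k) w) * mesh t n -
        gs (b (node t n k) w) * mesh t n) = riemann (fun x => g x - gs x) n w.
      by apply: eq_bigr => k _; rewrite mulrBl.
    exact: riemann_bound.
  have dH : `|H (b t w) - H 0| <= B * `|b t w|.
    by have := HL (b t w) 0; rewrite subr0.
  have e : Z w = (Z w - riemann g n w) + (riemann g n w - riemann gs n w) +
     ito_rest b t n H h gs w + 2 * (H (b t w) - H 0) - 2 * mart b t n (fun=> h) w.
    by rewrite /ito_rest /riemann; ring.
  have dL2 : (riemann g n w - riemann gs n w) ^+ 2 <= (L * t) ^+ 2.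
    rewrite -[leLHS]real_normK ?num_real// lerXn2r ?nnegrE//.
    exact: le_trans dL.
  have dH2 : (H (b t w) - H 0) ^+ 2 <= B ^+ 2 * b t w ^+ 2.
    rewrite -[leLHS]real_normK ?num_real// -[b t w ^+ 2]real_normK ?num_real// -exprMn.
    rewrite lerXn2r ?nnegrE//; exact: le_trans dH.
  rewrite {1}e.
  have five (x1 x2 x3 x4 x5 : R) : (x1 + x2 + x3 + 2 * x4 - 2 * x5) ^+ 2 <=
      5 * x1 ^+ 2 + 5 * x2 ^+ 2 + 5 * x3 ^+ 2 + 20 * x4 ^+ 2 + 20 * x5 ^+ 2.
    have := sqr_ge0 (x1 - x2); have := sqr_ge0 (x1 - x3).
    have := sqr_ge0 (x1 - 2 * x4); have := sqr_ge0 (x1 + 2 * x5).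
    have := sqr_ge0 (x2 - x3); have := sqr_ge0 (x2 - 2 * x4); have := sqr_ge0 (x2 + 2 * x5).
    have := sqr_ge0 (x3 - 2 * x4); have := sqr_ge0 (x3 + 2 * x5).
    have := sqr_ge0 (2 * x4 + 2 * x5); nra.
  apply: le_trans (five _ _ _ _ _) _; lra.
set V := 5 * (L * t) ^+ 2 + _ in key *.
have c : (fun n => 5 * Exp (fun w => (Z w - riemann g n w) ^+ 2) +
    5 * (D / n.+1%:R) + V) @ \oo --> 5 * 0 + 5 * (D * 0) + V.
  apply: cvgD; last exact: cvg_cst.
  apply: cvgD; apply: cvgM; [exact: cvg_cst|exact: riemann_L2|exact: cvg_cst|].
  by apply: cvgM; [exact: cvg_cst|exact: cvg_harmonic].
rewrite !mulr0 !add0r in c.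
rewrite -(cvg_lim (@Rhausdorff R) c); apply: limr_ge; first by apply/cvg_ex; exists V.
by near=> n; exact: key.
Unshelve. all: by end_near. Qed.

Lemma Ex_pairing_le (X Y : T -> R) (x y : R) : 0 <= x -> 0 <= y ->
  mom P X -> mom P Y ->
  Exp (fun w => X w ^+ 2) <= x ^+ 2 -> Exp (fun w => Y w ^+ 2) <= y ^+ 2 ->
  `|Exp (fun w => X w * Y w)| <= x * y.
Proof.
move=> x0 y0 mX mY hX hY; apply: le_trans (Ex_norm (momM mX mY)) _.
under eq_Ex do rewrite normrM.
exact: Ex_normM_le.
Qed.

(** Reversing the order of summation turns distances to [t] into nodes, since [t] is the node n +
    1. *)
Lemma sum_mesh_sqrt_rev n :
  \sum_(0 <= k < n) mesh t n / Num.sqrt (t - node t n k.+1) <= 2 * Num.sqrt t.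
Proof.
rewrite big_nat_rev /=; apply: le_trans (sum_mesh_sqrt n t0).
rewrite le_eqVlt; apply/orP; left; apply/eqP; apply: eq_big_nat => k /andP[_ kn].
congr (_ / Num.sqrt _); rewrite -{1}(node_last t n) /node -mulrBl -natrB; last first.
  by rewrite add0n ltnS leq_subLR leq_addl.
by rewrite add0n subnSK// subSn ?leq_subr// subKn// ltnW.
Qed.

(** The last hypothesis bounds the correlation at time u from below; its singularities at the two
    ends integrate to 2 sqrt t each. On the right stands the Cauchy-Schwarz bound for the pairing,
    in which replacing [g] by [gs] costs eps t. *)
Lemma sbm_lower (H h gs phi : R -> R) (B C C' kappa c d1 d2 eps : R) :
  antiderivative H h -> antiderivative h gs -> (forall x, `|h x| <= B) ->
  (forall x, `|gs x| <= C) -> (forall x y, `|gs x - gs y| <= C' * `|x - y|) ->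
  continuous gs -> (forall x, `|g x - gs x| <= eps) ->
  measurable_fun setT phi -> (forall x, `|phi x| <= kappa) ->
  0 <= d1 -> 0 <= d2 ->
  (forall u, 0 < u -> u < t ->
    c - d1 / Num.sqrt u - d2 / Num.sqrt (t - u) <=
    Exp (fun w => phi (b u w) * h (b u w)) - Exp (fun w => phi (b u w) * h (b t w))) ->
  2 * (c * t - 2 * (d1 + d2) * Num.sqrt t) <=
  (Num.sqrt (Exp (fun w => Z w ^+ 2)) + eps * t) * (kappa * Num.sqrt t).
Proof.
move=> HH hh hB gsC gsC' cgs geps mphi phik d10 d20 hcor.
have ch := antiderivative_continuous hh.
have bh : bounded_coef h by split; [exact: continuous_measurable_fun|exists B].
have bgs : bounded_coef gs by split; [exact: continuous_measurable_fun|exists C].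
have bphi : bounded_coef phi by split => //; exists kappa.
have HL x y : `|H x - H y| <= B * `|x - y| by exact: antiderivative_lip HH hB _ _.
have st : 0 < Num.sqrt t by rewrite sqrtr_gt0.
have k0 : 0 <= kappa by exact: le_trans (phik 0).
have eps0 : 0 <= eps by exact: le_trans (geps 0).
pose D := 4 * C ^+ 2 * t ^+ 2 + 120 * C' ^+ 2 * t ^+ 3.
pose e n := Exp (fun w => (Z w - riemann g n w) ^+ 2).
pose V := Num.sqrt (Exp (fun w => Z w ^+ 2)).
have key n : 2 * (c * t - c * (t / n.+1%:R) - 2 * (d1 + d2) * Num.sqrt t) <=
    (V + Num.sqrt (e n) + eps * t + Num.sqrt (D / n.+1%:R)) * (kappa * Num.sqrt t).
  (* The weight at node 0 is set to 0 because the correlation bound needs u > 0. This loses c t / (n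
     + 1), which vanishes in the limit. *)
  pose a (k : nat) := if k is 0%N then (fun=> 0) else phi.
  have ba k : bounded_coef (a k).
    by case: k => [|k]; [exact: bounded_coef_cst|exact: bphi].
  have ms := mesh_gt0 n t0.
  have mbt := sbm_mom hb (ltW t0).
  have mX := mart_mom hb n t0 ba.
  have mM : mom P (mart b t n (fun=> h)) by apply: (mart_mom hb).
  have mr := ito_rest_mom hb n t0 bh bgs HH HL.
  have rb := ito_rest_bound hb n t0 bh bgs.1 gsC HH hh HL gsC'.
  have momH : mom P (fun w => H (b t w)).
    have gt := sbm_gaussian hb (lexx 0) t0.
    rewrite (sbm_path0 hb) subr0 in gt.
    apply: (mom_gaussian st gt) (poly_growth_lip HL).
    exact: continuous_measurable_fun (antiderivative_continuous HH).
  have X2 : Exp (fun w => mart b t n a w ^+ 2) <= (kappa * Num.sqrt t) ^+ 2.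
    under eq_Ex do rewrite expr2.
    rewrite (mart_isometry hb)// exprMn (sqr_sqrtr (ltW t0)).
    apply: le_trans (_ : \sum_(k < n.+1) mesh t n * kappa ^+ 2 <= _).
      apply: ler_sum => k _; rewrite ler_wpM2l ?(ltW ms)//.
      rewrite -[leRHS](Ex_cst P); apply: Ex_le; [|exact: mom_cst|].
        by apply: momM; apply: (coef_mom hb) => //; exact: node_ge0.
      move=> w; rewrite -expr2 -[leLHS]real_normK ?num_real//.
      rewrite lerXn2r ?nnegrE//.
      by case: (nat_of_ord k) => [|k']; rewrite /a ?normr0.
    rewrite sumr_const card_ord -mulr_natl /mesh le_eqVlt; apply/orP; left; apply/eqP.
    by field; rewrite nat1r gt_eqF.
  have mdiff : mom P (fun w => Z w - riemann g n w).
    by apply: momB => //; exact: riemann_mom.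
  have mdel : mom P (fun w => riemann g n w - riemann gs n w).
    by apply: momB; exact: riemann_mom.
  have kt0 : 0 <= kappa * Num.sqrt t by rewrite mulr_ge0// ltW.
  have sqs (Y : T -> R) : Exp (fun w => Y w ^+ 2) <= Num.sqrt (Exp (fun w => Y w ^+ 2)) ^+ 2.
    by rewrite sqr_sqrtr//; apply: Ex_ge0 => w; exact: sqr_ge0.
  have D0 : 0 <= D / n.+1%:R.
    by apply: le_trans rb; apply: Ex_ge0 => w; exact: sqr_ge0.
  have dL w : `|riemann g n w - riemann gs n w| <= eps * t.
    rewrite /riemann -sumrB.
    have -> : \sum_(k < n.+1) (g (b (node t n k) w) * mesh t n -
        gs (b (node t n k) w) * mesh t n) = riemann (fun x => g x - gs x) n w.
      by apply: eq_bigr => k _; rewrite mulrBl.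
    exact: riemann_bound.
  have p1 := Ex_pairing_le (sqrtr_ge0 _) kt0 mZ mX (sqs Z) X2.
  have p2 := Ex_pairing_le (sqrtr_ge0 _) kt0 mdiff mX (sqs _) X2.
  have p3 : `|Exp (fun w => (riemann g n w - riemann gs n w) * mart b t n a w)|
      <= eps * t * (kappa * Num.sqrt t).
    apply: Ex_pairing_le => //; first by rewrite mulr_ge0// ltW.
    rewrite -[leRHS](Ex_cst P); apply: Ex_le; [exact: momX|exact: mom_cst|].
    move=> w; rewrite -[leLHS]real_normK ?num_real// lerXn2r ?nnegrE//.
    exact: le_trans (dL w).
  have p4 : `|Exp (fun w => ito_rest b t n H h gs w * mart b t n a w)|
      <= Num.sqrt (D / n.+1%:R) * (kappa * Num.sqrt t).
    by apply: Ex_pairing_le => //; rewrite (sqr_sqrtr D0).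
  (* The martingale has mean zero: integration by parts against the constant 1. This removes the
     constant [H 0] from the pairing. *)
  have mX0 : Exp (mart b t n a) = 0.
    have g1 : forall x : R, `|(fun=> 0 : R) x| <= 0 by move=> x; rewrite normr0.
    have := mart_ibp hb n t0 ba (antiderivative_cst 1) (@cst_continuous _ _ 0) g1.
    rewrite big1; last by move=> k _; under eq_Ex do rewrite mulr0; rewrite Ex_cst mulr0.
    by move=> <-; apply: eq_Ex => w; rewrite mulr1.
  have eH := mart_ibp hb n t0 ba HH ch hB.
  have eM := mart_isometry hb n t0 ba (fun=> bh).
  (* The main part comes out as minus twice the correlation integral. The sign is harmless, as
     Cauchy-Schwarz bounds the absolute value. *)
  have dec : Exp (fun w => Z w * mart b t n a w) =
     Exp (fun w => (Z w - riemann g n w) * mart b t n a w) +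
     Exp (fun w => (riemann g n w - riemann gs n w) * mart b t n a w) +
     Exp (fun w => ito_rest b t n H h gs w * mart b t n a w) +
     2 * Exp (fun w => mart b t n a w * H (b t w)) -
     2 * Exp (fun w => mart b t n a w * mart b t n (fun=> h) w).
    have q1 := momM mdiff mX; have q2 := momM mdel mX; have q3 := momM mr mX.
    have q4 := momM mX momH; have q5 := momM mX mM.
    have q12 := momD q1 q2; have q123 := momD q12 q3.
    have q6 := momZ (2 * H 0) mX.
    have q1234 := momD q123 (momZ 2 q4); have q12345 := momB q1234 (momZ 2 q5).
    rewrite -(ExZ 2 q4) -(ExZ 2 q5) -(ExD q1 q2) -(ExD q12 q3) -(ExD q123 (momZ 2 q4)).
    rewrite -(ExB q1234 (momZ 2 q5)).
    have z6 : Exp (fun w => 2 * H 0 * mart b t n a w) = 0 by rewrite ExZ// mX0 mulr0.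
    rewrite -[RHS]subr0 -z6 -(ExB q12345 q6).
    apply: eq_Ex => w; rewrite /ito_rest.
    set M1 := mart b t n a w; set M2 := mart b t n (fun=> h) w.
    rewrite -/(riemann gs n w); ring.
  have low : c * t - c * (t / n.+1%:R) - 2 * (d1 + d2) * Num.sqrt t <=
      Exp (fun w => mart b t n a w * mart b t n (fun=> h) w) -
      Exp (fun w => mart b t n a w * H (b t w)).
    rewrite eH eM -sumrB big_ord_recl /=.
    have -> : Exp (fun w => 0 * h (b (node t n 0) w)) = 0.
      by under eq_Ex do rewrite mul0r; rewrite Ex_cst.
    have -> : Exp (fun w => 0 * h (b t w)) = 0.
      by under eq_Ex do rewrite mul0r; rewrite Ex_cst.
    rewrite !mulr0 subrr add0r.
    rewrite -(big_mkord xpredT (fun k => mesh t n * Exp (fun w => phi (b (node t n k.+1) w) *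
       h (b (node t n k.+1) w)) - mesh t n * Exp (fun w => phi (b (node t n k.+1) w) * h (b t w)))).
    apply: le_trans (_ : \sum_(0 <= k < n) (c * mesh t n - d1 * (mesh t n / Num.sqrt (node t n k.+1))
       - d2 * (mesh t n / Num.sqrt (t - node t n k.+1))) <= _); last first.
      rewrite !big_seq; apply: ler_sum => k; rewrite mem_index_iota => /andP[_ kn].
      have u0 : 0 < node t n k.+1 by exact: le_lt_trans (node_ge0 n t0 k) (node_lt n t0 k).
      have ut : node t n k.+1 < t.
        by rewrite -{2}(node_last t n) /node ltr_pM2r// ltr_nat.
      have /(ler_wpM2l (ltW ms)) hk := hcor _ u0 ut.
      rewrite -mulrBr; apply: le_trans hk.
      by rewrite le_eqVlt; apply/orP; left; apply/eqP; ring.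
    rewrite (_ : \sum_(0 <= k < n) _ = c * (n%:R * mesh t n) -
        d1 * (\sum_(0 <= k < n) mesh t n / Num.sqrt (node t n k.+1)) -
        d2 * (\sum_(0 <= k < n) mesh t n / Num.sqrt (t - node t n k.+1))); last first.
      rewrite !sumrB sumr_const_nat subn0 -[X in X - _ - _]mulr_natl !mulr_sumr.
      by congr (_ - _ - _); ring.
    have s1 := ler_wpM2l d10 (sum_mesh_sqrt n t0).
    have s2 := ler_wpM2l d20 (sum_mesh_sqrt_rev n).
    have -> : c * t - c * (t / n.+1%:R) = c * (n%:R * mesh t n).
      by rewrite /mesh -natr1; field; rewrite natr1 gt_eqF.
    move: s1 s2; set S1 := \sum_(_ <= _ < _) _; set S2 := \sum_(_ <= _ < _) _.
    set nc := c * (n%:R * _); move: S1 S2 nc (Num.sqrt t) => S1 S2 nc q; lra.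
  have fin (l E1 E2 F1 F2 F3 P1 P2 P3 P4 : R) : l <= E1 - E2 ->
      `|F1 + F2 + F3 + 2 * E2 - 2 * E1| <= P1 -> `|F1| <= P2 -> `|F2| <= P3 ->
      `|F3| <= P4 -> 2 * l <= P1 + P2 + P3 + P4.
    rewrite !ler_norml => hl /andP[h1 _] /andP[_ h2] /andP[_ h3] /andP[_ h4]; lra.
  rewrite dec in p1.
  rewrite [leRHS](_ : _ = V * (kappa * Num.sqrt t) + Num.sqrt (e n) * (kappa * Num.sqrt t)
    + eps * t * (kappa * Num.sqrt t) + Num.sqrt (D / n.+1%:R) * (kappa * Num.sqrt t)); last first.
    by move: (kappa * _) (Num.sqrt (e n)) (Num.sqrt (D / _)) => x y z; ring.
  exact: fin low p1 p2 p3 p4.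
have ce : Num.sqrt (e n) @[n --> \oo] --> (0 : R).
  rewrite -(@sqrtr0 R); apply: continuous_cvg; first exact: sqrt_continuous.
  exact: riemann_L2.
have cD : Num.sqrt (D / n.+1%:R) @[n --> \oo] --> (0 : R).
  rewrite -(@sqrtr0 R); apply: continuous_cvg; first exact: sqrt_continuous.
  by rewrite -(mulr0 D); apply: cvgM; [exact: cvg_cst|exact: cvg_harmonic].
have cl : 2 * (c * t - c * (t / n.+1%:R) - 2 * (d1 + d2) * Num.sqrt t) @[n --> \oo] -->
    2 * (c * t - c * (t * 0) - 2 * (d1 + d2) * Num.sqrt t).
  apply: cvgM; first exact: cvg_cst.
  apply: cvgB; last exact: cvg_cst.
  apply: cvgB; first exact: cvg_cst.
  apply: cvgM; first exact: cvg_cst.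
  by apply: cvgM; [exact: cvg_cst|exact: cvg_harmonic].
have cr : (V + Num.sqrt (e n) + eps * t + Num.sqrt (D / n.+1%:R)) * (kappa * Num.sqrt t)
    @[n --> \oo] --> (V + 0 + eps * t + 0) * (kappa * Num.sqrt t).
  apply: cvgM; last exact: cvg_cst.
  apply: cvgD; last exact: cD.
  apply: cvgD; last exact: cvg_cst.
  by apply: cvgD; [exact: cvg_cst|exact: ce].
rewrite !mulr0 subr0 in cl; rewrite !addr0 in cr.
by apply: ler_cvg_to cl cr _; near=> n; exact: key.
Unshelve. all: by end_near. Qed.

End PathIntegral.

(** * Multiscale profiles *)

Section Multiscale.
Context (R : realType).
Notation mu := (@lebesgue_measure R).

Record multiscale (Rn gam : nat -> R) (f f' : nat -> R -> R)
    (K0 K1 gm gM rm rM : R) : Prop := Multiscale {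
  ms_R0 : Rn 0%N = 1;
  ms_Rlo : forall n, rm * Rn n <= Rn n.+1;
  ms_Rhi : forall n, Rn n.+1 <= rM * Rn n;
  ms_rm : 2 <= rm;
  ms_rM : rm <= rM;
  ms_g0 : gam 0%N = 1;
  ms_glo : forall n, gm * gam n <= gam n.+1;
  ms_ghi : forall n, gam n.+1 <= gM * gam n;
  ms_gm : 1 < gm;
  ms_gM : gm <= gM;
  ms_f : forall n, antiderivative (f n) (f' n);
  ms_f' : forall n, exists f'' C, antiderivative (f' n) f'' /\ forall x, `|f'' x| <= C;
  ms_f0 : forall n, f n 0 = 0;
  ms_K0 : forall n x y, `|f n x - f n y| <= K0;
  ms_K1 : forall n x, `|f' n x| <= K1;
  (* [c] is the mean of [f n]; [F1] and [F2] are bounded because their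
     derivatives are periodic of mean zero. *)
  ms_center : forall n, exists c F1 F2, [/\ forall x, `|f n x - c| <= K0,
    antiderivative F1 (fun x => f n x - c), (forall x, `|F1 x| <= K0),
    antiderivative F2 (fun x => (f n x - c) ^+ 2 - 1) &
    forall x, `|F2 x| <= K0 ^+ 2 + 1]
}.

(** A nonzero [inf] is not the default value 0, so the set is bounded below. *)
Lemma inf_le_elt (E : set R) x : inf E != 0 -> E x -> inf E <= x.
Proof.
move=> E0 Ex; apply: ge_inf => //; apply: contrapT => nlb.
by move: E0; rewrite inf_out ?eqxx// => -[].
Qed.

Lemma derive_antiderivative (F : R -> R) : (forall x, derivable F x 1) ->
  antiderivative F (derive1 F).
Proof. by move=> dF x; rewrite derive1E; exact: derivableP. Qed.

Lemma antiderivative_unique (F f g : R -> R) : antiderivative F f ->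
  antiderivative F g -> f =1 g.
Proof. by move=> Ff Fg x; have [_ <-] := Ff x; have [_ <-] := Fg x. Qed.

Lemma derivative_periodic (F f : R -> R) : antiderivative F f ->
  (forall x, F (x + 1) = F x) -> forall x, f (x + 1) = f x.
Proof.
move=> FF pF x; have := antiderivative_affine 1 1 FF.
have -> : (fun x => F (1 * x + 1)) = F by apply/funext => y; rewrite mul1r pF.
by move/antiderivative_unique => /(_ _ FF x); rewrite !mul1r.
Qed.

(** The constant is the mean over a period, so [F - c] averages to zero, and the variance
    normalisation says that [(F - c)^2 - 1] does too. Both then have bounded primitives; the
    normalisation enters the proof only here. *)
Lemma centered_antiderivatives (F f : R -> R) K : antiderivative F f ->
  (forall x, F (x + 1) = F x) -> (forall x y, `|F x - F y| <= K) ->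
  unit_integral (fun x => (F x - unit_integral F) ^+ 2) = 1 ->
  exists c F1 F2, [/\ forall x, `|F x - c| <= K,
    antiderivative F1 (fun x => F x - c), (forall x, `|F1 x| <= K),
    antiderivative F2 (fun x => (F x - c) ^+ 2 - 1) &
    forall x, `|F2 x| <= K ^+ 2 + 1].
Proof.
move=> FF pF FK; set c := unit_integral F => var.
have cF := antiderivative_continuous FF.
have iF := continuous_integrable_itv 0 1 cF.
have ic (k : R) : mu.-integrable `[0, 1]%classic (EFin \o (fun=> k)).
  exact: continuous_integrable_itv (@cst_continuous _ _ k).
have intc (k : R) : \int[mu]_(x in `[0, 1]) k = k.
  rewrite Rintegral_cst; last exact: measurable_itv.
  rewrite -[RHS]mulr1; congr (_ * _).
  transitivity (fine (1%:E : \bar R)) => //; congr fine.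
  apply: etrans (lebesgue_measure_itv `[0, 1]) _.
  by rewrite /= lte_fin ltr01 -EFinB subr0.
have Fc x : `|F x - c| <= K.
  have m0 : measurable (`[0, 1]%classic : set R) by exact: measurable_itv.
  have iFx (k : R) : mu.-integrable `[0, 1]%classic (EFin \o (fun y => F y + k)).
    apply: continuous_integrable_itv => y; apply: cvgD; [exact: cF|exact: cvg_cst].
  rewrite ler_norml /c /unit_integral; apply/andP; split.
    rewrite lerBrDr -lerBrDl opprK -[leRHS](intc (F x + K)).
    apply: le_Rintegral => // y _; have := FK x y; rewrite ler_norml => /andP[h _].
    by move: h; lra.
  rewrite lerBlDr -lerBlDl -[leLHS](intc (F x - K)).
  apply: le_Rintegral => // y _; have := FK x y; rewrite ler_norml => /andP[_ h].
  by move: h; lra.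
have cFc : continuous (fun x => F x - c).
  by move=> x; apply: cvgB; [exact: cF|exact: cvg_cst].
have cFc2' : continuous (fun x => (F x - c) ^+ 2).
  rewrite (_ : (fun x => _ ^+ 2) = (fun x => (F x - c) * (F x - c)))//.
  by move=> x; apply: cvgM; exact: cFc.
have cFc2 : continuous (fun x => (F x - c) ^+ 2 - 1).
  by move=> x; apply: cvgB; [exact: cFc2'|exact: cvg_cst].
have m01 : measurable (`[0, 1]%classic : set (measurableTypeR R)) by exact: measurable_itv.
have i1 : \int[mu]_(x in `[0, 1]) (F x - c) = 0.
  by rewrite (RintegralB m01 iF (ic c)) intc subrr.
have i2 : \int[mu]_(x in `[0, 1]) ((F x - c) ^+ 2 - 1) = 0.
  have iq := continuous_integrable_itv 0 1 cFc2'.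
  by rewrite (RintegralB m01 iq (ic 1)) intc -[X in X - _]/(unit_integral _) var subrr.
have [F1 F1F F1K] : exists2 F1, antiderivative F1 (fun x => F x - c) & forall x, `|F1 x| <= K.
  by apply: periodic_antiderivative => // x; rewrite pF.
have [F2 F2F F2K] : exists2 F2, antiderivative F2 (fun x => (F x - c) ^+ 2 - 1) &
    forall x, `|F2 x| <= K ^+ 2 + 1.
  apply: periodic_antiderivative => // x; first by rewrite pF.
  apply: le_trans (ler_normB _ _) _; rewrite normr1 lerD2r normrX.
  by rewrite lerXn2r ?nnegrE// (le_trans _ (FK 0 0)).
by exists c, F1, F2.
Qed.

Lemma shear_data_multiscale r gamma (hn : nat -> R -> R) :
  shear_data r gamma hn ->
  multiscale (scale R r) gamma hn (fun n => derive1 (hn n)) (K0 hn) (K1 hn)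
    (gamma_min gamma) (gamma_max gamma) (rho_min R r) (rho_max R r).
Proof.
case=> r0 rmin rmax g0 gmin gmax sm per h0 var k0 k1.
have rlo n : rho_min R r <= (r n.+1)%:~R.
  apply: inf_le_elt; last by exists n.
  by rewrite gt_eqF//; apply: lt_le_trans rmin.
have rhi n : (r n.+1)%:~R <= rho_max R r.
  by apply: ub_le_sup rmax _ _; exists n.
have scS n : scale R r n.+1 = (r n.+1)%:~R * scale R r n.
  by rewrite /scale big_nat_recr//= intrM mulrC.
have sc0 : scale R r 0 = 1 by rewrite /scale big_nat1 r0.
have scp n : 0 < scale R r n.
  elim: n => [|n ih]; first by rewrite sc0.
  by rewrite scS mulr_gt0//; apply: lt_le_trans (rlo n); apply: lt_le_trans rmin.
have glo n : gamma_min gamma <= gamma n.+1 / gamma n.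
  apply: inf_le_elt; last by exists n.
  by rewrite gt_eqF//; apply: lt_trans gmin.
have ghi n : gamma n.+1 / gamma n <= gamma_max gamma.
  by apply: ub_le_sup gmax _ _; exists n.
have gp n : 0 < gamma n.
  elim: n => [|n ih]; first by rewrite g0.
  have := lt_le_trans (lt_trans ltr01 gmin) (glo n).
  by rewrite pmulr_lgt0// invr_gt0.
have dh n : antiderivative (hn n) (derive1 (hn n)).
  by apply: derive_antiderivative => x; exact: (sm n 0%N x).
have dh' n : antiderivative (derive1 (hn n)) (derive1n 2 (hn n)).
  by apply: derive_antiderivative => x; exact: (sm n 1%N x).
have dh'' n : antiderivative (derive1n 2 (hn n)) (derive1n 3 (hn n)).
  by apply: derive_antiderivative => x; exact: (sm n 2%N x).
have perh' n := derivative_periodic (dh n) (per n).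
(* Without these bounds the inner [sup] and [inf] might be default values; [K0_fin] and [K1_fin]
   only control the outer suprema over the layers. *)
have bh n := periodic_bounded (antiderivative_continuous (dh n)) (per n).
have bh' n := periodic_bounded (antiderivative_continuous (dh' n)) (perh' n).
have bh'' n := periodic_bounded (antiderivative_continuous (dh'' n))
  (derivative_periodic (dh' n) (perh' n)).
have hK0 n x y : `|hn n x - hn n y| <= K0 hn.
  have osc a c : hn n a - hn n c <= K0 hn.
    apply: le_trans (_ : sup (range (hn n)) - inf (range (hn n)) <= _); last first.
      by apply: ub_le_sup k0 _ _; exists n.
    have [C hC] := bh n; apply: lerB.
      apply: ub_le_sup; last by exists a.
      by exists C => _ [z _ <-]; exact: le_trans (ler_norm _) (hC z).
    apply: ge_inf; last by exists c.
    exists (- C) => _ [z _ <-]; have := hC z; rewrite ler_norml => /andP[] //.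
  by rewrite ler_norml lerNl opprB !osc.
have hK1 n x : `|derive1 (hn n) x| <= K1 hn.
  apply: le_trans (_ : sup_norm (derive1 (hn n)) <= _); last first.
    by apply: ub_le_sup k1 _ _; exists n.
  have [C hC] := bh' n; apply: ub_le_sup; last by exists x.
  by exists C => _ [z _ <-].
split => //.
- by move=> n; rewrite scS ler_wpM2r// ltW.
- by move=> n; rewrite scS ler_wpM2r// ltW.
- exact: le_trans (rlo 0%N) (rhi 0%N).
- by move=> n; rewrite -ler_pdivlMr.
- by move=> n; rewrite -ler_pdivrMr.
- exact: le_trans (glo 0%N) (ghi 0%N).
- by move=> n; have [C hC] := bh'' n; exists (derive1n 2 (hn n)), C.
- by move=> n; exact: centered_antiderivatives (dh n) (per n) (hK0 n) (var n).
Qed.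

End Multiscale.

(** * Geometric sums over the layers and the limiting profile *)

Section MultiscaleSums.
Context (R : realType).
Variables (Rn gam : nat -> R) (f f' : nat -> R -> R) (K0 K1 gm gM rm rM : R).
Hypothesis ms : multiscale Rn gam f f' K0 K1 gm gM rm rM.
Hypothesis gMrm : gM < rm.

Definition layer k (x : R) : R := gam k * f k (x / Rn k).
Definition layer' k (x : R) : R := gam k * f' k (x / Rn k) / Rn k.
(** The sum of the powers (gM / rm)^k over k >= 1, the worst decay of gamma_k / R_k past a given
    layer. *)
Definition tail_rate : R := gM / (rm - gM).
Definition tail_slope N : R := K1 * (tail_rate * (gam N / Rn N)).

Let rm2 := ms_rm ms.
Let gm1 := ms_gm ms.

Lemma Rn_gt0 k : 0 < Rn k.
Proof.
elim: k => [|k ih]; first by rewrite (ms_R0 ms).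
by apply: lt_le_trans (ms_Rlo ms k); rewrite mulr_gt0//; move: rm2; lra.
Qed.

Lemma gam_gt0 k : 0 < gam k.
Proof.
elim: k => [|k ih]; first by rewrite (ms_g0 ms).
by apply: lt_le_trans (ms_glo ms k); rewrite mulr_gt0//; move: gm1; lra.
Qed.

Lemma K0_ge0 : 0 <= K0.
Proof. exact: le_trans (ms_K0 ms 0 0 0). Qed.

Lemma K1_ge0 : 0 <= K1.
Proof. exact: le_trans (ms_K1 ms 0 0). Qed.

Lemma gam_ge_exp k : gm ^+ k <= gam k.
Proof.
elim: k => [|k ih]; first by rewrite (ms_g0 ms).
apply: le_trans (ms_glo ms k); rewrite exprS ler_wpM2l//; move: gm1; lra.
Qed.

Lemma gam_le_exp k : gam k <= gM ^+ k.
Proof.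
elim: k => [|k ih]; first by rewrite (ms_g0 ms).
apply: le_trans (ms_ghi ms k) _; rewrite exprS ler_wpM2l//.
by have := ms_gM ms; move: gm1; lra.
Qed.

Lemma Rn_ge_exp k : rm ^+ k <= Rn k.
Proof.
elim: k => [|k ih]; first by rewrite (ms_R0 ms).
apply: le_trans (ms_Rlo ms k); rewrite exprS ler_wpM2l//; move: rm2; lra.
Qed.

Lemma Rn_le_exp k : Rn k <= rM ^+ k.
Proof.
elim: k => [|k ih]; first by rewrite (ms_R0 ms).
apply: le_trans (ms_Rhi ms k) _; rewrite exprS ler_wpM2l//.
by have := ms_rM ms; move: rm2; lra.
Qed.

Lemma tail_rate_ge0 : 0 <= tail_rate.
Proof.
by have := ms_gM ms; move: gm1 gMrm => h1 h2 h3; rewrite divr_ge0//; lra.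
Qed.

Lemma sum_gam_le N : \sum_(0 <= k < N.+1) gam k <= gm / (gm - 1) * gam N.
Proof.
have gm0 : 0 < gm - 1 by rewrite subr_gt0.
elim: N => [|N ih].
  by rewrite big_nat1 ler_peMl ?(ltW (gam_gt0 0))// ler_pdivlMr// mul1r gerBl.
rewrite big_nat_recr//=; apply: le_trans (lerD ih (lexx _)) _.
have := ms_glo ms N; have := gam_gt0 N; move: (gam N) (gam N.+1) => x y x0 xy.
have -> : gm / (gm - 1) * y = 1 / (gm - 1) * y + y by field; rewrite gt_eqF.
by rewrite lerD2r mulrAC [leRHS]mulrAC mul1r ler_wpM2r// invr_ge0 ltW.
Qed.

Lemma sum_tail_le N M : (N <= M)%N ->
  \sum_(N.+1 <= k < M.+1) gam k / Rn k <= tail_rate * (gam N / Rn N).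
Proof.
have d0 : 0 < rm - gM by rewrite subr_gt0.
(* Keeping the last term with a negative sign makes the bound inductive in [M]. *)
suff h : (N <= M)%N -> \sum_(N.+1 <= k < M.+1) gam k / Rn k <=
    tail_rate * (gam N / Rn N - gam M / Rn M).
  move=> /h /le_trans; apply; rewrite ler_wpM2l ?tail_rate_ge0// gerBl.
  by rewrite divr_ge0// ltW ?gam_gt0 ?Rn_gt0.
elim: M => [|M ih].
  by rewrite leqn0 => /eqP ->; rewrite big_geq// subrr mulr0.
rewrite leq_eqVlt => /predU1P[->|]; first by rewrite big_geq// subrr mulr0.
rewrite ltnS => NM; rewrite big_nat_recr//=; apply: le_trans (lerD (ih NM) (lexx _)) _.
set x := gam M / Rn M; set y := gam M.+1 / Rn M.+1.
have xy : rm * y <= gM * x.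
  have a1 : rm / Rn M.+1 <= (Rn M)^-1.
    rewrite ler_pdivrMr ?Rn_gt0// mulrC ler_pdivlMr ?Rn_gt0//; exact: ms_Rlo ms M.
  have -> : rm * y = gam M.+1 * (rm / Rn M.+1) by rewrite /y; ring.
  have -> : gM * x = gM * gam M * (Rn M)^-1 by rewrite /x; ring.
  apply: ler_pM => //; first exact: ltW (gam_gt0 _).
  - by rewrite divr_ge0 ?(ltW (Rn_gt0 _))//; move: rm2; lra.
  - exact: ms_ghi ms M.
rewrite /tail_rate -subr_ge0.
have -> : gM / (rm - gM) * (gam N / Rn N - y) -
   (gM / (rm - gM) * (gam N / Rn N - x) + y) = (gM * x - rm * y) / (rm - gM).
  by field; rewrite !gt_eqF ?Rn_gt0//.
by rewrite divr_ge0 ?subr_ge0// ltW.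
Qed.

(** R_k grows by a factor of at least rm while gamma_k does not decrease. Leaving out layer N
    produces the divisor rm - 1, the gain from the separation of scales. *)
Lemma sum_fast_le N : \sum_(0 <= k < N) gam k * Rn k <= gam N * Rn N / (rm - 1).
Proof.
have r1 : 0 < rm - 1 by move: rm2; lra.
elim: N => [|N ih].
  by rewrite big_nil divr_ge0 ?(ltW r1)// mulr_ge0// ltW ?gam_gt0 ?Rn_gt0.
rewrite big_nat_recr//=; apply: le_trans (lerD ih (lexx _)) _.
rewrite ler_pdivlMr// mulrDl divfK ?gt_eqF//.
have h1 := ms_Rlo ms N; have h2 := ms_glo ms N.
have p1 := Rn_gt0 N; have p2 := gam_gt0 N; have p3 := Rn_gt0 N.+1.
apply: le_trans (_ : gam N * Rn N.+1 <= _).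
  have := ler_wpM2l (ltW p2) h1; lra.
rewrite ler_wpM2r ?(ltW p3)//; apply: le_trans h2.
by rewrite ler_peMl ?(ltW p2)// ltW.
Qed.

Lemma sum_fast_le2 N : \sum_(0 <= k < N.+1) gam k * Rn k <= 2 * (gam N * Rn N).
Proof.
rewrite big_nat_recr//=; apply: le_trans (lerD (sum_fast_le N) (lexx _)) _.
have p : 0 < gam N * Rn N by rewrite mulr_gt0 ?gam_gt0 ?Rn_gt0.
have r1 : 0 < rm - 1 by move: rm2; lra.
rewrite mulr_natl mulr2n lerD2r ler_pdivrMr// ler_peMr ?(ltW p)//; move: rm2; lra.
Qed.

Lemma rescale_antiderivative (F G : R -> R) (r : R) : antiderivative F G ->
  antiderivative (fun x => F (x / r)) (fun x => G (x / r) / r).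
Proof.
move=> FG; have := antiderivative_affine r^-1 0 FG.
rewrite (_ : (fun x => F (r^-1 * x + 0)) = (fun x => F (x / r))); last first.
  by apply/funext => x; rewrite addr0 mulrC.
by apply: eq_antiderivative => x; rewrite addr0 [RHS]mulrC [x / r]mulrC.
Qed.

Lemma layer_antiderivative k : antiderivative (layer k) (layer' k).
Proof.
apply: eq_antiderivative (antiderivativeZ (gam k) (rescale_antiderivative (Rn k) (ms_f ms k))).
by move=> x; rewrite /layer' mulrA.
Qed.

Lemma layer'_bound k x : `|layer' k x| <= K1 * (gam k / Rn k).
Proof.
rewrite /layer' !normrM normfV (gtr0_norm (gam_gt0 k)) (gtr0_norm (Rn_gt0 k)).
rewrite mulrAC [leRHS]mulrC ler_wpM2l ?divr_ge0 ?(ltW (gam_gt0 k)) ?(ltW (Rn_gt0 k))//.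
exact: ms_K1 ms _ _.
Qed.

Lemma layer'_lip k : exists2 C, 0 <= C & forall x y, `|layer' k x - layer' k y| <= C * `|x - y|.
Proof.
have [f'' [C [ff' fC]]] := ms_f' ms k.
exists (gam k / Rn k * (C / Rn k)).
  have C0 : 0 <= C by exact: le_trans (fC 0).
  by rewrite !mulr_ge0// ?invr_ge0 ltW ?gam_gt0 ?Rn_gt0.
move=> x y.
have := antiderivative_lip ff' fC (y / Rn k) (x / Rn k) => h.
have -> : layer' k x - layer' k y =
    gam k / Rn k * (f' k (x / Rn k) - f' k (y / Rn k)) by rewrite /layer'; ring.
have p : 0 <= gam k / Rn k by rewrite divr_ge0// ltW ?gam_gt0 ?Rn_gt0.
rewrite normrM (ger0_norm p) -[leRHS]mulrA; apply: ler_wpM2l => //.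
apply: le_trans h _; rewrite -mulrBl normrM normfV (gtr0_norm (Rn_gt0 k)).
by rewrite -mulrA [_^-1 * _]mulrC.
Qed.

Lemma sum_layer_antiderivative m n : antiderivative
  (fun x => \sum_(m <= k < n) layer k x) (fun x => \sum_(m <= k < n) layer' k x).
Proof. by apply: antiderivative_sum => k; exact: layer_antiderivative. Qed.

Lemma sum_layer'_lip m n : exists C, forall x y,
  `|\sum_(m <= k < n) layer' k x - \sum_(m <= k < n) layer' k y| <= C * `|x - y|.
Proof.
have hc k := cid2 (layer'_lip k).
exists (\sum_(m <= k < n) s2val (hc k)) => x y.
rewrite -sumrB (le_trans (ler_norm_sum _ _ _))// mulr_suml ler_sum// => k _.
exact: (s2valP' (hc k)).
Qed.


Lemma lip_continuous (F : R -> R) C : (forall x y, `|F x - F y| <= C * `|x - y|) ->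
  continuous F.
Proof.
move=> FC x; have C0 : 0 <= C.
  by have := FC 1 0; rewrite subr0 normr1 mulr1; exact: le_trans.
apply/cvgrPdist_le => e e0.
have d0 : 0 < e / (C + 1) by rewrite divr_gt0// ltr_wpDl.
apply/nbhs_ballP; exists (e / (C + 1)) => // y; rewrite /ball /= => xy.
apply: le_trans (FC x y) _; apply: le_trans (_ : (C + 1) * (e / (C + 1)) <= _).
  by rewrite ler_pM// ?lerDl// ltW.
by rewrite mulrC divfK// gt_eqF// ltr_wpDl.
Qed.

Lemma sum_layer'_continuous m n : continuous (fun x => \sum_(m <= k < n) layer' k x).
Proof. by have [C hC] := sum_layer'_lip m n; exact: lip_continuous hC. Qed.

Lemma tail_slope_ge0 N : 0 <= tail_slope N.
Proof.
apply: mulr_ge0; first exact: K1_ge0.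
apply: mulr_ge0; first exact: tail_rate_ge0.
exact: divr_ge0 (ltW (gam_gt0 N)) (ltW (Rn_gt0 N)).
Qed.

Lemma tail_layer' N M x : `|\sum_(N.+1 <= k < M) layer' k x| <= tail_slope N.
Proof.
have [NM|MN] := ltnP N M; last first.
  by rewrite big_geq ?normr0 ?tail_slope_ge0// ltnW.
case: M NM => // M; rewrite ltnS => NM.
rewrite (le_trans (ler_norm_sum _ _ _))//.
apply: le_trans (_ : \sum_(N.+1 <= k < M.+1) K1 * (gam k / Rn k) <= _).
  by apply: ler_sum => k _; exact: layer'_bound.
by rewrite -mulr_sumr ler_wpM2l ?K1_ge0// sum_tail_le.
Qed.

Lemma tail_layer N M x y :
  `|\sum_(N.+1 <= k < M) layer k x - \sum_(N.+1 <= k < M) layer k y| <=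
  tail_slope N * `|x - y|.
Proof.
have := antiderivative_lip (sum_layer_antiderivative N.+1 M) (tail_layer' N M) y x.
by [].
Qed.

Lemma tail_slope_cvg0 : tail_slope @ \oo --> (0 : R).
Proof.
have gM0 : 0 < gM by have := ms_gM ms; move: gm1; lra.
have rm0 : 0 < rm by move: rm2; lra.
have q1 : `|gM / rm| < 1 by rewrite gtr0_norm ?divr_gt0// ltr_pdivrMr// mul1r.
have c : (fun N => K1 * (tail_rate * (gM / rm) ^+ N)) @ \oo --> K1 * (tail_rate * 0).
  by apply: cvgM; [exact: cvg_cst|apply: cvgM; [exact: cvg_cst|exact: cvg_expr]].
rewrite !mulr0 in c.
apply: (squeeze_cvgr _ (cvg_cst 0) c); near=> N; rewrite tail_slope_ge0 /=.
rewrite !ler_wpM2l ?K1_ge0 ?tail_rate_ge0// expr_div_n.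
have p1 := gam_gt0 N; have p2 := Rn_gt0 N.
by rewrite ler_pM ?invr_ge0 ?(ltW p1) ?(ltW p2)// ?gam_le_exp//
  lef_pV2 ?posrE ?exprn_gt0// Rn_ge_exp.
Unshelve. all: by end_near. Qed.

Lemma layer0 k : layer k 0 = 0.
Proof. by rewrite /layer mul0r (ms_f0 ms) mulr0. Qed.

Lemma summable_bound (v : nat -> R) C :
  (forall k, `|v k| <= C * (gam k / Rn k)) -> cvgn (series v).
Proof.
move=> vC.
have gM0 : 0 < gM by have := ms_gM ms; move: gm1; lra.
have rm0 : 0 < rm by move: rm2; lra.
have C0 : 0 <= C.
  have := vC 0%N; rewrite (ms_g0 ms) (ms_R0 ms) divr1 mulr1; exact: le_trans.
have q1 : `|gM / rm| < 1 by rewrite gtr0_norm ?divr_gt0// ltr_pdivrMr// mul1r.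
apply: normed_cvg; apply: (@series_le_cvg _ _ (geometric C (gM / rm))) => //=.
- by move=> n; rewrite mulr_ge0// exprn_ge0// divr_ge0// ltW.
- move=> k; apply: le_trans (vC k) _; rewrite ler_wpM2l// expr_div_n.
  have p1 := gam_gt0 k; have p2 := Rn_gt0 k.
  by rewrite ler_pM ?invr_ge0 ?(ltW p1) ?(ltW p2)// ?gam_le_exp//
  lef_pV2 ?posrE ?exprn_gt0// Rn_ge_exp.
- exact: is_cvg_geometric_series.
Qed.

Lemma layer_bound k x : `|layer k x| <= K1 * `|x| * (gam k / Rn k).
Proof.
have := antiderivative_lip (layer_antiderivative k) (layer'_bound k) 0 x.
by rewrite layer0 !subr0 mulrAC.
Qed.

Definition profile (x : R) : R := limn (series (fun k => layer k x)).
Definition profile' (x : R) : R := limn (series (fun k => layer' k x)).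

Lemma profile_cvg x : series (fun k => layer k x) @ \oo --> profile x.
Proof. exact: (summable_bound (fun k => layer_bound k x)). Qed.

Lemma profile'_cvg x : series (fun k => layer' k x) @ \oo --> profile' x.
Proof. exact: (summable_bound (fun k => layer'_bound k x)). Qed.

Lemma norm_cvg_le (v : nat -> R) l C : v @ \oo --> l ->
  (forall n, `|v n| <= C) -> `|l| <= C.
Proof.
move=> vl vC; have nl : (fun n => `|v n|) @ \oo --> `|l| by exact: cvg_norm vl.
rewrite -(cvg_lim (@Rhausdorff R) nl); apply: limr_le; first by apply/cvg_ex; exists `|l|.
by near=> n; exact: vC.
Unshelve. all: by end_near. Qed.

Lemma profile'_tail N x :
  `|profile' x - \sum_(0 <= k < N.+1) layer' k x| <= tail_slope N.
Proof.
have c : (fun n => series (fun k => layer' k x) (n + N.+1)%N -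
    \sum_(0 <= k < N.+1) layer' k x) @ \oo -->
    profile' x - \sum_(0 <= k < N.+1) layer' k x.
  apply: cvgB; last exact: cvg_cst.
  by have := @profile'_cvg x; rewrite -(cvg_shiftn N.+1).
apply: (norm_cvg_le c) => n; rewrite /series /=.
rewrite (@big_cat_nat _ _ _ N.+1)//=; last exact: leq_addl.
by rewrite addrAC subrr add0r tail_layer'.
Qed.

Lemma profile_tail N x y :
  `|(profile x - profile y) -
    (\sum_(0 <= k < N.+1) layer k x - \sum_(0 <= k < N.+1) layer k y)| <=
  tail_slope N * `|x - y|.
Proof.
have c : (fun n => (series (fun k => layer k x) (n + N.+1)%N -
     series (fun k => layer k y) (n + N.+1)%N) -
    (\sum_(0 <= k < N.+1) layer k x - \sum_(0 <= k < N.+1) layer k y)) @ \oo -->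
    (profile x - profile y) -
    (\sum_(0 <= k < N.+1) layer k x - \sum_(0 <= k < N.+1) layer k y).
  apply: cvgB; last exact: cvg_cst.
  apply: cvgB.
    by have := @profile_cvg x; rewrite -(cvg_shiftn N.+1).
  by have := @profile_cvg y; rewrite -(cvg_shiftn N.+1).
apply: (norm_cvg_le c) => n; rewrite /series /=.
rewrite !(@big_cat_nat _ _ _ N.+1 0 (n + N.+1))//=; try exact: leq_addl.
set a := \sum_(0 <= _ < _) _; set a' := \sum_(0 <= _ < _) _.
rewrite (_ : _ - (a - a') = \sum_(N.+1 <= k < n + N.+1) layer k x -
   \sum_(N.+1 <= k < n + N.+1) layer k y); last by ring.
exact: tail_layer.
Qed.

Lemma profile'_continuous : continuous profile'.
Proof.
move=> x; apply/cvgrPdist_le => e e0.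
have [N hN] : exists N, tail_slope N <= e / 3.
  have /cvgr0Pnorm_le /(_ (e / 3)) := tail_slope_cvg0.
  rewrite divr_gt0// => /(_ isT) [N _ hN]; exists N.
  exact: le_trans (ler_norm _) (hN N (leqnn _)).
have /cvgrPdist_le /(_ (e / 3)) := @sum_layer'_continuous 0 N.+1 x.
rewrite divr_gt0// => /(_ isT); apply: filterS => y hy.
have := profile'_tail N x; have := profile'_tail N y; move: hy.
rewrite !ler_norml => /andP[a1 a2] /andP[b1 b2] /andP[c1 c2]; apply/andP; split; lra.
Qed.

(** Difference quotients of the tail are bounded by [tail_slope] uniformly in the increment, which
    allows differentiating term by term with an e / 3 argument on the Caratheodory slope. *)
Lemma profile_antiderivative : antiderivative profile profile'.
Proof.
move=> x; apply/is_derive1_caratheodory.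
exists (fun z => if z == x then profile' x else (profile z - profile x) / (z - x)).
rewrite eqxx; split => //.
  move=> z; case: eqP => [->|/eqP]; first by rewrite !subrr mulr0.
  by rewrite -subr_eq0 => /divfK ->.
apply/cvgrPdist_le => e e0; rewrite eqxx.
have [N hN] : exists N, tail_slope N <= e / 3.
  have /cvgr0Pnorm_le /(_ (e / 3)) := tail_slope_cvg0.
  rewrite divr_gt0// => /(_ isT) [N _ hN]; exists N.
  exact: le_trans (ler_norm _) (hN N (leqnn _)).
have /is_derive1_caratheodory [q [qE qc qx]] := @sum_layer_antiderivative 0 N.+1 x.
move/cvgrPdist_le : qc => /(_ (e / 3)); rewrite divr_gt0// => /(_ isT).
rewrite qx; apply: filterS => y hy.
case: eqP => [_|/eqP yx]; first by rewrite subrr normr0 ltW.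
have yx0 : 0 < `|y - x| by rewrite normr_gt0 subr_eq0.
have h1 : `|(profile y - profile x) / (y - x) - q y| <= tail_slope N.
  have := profile_tail N y x; rewrite qE => h.
  rewrite -(ler_pM2r yx0) -normrM mulrBl divfK ?subr_eq0//.
have := profile'_tail N x; move: hy h1.
rewrite !ler_norml => /andP[a1 a2] /andP[b1 b2] /andP[c1 c2]; apply/andP; split; lra.
Qed.

Lemma profile'_bound x : `|profile' x| <= K1 * (1 + tail_rate).
Proof.
have := profile'_tail 0 x; rewrite big_nat1 /tail_slope (ms_g0 ms) (ms_R0 ms) divr1 mulr1.
have := layer'_bound 0 x; rewrite (ms_g0 ms) (ms_R0 ms) divr1 mulr1.
move=> h1 h2; have := ler_normD (profile' x - layer' 0 x) (layer' 0 x).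
rewrite subrK; lra.
Qed.

End MultiscaleSums.

(** * Bounds on the second moment *)

Section VarianceBounds.
Context (d : measure_display) (T : measurableType d) (R : realType).
Variable P : probability T R.
Variable b : R -> T -> R.
Hypothesis hb : scalar_bm P b.
Notation Exp := (Ex P).
Notation mu := (@lebesgue_measure R).
Variables (Rn gam : nat -> R) (f f' : nat -> R -> R) (K0 K1 gm gM rm rM : R).
Hypothesis ms : multiscale Rn gam f f' K0 K1 gm gM rm rM.
Hypothesis gMrm : gM < rm.
Variables (t : R) (Z : T -> R).
Notation kap := (tail_rate gM rm).
Notation g := (profile' Rn gam f').
Notation G := (K1 * (1 + kap)).
Hypothesis t0 : 0 < t.
Hypothesis mZ : mom P Z.
Hypothesis ZG : forall w, `|Z w| <= G * t.
Hypothesis Zint : {ae P, forall w, Z w = \int[mu]_(s in `[0, t]) g (b s w)}.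
Hypothesis bcont :
  {ae P, forall w, {within `[0, +oo[, continuous (fun s => b s w)}}.

Notation lay := (layer Rn gam f).
Notation lay' := (layer' Rn gam f').
Notation slope := (tail_slope Rn gam K1 gM rm).

Let cg : continuous g := profile'_continuous ms gMrm.
Let gG : forall x, `|g x| <= G := profile'_bound ms gMrm.

Let slc m n : continuous (fun x => \sum_(m <= k < n) lay' k x).
Proof. exact: (@sum_layer'_continuous _ _ _ _ _ _ _ _ _ _ _ ms m n). Qed.

Lemma layer_le k x : `|lay k x| <= K0 * gam k.
Proof.
rewrite /layer normrM (gtr0_norm (gam_gt0 ms k)) mulrC ler_wpM2r ?(ltW (gam_gt0 ms k))//.
by have := ms_K0 ms k (x / Rn k) 0; rewrite (ms_f0 ms) subr0.
Qed.

Lemma sum_layer_le m n x :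
  `|\sum_(m <= k < n) lay k x| <= K0 * \sum_(m <= k < n) gam k.
Proof.
rewrite (le_trans (ler_norm_sum _ _ _))// mulr_sumr ler_sum// => k _.
exact: layer_le.
Qed.

Lemma sum_layer'_bounded N x :
  `|\sum_(0 <= k < N.+1) lay' k x| <= G + slope N.
Proof.
have := profile'_tail ms gMrm N x; have := gG x.
have := ler_normB (g x) (g x - \sum_(0 <= k < N.+1) lay' k x).
rewrite opprB addrC subrK; lra.
Qed.

(** [sbm_upper] with the layers up to N: their sum is at most of order gamma_N by geometric growth,
    and the tail contributes (gamma_N t / R_N)^2, at most gamma_N^2 t by the choice of N. *)
Lemma variance_upper N : Num.sqrt t <= Rn N ->
  Exp (fun w => Z w ^+ 2) <=
  (5 * (K1 * kap) ^+ 2 + 40 * (K0 * (gm / (gm - 1))) ^+ 2) * (gam N ^+ 2 * t).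
Proof.
move=> tR.
have [C' hC'] := sum_layer'_lip ms 0 N.+1.
have hh := sum_layer_antiderivative ms 0 N.+1.
have [H HH _] := continuous_antiderivative (antiderivative_continuous hh).
have hB x : `|\sum_(0 <= k < N.+1) lay k x| <= K0 * (gm / (gm - 1) * gam N).
  apply: le_trans (sum_layer_le _ _ _) _; rewrite ler_wpM2l ?(K0_ge0 ms)//.
  exact: sum_gam_le ms _.
have := sbm_upper hb t0 cg gG mZ ZG Zint bcont HH hh hB (sum_layer'_bounded N) hC'
  (@slc 0 N.+1) (profile'_tail ms gMrm N).
move=> /le_trans; apply.
have tR2 : t <= Rn N ^+ 2.
  by rewrite -[leLHS](sqr_sqrtr (ltW t0)) lerXn2r ?nnegrE ?sqrtr_ge0 ?(ltW (Rn_gt0 ms N)).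
have Rp := Rn_gt0 ms N.
have s1 : (slope N * t) ^+ 2 <= (K1 * kap) ^+ 2 * (gam N ^+ 2 * t).
  have -> : (slope N * t) ^+ 2 = (K1 * kap * gam N) ^+ 2 * t * (t / Rn N ^+ 2).
    by rewrite /tail_slope; field; rewrite gt_eqF.
  have -> : (K1 * kap) ^+ 2 * (gam N ^+ 2 * t) = (K1 * kap * gam N) ^+ 2 * t * 1 by ring.
  apply: ler_wpM2l; first exact: mulr_ge0 (sqr_ge0 _) (ltW t0).
  by rewrite ler_pdivrMr ?exprn_gt0// mul1r.
have -> : 40 * (K0 * (gm / (gm - 1) * gam N)) ^+ 2 * t =
    40 * (K0 * (gm / (gm - 1))) ^+ 2 * (gam N ^+ 2 * t) by rewrite !exprMn; ring.
rewrite [leRHS]mulrDl; apply: lerD => //.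
by rewrite -[leRHS]mulrA ler_wpM2l.
Qed.

(** * Lower bound by pairing with the N-th layer *)

Section Lower.
Variable N : nat.
Variables (c : nat -> R) (F1 F2 : nat -> R -> R).
Hypothesis fc : forall n x, `|f n x - c n| <= K0.
Hypothesis F1f : forall n, antiderivative (F1 n) (fun x => f n x - c n).
Hypothesis F1K : forall n x, `|F1 n x| <= K0.
Hypothesis F2f : forall n, antiderivative (F2 n) (fun x => (f n x - c n) ^+ 2 - 1).
Hypothesis F2K : forall n x, `|F2 n x| <= K0 ^+ 2 + 1.

Let phi x := f N (x / Rn N) - c N.
Let phi' x := f' N (x / Rn N) / Rn N.
Let clayer k x := gam k * (f k (x / Rn k) - c k).
Let Flayer k x := gam k * Rn k * F1 k (x / Rn k).
Let fast x := \sum_(0 <= k < N) clayer k x.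
Let slow M x := \sum_(N.+1 <= k < M) lay k x.

Let Rp : 0 < Rn N := Rn_gt0 ms N.
Let gp : 0 < gam N := gam_gt0 ms N.
Let K00 : 0 <= K0 := K0_ge0 ms.
Let K10 : 0 <= K1 := K1_ge0 ms.
Let kap0 : 0 <= kap := tail_rate_ge0 ms gMrm.

Let Flayer_antiderivative k : antiderivative (Flayer k) (clayer k).
Proof.
apply: eq_antiderivative
  (antiderivativeZ (gam k * Rn k) (rescale_antiderivative (Rn k) (F1f k))) => x.
by rewrite /clayer; field; rewrite gt_eqF// (Rn_gt0 ms).
Qed.

Let Flayer_le n x : `|\sum_(0 <= k < n) Flayer k x| <= K0 * \sum_(0 <= k < n) gam k * Rn k.
Proof.
rewrite (le_trans (ler_norm_sum _ _ _))// mulr_sumr ler_sum// => k _.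
have p : 0 <= gam k * Rn k by rewrite mulr_ge0// ltW ?(gam_gt0 ms) ?(Rn_gt0 ms).
by rewrite /Flayer normrM (ger0_norm p) mulrC ler_wpM2r.
Qed.

Let clayer_le n x : `|\sum_(0 <= k < n) clayer k x| <= K0 * \sum_(0 <= k < n) gam k.
Proof.
rewrite (le_trans (ler_norm_sum _ _ _))// mulr_sumr ler_sum// => k _.
have p := ltW (gam_gt0 ms k).
by rewrite /clayer normrM (ger0_norm p) mulrC ler_wpM2r.
Qed.

Let sumF_antiderivative n : antiderivative (fun x => \sum_(0 <= k < n) Flayer k x)
  (fun x => \sum_(0 <= k < n) clayer k x).
Proof. by apply: antiderivative_sum => k. Qed.

Let sumc_cts n : continuous (fun x => \sum_(0 <= k < n) clayer k x).
Proof.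
have h k : antiderivative (clayer k) (fun x => gam k * (f' k (x / Rn k) / Rn k)).
  apply: antiderivativeZ.
  apply: eq_antiderivative (antiderivativeB (rescale_antiderivative (Rn k) (ms_f ms k))
    (antiderivative_cst (c k))) => x.
  by rewrite subr0.
exact: antiderivative_continuous (antiderivative_sum (index_iota 0 n) h).
Qed.

Let phi_antiderivative : antiderivative phi phi'.
Proof.
apply: eq_antiderivative (antiderivativeB (rescale_antiderivative (Rn N) (ms_f ms N))
    (antiderivative_cst (c N))) => x.
by rewrite subr0.
Qed.

Let phi_cts : continuous phi := antiderivative_continuous phi_antiderivative.

Let phi_le x : `|phi x| <= K0. Proof. exact: fc. Qed.

Let phi'_cts : continuous phi'.
Proof.
have [f'' [C [ff' fC]]] := ms_f' ms N => x.
apply: cvgM; last exact: cvg_cst.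
exact: antiderivative_continuous (rescale_antiderivative (Rn N) ff') x.
Qed.

Let phi'_le x : `|phi' x| <= K1 / Rn N.
Proof.
rewrite /phi' normrM normfV (gtr0_norm Rp) ler_wpM2r ?invr_ge0 ?(ltW Rp)//.
exact: ms_K1 ms _ _.
Qed.

Let Phi x := Rn N * F1 N (x / Rn N).
Let Phi_antiderivative : antiderivative Phi phi.
Proof.
apply: eq_antiderivative
  (antiderivativeZ (Rn N) (rescale_antiderivative (Rn N) (F1f N))) => x.
by rewrite /phi; field; rewrite gt_eqF.
Qed.

Let Phi_le x : `|Phi x| <= K0 * Rn N.
Proof. by rewrite /Phi normrM (gtr0_norm Rp) mulrC ler_wpM2r// ltW. Qed.

Let momphi v : 0 <= v -> mom P (fun w => phi (b v w)).
Proof.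
move=> v0; apply: (coef_mom hb) => //; split; first exact: continuous_measurable_fun.
by exists K0.
Qed.

(** Here phi plays the slow factor: the layers below N are integrated, which costs their total
    weight gamma_N R_N / (rm - 1), while the derivative of phi is at most K1 / R_N. *)
Lemma fast_corr u : 0 < u ->
  `|Exp (fun w => fast (b u w) * phi (b u w))| <=
    2 * K0 * K1 / (rm - 1) * gam N + gam N * (Rn N * K0 ^+ 2) / Num.sqrt u.
Proof.
move=> u0; have su : 0 < Num.sqrt u by rewrite sqrtr_gt0.
have L0 : 0 <= K1 / Rn N by rewrite divr_ge0// ltW.
have ph x : `|phi x| <= K0 + K1 / Rn N * `|x|.
  by apply: (le_trans (phi_le x)); rewrite lerDl mulr_ge0.
have := avg_slow hb u0 (lexx u) (sumF_antiderivative N) (@sumc_cts N)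
  (@Flayer_le N) (@clayer_le N) phi_antiderivative phi'_cts phi'_le ph.
move/le_trans; apply.
have r1 : 0 < rm - 1 by have := ms_rm ms; lra.
have r1' : 1 <= rm - 1 by have := ms_rm ms; lra.
have S := sum_fast_le ms N.
have e0 : 0 <= K1 / Rn N + (K0 + K1 / Rn N * Num.sqrt u) / Num.sqrt u.
  by rewrite addr_ge0// divr_ge0 ?(ltW su)// addr_ge0// mulr_ge0 ?(ltW su).
apply: le_trans (_ : K0 * (gam N * Rn N / (rm - 1)) *
   (K1 / Rn N + (K0 + K1 / Rn N * Num.sqrt u) / Num.sqrt u) <= _).
  by rewrite ler_wpM2r// ler_wpM2l.
have -> : K0 * (gam N * Rn N / (rm - 1)) *
   (K1 / Rn N + (K0 + K1 / Rn N * Num.sqrt u) / Num.sqrt u) =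
   2 * K0 * K1 / (rm - 1) * gam N + gam N * (Rn N * K0 ^+ 2) / Num.sqrt u / (rm - 1).
  by field; rewrite !gt_eqF.
rewrite lerD2l ler_pdivrMr// ler_peMr//.
by rewrite divr_ge0 ?(ltW su)// !mulr_ge0 ?sqr_ge0// ltW.
Qed.

(** phi^2 - 1 has a bounded primitive, so it is averaged out against the constant function 1. This
    isolates the main contribution, gamma_N times 1. *)
Lemma square_corr u : 0 < u ->
  `|Exp (fun w => phi (b u w) ^+ 2) - 1| <= Rn N * (K0 ^+ 2 + 1) / Num.sqrt u.
Proof.
move=> u0.
pose psi x := phi x ^+ 2 - 1.
pose Psi x := Rn N * F2 N (x / Rn N).
have PP : antiderivative Psi psi.
  apply: eq_antiderivative
    (antiderivativeZ (Rn N) (rescale_antiderivative (Rn N) (F2f N))) => x.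
  by rewrite /psi /phi; field; rewrite gt_eqF.
have PB x : `|Psi x| <= Rn N * (K0 ^+ 2 + 1).
  by rewrite /Psi normrM (gtr0_norm Rp) ler_wpM2l// ltW.
have cpsi : continuous psi.
  rewrite /psi; under eq_fun do rewrite expr2.
  by move=> x; apply: cvgB; [apply: cvgM; exact: phi_cts|exact: cvg_cst].
have psiB x : `|psi x| <= K0 ^+ 2 + 1.
  apply: le_trans (ler_normB _ _) _; rewrite normr1 lerD2r normrX.
  by rewrite lerXn2r ?nnegrE.
have one (x : R) : `|(fun=> 1 : R) x| <= 1 + 0 * `|x| by rewrite normr1 mul0r addr0.
have zero (x : R) : `|(fun=> 0 : R) (x : R)| <= 0 by rewrite normr0.
have := avg_slow hb u0 (lexx u) PP cpsi PB psiB (antiderivative_cst 1)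
  (@cst_continuous _ _ 0) zero one.
rewrite mul0r addr0 add0r -mulrA mul1r mulrA.
have -> : Exp (fun w => psi (b u w) * 1) = Exp (fun w => phi (b u w) ^+ 2) - 1.
  rewrite -[X in _ = _ - X](Ex_cst P) -ExB; [|apply: momX; exact: momphi (ltW u0)|exact: mom_cst].
  by apply: eq_Ex => w; rewrite mulr1.
by [].
Qed.

(** Now phi is the oscillating factor, with a primitive of size K0 R_N, and the layers above N
    vanish at 0 with slope [tail_slope]; the two powers of R_N cancel. Used with s = u and with s =
    t. *)
Lemma slow_corr M u s : 0 < u -> u <= s ->
  `|Exp (fun w => phi (b u w) * (slow M (b s w)))| <=
    K0 * K1 * kap * gam N * (1 + Num.sqrt s / Num.sqrt u).
Proof.
move=> u0 us; have su : 0 < Num.sqrt u by rewrite sqrtr_gt0.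
have sl x : `|slow M x| <= 0 + slope N * `|x|.
  have := tail_layer ms gMrm N M x 0; rewrite subr0 add0r.
  by rewrite [X in _ - X]big1 ?subr0// => k _; exact: layer0 ms _.
have := avg_slow hb u0 us Phi_antiderivative phi_cts Phi_le phi_le
  (sum_layer_antiderivative ms N.+1 M) (@slc N.+1 M)
  (tail_layer' ms gMrm N M) sl.
move/le_trans; apply; rewrite add0r le_eqVlt; apply/orP; left; apply/eqP.
by rewrite /tail_slope; field; rewrite !gt_eqF.
Qed.

(** At time t the layers up to N are averaged by the increment after u, which is independent of
    phi(b_u). Since N is included, the weight is 2 gamma_N R_N. *)
Lemma fine_corr u : 0 <= u -> u < t ->
  `|Exp (fun w => phi (b u w) * (\sum_(0 <= k < N.+1) clayer k (b t w)))| <=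
    2 * K0 ^+ 2 * gam N * Rn N / Num.sqrt (t - u).
Proof.
move=> u0 ut.
have := avg_fast hb u0 ut (continuous_measurable_fun phi_cts) phi_le
  (sumF_antiderivative N.+1) (@sumc_cts N.+1) (@Flayer_le N.+1) (@clayer_le N.+1).
move/le_trans; apply; rewrite ler_wpM2r ?invr_ge0 ?sqrtr_ge0//.
have -> : 2 * K0 ^+ 2 * gam N * Rn N = K0 * (K0 * (2 * (gam N * Rn N))) by ring.
by rewrite !ler_wpM2l// (sum_fast_le2 ms).
Qed.

Hypothesis small1 : 20 * (K0 * K1) <= rm - 1.
Hypothesis small2 : 20 * (K0 * K1) * gM <= rm - gM.
Hypothesis Nt : 16 * (4 * K0 ^+ 2 + 1) * Rn N <= Num.sqrt t.

(** The regular part of the correlation at time u, followed by the coefficients of its singularities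
    at 0 and at t. *)
Let lc : R := gam N * (1 - 2 * K0 * K1 / (rm - 1) - 3 * (K0 * K1 * kap)).
Let ld1 : R := gam N * (Rn N * (2 * K0 ^+ 2 + 1)) + K0 * K1 * kap * gam N * Num.sqrt t.
Let ld2 : R := 2 * K0 ^+ 2 * gam N * Rn N.
(** Subtracting the constants centres the layers up to N and leaves the derivative unchanged, so
    Ito's formula applies to the same integrand. *)
Let hh M x := \sum_(0 <= k < M) lay k x - \sum_(0 <= k < N.+1) gam k * c k.

Lemma hhE M x : (N < M)%N ->
  hh M x = \sum_(0 <= k < N.+1) clayer k x + slow M x.
Proof.
move=> NM; rewrite /hh (@big_cat_nat _ _ _ N.+1 0 M)//= addrAC -sumrB.
congr (_ + _); apply: eq_bigr => k _; rewrite /clayer /layer; ring.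
Qed.

(** The slow layers enter [lc] three times: twice at time u, where sqrt s / sqrt u is 1, and once at
    time t, where the remaining part in sqrt t / sqrt u goes into [ld1]. *)
Lemma corr_lower M u : (N < M)%N -> 0 < u -> u < t ->
  lc - ld1 / Num.sqrt u - ld2 / Num.sqrt (t - u) <=
  Exp (fun w => phi (b u w) * hh M (b u w)) - Exp (fun w => phi (b u w) * hh M (b t w)).
Proof.
move=> NM u0 ut.
have su : 0 < Num.sqrt u by rewrite sqrtr_gt0.
have mc n v : 0 <= v -> mom P (fun w => \sum_(0 <= k < n) clayer k (b v w)).
  move=> v0; apply: (coef_mom hb (a := fun x => \sum_(0 <= k < n) clayer k x)) => //.
  split; first exact: continuous_measurable_fun.
  by eexists; exact: clayer_le.
have msl v : 0 <= v -> mom P (fun w => slow M (b v w)).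
  move=> v0; apply: (coef_mom hb (a := slow M)) => //; split.
    exact: continuous_measurable_fun (antiderivative_continuous (sum_layer_antiderivative ms N.+1 M)).
  by eexists; exact: sum_layer_le.
have mp := momphi (ltW u0).
have e1 : Exp (fun w => phi (b u w) * hh M (b u w)) =
    Exp (fun w => fast (b u w) * phi (b u w)) + gam N * Exp (fun w => phi (b u w) ^+ 2) +
    Exp (fun w => phi (b u w) * slow M (b u w)).
  have q1 := momM (mc N _ (ltW u0)) mp; have q2 := momZ (gam N) (momX 2 mp).
  have q3 := momM mp (msl _ (ltW u0)).
  rewrite -(ExZ _ (momX 2 mp)) -(ExD q1 q2) -(ExD (momD q1 q2) q3).
  apply: eq_Ex => w; rewrite hhE// big_nat_recr//= /fast.
  by rewrite (_ : clayer N _ = gam N * phi (b u w))//; ring.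
have t0' := ltW t0.
have e2 : Exp (fun w => phi (b u w) * hh M (b t w)) =
    Exp (fun w => phi (b u w) * (\sum_(0 <= k < N.+1) clayer k (b t w))) +
    Exp (fun w => phi (b u w) * slow M (b t w)).
  rewrite -ExD; [|exact: momM mp (mc _ _ t0')|exact: momM mp (msl _ t0')].
  by apply: eq_Ex => w; rewrite hhE// mulrDr.
rewrite e1 e2.
have := fast_corr u0; have := square_corr u0.
have := slow_corr M u0 (lexx u); have := slow_corr M u0 (ltW ut).
have := fine_corr (ltW u0) ut.
rewrite divff ?gt_eqF//.
move: (Exp _) (Exp _) (Exp _) (Exp _) (Exp _) => X4 X5 X3 X2 X1.
rewrite !ler_norml => /andP[_ h4] /andP[_ h5] /andP[h3 _] /andP[h2 _] /andP[h1 _].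
have h2' := ler_wpM2l (ltW gp) h2.
move: h1 h2' h3 h4 h5; rewrite /lc /ld1 /ld2.
move: (Num.sqrt u) (Num.sqrt (t - u)) (Num.sqrt t) => a e s.
rewrite ![_ / a]mulrC ![_ / (rm - 1)]mulrC.
move: (a^-1) (rm - 1)^-1 => a' r'.
rewrite [ld2 / e]mulrC.
nra.
Qed.

(** [small1] and [small2] leave at least 1 - 1/10 - 3/20 = 3/4 in [lc]. The singular terms take 1/8
    through [Nt] and 1/10 through the slow layers, so more than 1/2 remains. *)
Lemma scale_lower : gam N * t / 2 <= lc * t - 2 * (ld1 + ld2) * Num.sqrt t.
Proof.
have r1 : 0 < rm - 1 by have := ms_rm ms; lra.
have r2 : 0 < rm - gM by rewrite subr_gt0.
have k01 : 0 <= K0 * K1 by rewrite mulr_ge0.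
have b1 : 2 * K0 * K1 / (rm - 1) <= 1 / 10 by rewrite ler_pdivrMr//; move: small1; lra.
have b2 : K0 * K1 * kap <= 1 / 20.
  by rewrite /tail_rate mulrA ler_pdivrMr//; move: small2; lra.
have st := sqr_sqrtr (ltW t0); have s0 : 0 <= Num.sqrt t by exact: sqrtr_ge0.
have h : (4 * K0 ^+ 2 + 1) * Rn N * Num.sqrt t <= t / 16.
  have := ler_wpM2r s0 Nt; rewrite -[Num.sqrt t * Num.sqrt t]expr2 st; lra.
have -> : lc * t - 2 * (ld1 + ld2) * Num.sqrt t = gam N *
   ((1 - 2 * K0 * K1 / (rm - 1) - 3 * (K0 * K1 * kap)) * t
    - 2 * ((4 * K0 ^+ 2 + 1) * Rn N * Num.sqrt t)
    - 2 * (K0 * K1 * kap) * Num.sqrt t ^+ 2).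
  by rewrite /lc /ld1 /ld2; ring.
rewrite st -mulrA ler_wpM2l ?(ltW gp)//.
have fin (x y q : R) : x <= 1 / 10 -> y <= 1 / 20 -> q <= t / 16 ->
    t / 2 <= (1 - x - 3 * y) * t - 2 * q - 2 * y * t.
  move=> /(ler_wpM2r (ltW t0)) h1 /(ler_wpM2r (ltW t0)) h2 h3.
  move: t0 h1 h2 h3; rewrite !mulrBl mul1r -!mulrA; lra.
exact: fin.
Qed.

(** The Ito integrand is cut at a level j >= N and j then tends to infinity. Cutting at N would
    leave an error slope(N) t K0 sqrt t, which need not be small against gamma_N t when sqrt t is
    large compared with R_N. *)
Lemma variance_lower_aux : gam N ^+ 2 * t <= K0 ^+ 2 * Exp (fun w => Z w ^+ 2).
Proof.
have st := sqr_sqrtr (ltW t0); have s0 : 0 < Num.sqrt t by rewrite sqrtr_gt0.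
set V := Exp _; have V0 : 0 <= V by apply: Ex_ge0 => w; exact: sqr_ge0.
have key j : (N <= j)%N -> gam N * t <= (Num.sqrt V + slope j * t) * (K0 * Num.sqrt t).
  move=> Nj.
  have dhh : antiderivative (hh j.+1) (fun x => \sum_(0 <= k < j.+1) lay' k x).
    apply: eq_antiderivative (antiderivativeB (sum_layer_antiderivative ms 0 j.+1)
      (antiderivative_cst (\sum_(0 <= k < N.+1) gam k * c k))) => x.
    by rewrite subr0.
  have [H HH _] := continuous_antiderivative (antiderivative_continuous dhh).
  have [C' hC'] := sum_layer'_lip ms 0 j.+1.
  have hB x : `|hh j.+1 x| <= K0 * (\sum_(0 <= k < j.+1) gam k) +
      `|\sum_(0 <= k < N.+1) gam k * c k|.
    by apply: le_trans (ler_normB _ _) _; rewrite lerD2r sum_layer_le.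
  have kap1 : 0 <= K0 * K1 * kap * gam N.
    exact: mulr_ge0 (mulr_ge0 (mulr_ge0 K00 K10) kap0) (ltW gp).
  have q0 : 0 <= 2 * K0 ^+ 2 by rewrite mulr_ge0 ?sqr_ge0.
  have d10 : 0 <= ld1.
    apply: addr_ge0; last exact: mulr_ge0 kap1 (ltW s0).
    apply: mulr_ge0 (ltW gp) _; apply: mulr_ge0 (ltW Rp) _.
    by rewrite addr_ge0.
  have d20 : 0 <= ld2 by exact: mulr_ge0 (mulr_ge0 q0 (ltW gp)) (ltW Rp).
  have := sbm_lower hb t0 cg gG mZ ZG Zint bcont HH dhh hB
    (sum_layer'_bounded j) hC' (@slc 0 j.+1) (profile'_tail ms gMrm j)
    (continuous_measurable_fun phi_cts) phi_le d10 d20 (fun u => @corr_lower j.+1 u _).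
  move=> /(_ Nj); apply: le_trans.
  have := scale_lower; move: (lc * t - _) => y; lra.
have lim : gam N * t <= (Num.sqrt V + 0 * t) * (K0 * Num.sqrt t).
  have cj : (fun j => (Num.sqrt V + slope j * t) * (K0 * Num.sqrt t)) @ \oo -->
     (Num.sqrt V + 0 * t) * (K0 * Num.sqrt t).
    apply: cvgM; last exact: cvg_cst.
    apply: cvgD; first exact: cvg_cst.
    by apply: cvgM; [exact: tail_slope_cvg0 ms gMrm|exact: cvg_cst].
  apply: (ler_cvg_to (cvg_cst (gam N * t)) cj); near=> j.
  by apply: key; near: j; exact: nbhs_infty_ge.
have lim2 : gam N * Num.sqrt t <= Num.sqrt V * K0.
  rewrite -(ler_pM2r s0) -mulrA -expr2 st; apply: le_trans lim _.
  by rewrite mul0r addr0 mulrA.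
rewrite -(sqr_sqrtr V0) -st -!exprMn mulrC [X in _ <= X ^+ 2]mulrC mulrC.
rewrite lerXn2r ?nnegrE ?mulr_ge0 ?sqrtr_ge0 ?(ltW gp)//.
Unshelve. all: by end_near. Qed.

End Lower.

Lemma variance_lower N :
  20 * (K0 * K1) <= rm - 1 -> 20 * (K0 * K1) * gM <= rm - gM ->
  16 * (4 * K0 ^+ 2 + 1) * Rn N <= Num.sqrt t ->
  gam N ^+ 2 * t <= K0 ^+ 2 * Exp (fun w => Z w ^+ 2).
Proof.
move=> s1 s2 Nt; have /choice[c /choice[F1 /choice[F2 h]]] := ms_center ms.
by apply: (@variance_lower_aux N c F1 F2) => // n; have [] := h n.
Qed.

End VarianceBounds.

(** * The stochastic differential equation *)

Section Divergence.
Context (R : realType).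

Lemma derive_coord0 (F f : R -> R) (x : 'rV[R]_2) : antiderivative F f ->
  'D_(delta_mx 0 0) (fun z : 'rV[R]_2 => F (z 0 0)) x = f (x 0 0).
Proof.
move=> FF; have [_ <-] := FF (x 0 0); rewrite /derive.
have e : (fun h : R => h^-1 *: ((fun z : 'rV[R]_2 => F (z 0 0))
    (h *: delta_mx 0 0 + x) - F (x 0 0))) =
    (fun h : R => h^-1 *: (F (h *: 1 + x 0 0) - F (x 0 0))).
  by apply/funext => h; rewrite /= !mxE !eqxx.
by rewrite /shift /= [X in X @ _]e.
Qed.

Lemma derive_coord1 (F : R -> R) (x : 'rV[R]_2) :
  'D_(delta_mx 0 1) (fun z : 'rV[R]_2 => F (z 0 0)) x = 0.
Proof.
have e : (fun h : R => h^-1 *: ((fun z : 'rV[R]_2 => F (z 0 0))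
    (h *: delta_mx 0 1 + x) - F (x 0 0))) = cst 0.
  by apply/funext => h; rewrite /= !mxE /= mulr0 add0r subrr scaler0.
by rewrite /derive /shift /= [X in X @ _]e lim_cst.
Qed.

Variables (r : nat -> int) (gamma : nat -> R) (hn : nat -> R -> R).
Variable h' : R -> R.
Hypothesis dh : antiderivative (shear_profile r gamma hn) h'.

Lemma shear_divergence (x : 'rV[R]_2) (i : 'I_2) :
  mx_divergence (shear_stream_matrix r gamma hn) x 0 i =
  if i == 0 then 0 else - h' (x 0 0).
Proof.
rewrite /mx_divergence mxE big_ord_recl big_ord1.
have -> : lift ord0 ord0 = 1 :> 'I_2 by apply/val_inj.
have E (j : 'I_2) : (fun z : 'rV[R]_2 => shear_stream_matrix r gamma hn z i j) =
   (fun z => if (i == 0) && (j == 1) then shear_profile r gamma hn (z 0 0)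
             else if (i == 1) && (j == 0) then - shear_profile r gamma hn (z 0 0)
             else 0).
  by apply/funext => z; rewrite mxE.
rewrite !E; have [->|i0] := eqVneq i 0.
  rewrite /= (derive_coord1 (shear_profile r gamma hn)).
  by rewrite (derive_coord0 x (antiderivative_cst 0)) addr0.
have i1 : i == 1.
  by apply/eqP/val_inj; case: i i0 {E} => -[|[|]].
rewrite i1 /=.
rewrite (derive_coord1 (fun=> 0)) addr0.
have dN : antiderivative (fun z => - shear_profile r gamma hn z) (fun z => - h' z).
  have e : (fun z => - shear_profile r gamma hn z) =
      (fun z => -1 * shear_profile r gamma hn z) by apply/funext => z; rewrite mulN1r.
  rewrite e; apply: eq_antiderivative (antiderivativeZ (-1) dh) => z.
  by rewrite mulN1r.
exact: derive_coord0 x dN.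
Qed.

End Divergence.

Section SecondMoment.
Context (d : measure_display) (T : measurableType d) (R : realType).
Variables (P : probability T R) (W y : R -> T -> 'rV[R]_2).
Notation mu := (@lebesgue_measure R).
Notation b := (fun s => increment W 0 s 0).
Variables (r : nat -> int) (gamma : nat -> R) (hn : nat -> R -> R).
Hypothesis hW : brownian_motion P W.
Hypothesis hy : sde_solution P (shear_stream_matrix r gamma hn) W y.
Variable h' : R -> R.
Hypothesis dh : antiderivative (shear_profile r gamma hn) h'.
Hypothesis ch' : continuous h'.

Lemma within_coord (f : R -> 'rV[R]_2) (A : set R) (i : 'I_2) :
  {within A, continuous f} -> {within A, continuous (fun s => f s 0 i)}.
Proof.
move=> cf x; apply: (@continuous_comp (subspace A) 'rV[R]_2 R f (fun M => M 0 i)).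
  exact: cf.
exact: coord_continuous.
Qed.

Lemma bm_path_continuous :
  {ae P, forall w, {within `[0, +oo[, continuous (fun s => b s w)}}.
Proof.
apply: filterS (bm_continuous hW) => w cw.
have := @within_coord (fun s => W s w) _ 0 cw => h x.
by apply: cvgB; [exact: h|exact: cvg_cst].
Qed.

Lemma coef_path_integrable (t : R) (w : T) :
  {within `[0, +oo[, continuous (fun s => b s w)} ->
  mu.-integrable `[0, t] (EFin \o (fun s => h' (b s w))).
Proof.
move=> cb; apply: continuous_compact_integrable; first exact: segment_compact.
have cb' : {within `[0, t], continuous (fun s => b s w)}.
  by apply: continuous_subspaceW cb => s /=; rewrite !in_itv /= => /andP[-> _].
by move=> s; apply: continuous_comp; [exact: cb'|exact: ch'].
Qed.

Lemma sde_second_coord (t : R) : 0 < t ->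
  {ae P, forall w, y t w 0 1 - increment W 0 t 1 w = \int[mu]_(s in `[0, t]) h' (b s w)}.
Proof.
move=> t0.
apply: filterS2 (bm_start0 hW) (filterI (sol_equation hy) bm_path_continuous) => w W0 [eqy cb].
have y0 s : 0 <= s -> y s w 0 0 = b s w.
  move=> s0; rewrite (eqy s 0 s0) /increment W0 mxE subr0.
  rewrite [X in _ - X](_ : _ = 0) ?subr0//.
  under eq_Rintegral do rewrite (shear_divergence dh) /=.
  by rewrite Rintegral_cst ?mul0r//; exact: measurable_itv.
rewrite (eqy t 1 (ltW t0)) {1}/increment W0 mxE subr0.
rewrite addrAC subrr add0r.
have -> : \int[mu]_(s in `[0, t]) mx_divergence (shear_stream_matrix r gamma hn) (y s w) 0 1 =
    \int[mu]_(s in `[0, t]) (-1 * h' (b s w)).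
  apply: eq_Rintegral => s; rewrite inE /= in_itv /= => /andP[s0 _].
  by rewrite (shear_divergence dh) /= y0// mulN1r.
rewrite (RintegralZl (-1) _ (coef_path_integrable t cb)); last exact: measurable_itv.
by rewrite mulN1r opprK.
Qed.

Lemma clamp_bound (C x : R) : 0 <= C -> `|Num.max (- C) (Num.min C x)| <= C.
Proof.
move=> C0; rewrite ler_norml le_max lexx /= ge_max ge_min lexx /= andbT.
by rewrite ge0_cp.
Qed.

(** [Z] is built from the difference of [y] and the noise, which is measurable by assumption, and
    only then identified almost surely with the pathwise integral of the drift. *)
Lemma second_moment (t G : R) : 0 < t -> (forall x, `|h' x| <= G) ->
  exists Z : T -> R, [/\ mom P Z, forall w, `|Z w| <= G * t,
    {ae P, forall w, Z w = \int[mu]_(s in `[0, t]) h' (b s w)} &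
    ('E_P[(fun w => `|y t w 0 1| ^+ 2)%R])%E = (t + Ex P (fun w => Z w ^+ 2))%:E].
Proof.
move=> t0 hG; have G0 : 0 <= G by exact: le_trans (hG 0).
have C0 : 0 <= G * t by rewrite mulr_ge0// ltW.
have hb := bm_coordinate_scalar_bm hW 0.
pose I := increment W 0 t 1.
pose Z0 w := y t w 0 1 - I w.
have mI : measurable_fun setT I by apply: (increment_measurable hW) => //; exact: ltW.
have my : measurable_fun setT (fun w => y t w 0 1) by apply: (sol_measurable hy); exact: ltW.
have mZ0 : measurable_fun setT Z0 by exact: measurable_funB.
(* The bound G t on the difference holds only almost surely. Clamping makes it hold for every [w],
   as membership in [mom] and the domination of the Riemann sums require. *)
pose Z w := Num.max (- (G * t)) (Num.min (G * t) (Z0 w)).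
have mZ : measurable_fun setT Z.
  by apply: measurable_maxr => //; exact: measurable_minr.
have ZG w : `|Z w| <= G * t by exact: clamp_bound.
have mmZ : mom P Z by exact: mom_bounded ZG.
have Z0int := sde_second_coord t0.
have ZZ0 : {ae P, forall w, Z w = Z0 w}.
  apply: filterS2 Z0int bm_path_continuous => w e cb.
  have : `|Z0 w| <= G * t.
    rewrite /Z0 e.
    have ih := coef_path_integrable t cb.
    apply: le_trans (le_normr_Rintegral _ ih) _; first exact: measurable_itv.
    apply: le_trans (_ : \int[mu]_(s in `[0, t]) G <= _).
      apply: le_Rintegral => //.
      - exact: integrable_norm.
      - exact: continuous_integrable_itv (@cst_continuous _ _ G).
    rewrite Rintegral_cst; last exact: measurable_itv.
    rewrite ler_wpM2l// (_ : fine _ = t)//.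
    transitivity (fine (t%:E : \bar R)) => //; congr fine.
    apply: etrans (lebesgue_measure_itv `[0, t]) _.
    by rewrite /= lte_fin t0 -EFinB subr0.
  rewrite ler_norml /Z => /andP[h1 h2].
  by rewrite (min_idPr h2) (max_idPr h1).
have Zint : {ae P, forall w, Z w = \int[mu]_(s in `[0, t]) h' (b s w)}.
  by apply: filterS2 ZZ0 Z0int => w e1 e2; rewrite e1 -e2.
exists Z; split => //.
have gI := increment_gaussian hW 1 (lexx 0) t0; rewrite subr0 in gI.
have st : 0 < Num.sqrt t by rewrite sqrtr_gt0.
have momI : mom P I := mom_gaussian_id st gI.
(* Each Riemann sum of the drift is orthogonal to the noise by [increment_cross0], and mean-square
   convergence passes this to [Z]. *)
have cross : Ex P (fun w => Z w * I w) = 0.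
  have h n : `|Ex P (fun w => Z w * I w)| <=
      Num.sqrt (Ex P (fun w => (Z w - riemann b t h' n w) ^+ 2)) * Num.sqrt t.
    have br : bounded_coef h'.
      by split; [exact: continuous_measurable_fun|exists G].
    have mr := riemann_mom hb t0 n br.
    have z0 : Ex P (fun w => riemann b t h' n w * I w) = 0.
      transitivity (Ex P (fun w => \sum_(k < n.+1) (mesh t n * (h' (b (node t n k) w) * I w)))).
        by apply: eq_Ex => w; rewrite /riemann mulr_suml; apply: eq_bigr => k _; ring.
      have mk k : mom P (fun w => h' (b (node t n k) w) * I w).
        by apply: momM => //; apply: (coef_mom hb) => //; exact: node_ge0.
      rewrite Ex_sum; last by move=> k; exact: momZ.
      rewrite big1// => k _; rewrite ExZ// (increment_cross0 hW (C := G)) ?mulr0//.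
      - exact: node_ge0.
      - rewrite -[leRHS](node_last t n); apply: node_le => //; exact: ltnW (ltn_ord k).
      - exact: continuous_measurable_fun.
    have mdf : mom P (fun w => Z w - riemann b t h' n w) by exact: momB.
    have -> : Ex P (fun w => Z w * I w) = Ex P (fun w => (Z w - riemann b t h' n w) * I w).
      transitivity (Ex P (fun w => Z w * I w - riemann b t h' n w * I w)).
        by rewrite ExB; [rewrite z0 subr0|exact: momM|exact: momM].
      by apply: eq_Ex => w; rewrite mulrBl.
    apply: Ex_pairing_le => //; rewrite ?sqrtr_ge0//.
      by rewrite sqr_sqrtr//; apply: Ex_ge0 => w; exact: sqr_ge0.
    by rewrite (gaussian_variance st gI).
  have c : (fun n => Num.sqrt (Ex P (fun w => (Z w - riemann b t h' n w) ^+ 2)) * Num.sqrt t)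
      @ \oo --> Num.sqrt 0 * Num.sqrt t.
    apply: cvgM; last exact: cvg_cst.
    apply: continuous_cvg; first exact: sqrt_continuous.
    exact: (riemann_L2 hb t0 ch' hG mmZ ZG Zint bm_path_continuous).
  rewrite sqrtr0 mul0r in c.
  apply/eqP; rewrite -normr_le0.
  by apply: (ler_cvg_to (cvg_cst _) c); near=> n; exact: h.
have mIZ := momD momI mmZ.
have E1 : Ex P (fun w => (I w + Z w) ^+ 2) = t + Ex P (fun w => Z w ^+ 2).
  transitivity (Ex P (fun w => I w ^+ 2 + 2 * (Z w * I w) + Z w ^+ 2)).
    by apply: eq_Ex => w; ring.
  have q1 := momX 2 momI; have q2 := momM mmZ momI; have q3 := momX 2 mmZ.
  rewrite (ExD (momD q1 (momZ 2 q2)) q3) (ExD q1 (momZ 2 q2)) (ExZ 2 q2) cross mulr0 addr0.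
  by rewrite (gaussian_variance st gI) sqr_sqrtr// ltW.
(* The expectation asked for is an extended-real integral of the original [y]; it equals that of
   [I + Z] because clamping changes nothing almost everywhere. *)
rewrite -E1 unlock /Ex /Rintegral fineK; last first.
  apply: integrable_fin_num => //; exact: mom_int (momX 2 mIZ).
apply: ae_eq_integral => //.
- apply/measurable_EFinP; apply: measurable_funX; exact: measurableT_comp.
- by apply/measurable_EFinP; exact: mom_meas (momX 2 mIZ).
- apply: filterS ZZ0 => w e _ /=; rewrite e /Z0 real_normK ?num_real//.
  by rewrite addrC subrK.
Unshelve. all: by end_near. Qed.

End SecondMoment.

(** * Exponents *)

Section Exponents.
Context (R : realType).
Variables (Rn gam : nat -> R) (f f' : nat -> R -> R) (K0 K1 gm gM rm rM : R).
Hypothesis ms : multiscale Rn gam f f' K0 K1 gm gM rm rM.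
Hypothesis gMrm : gM < rm.
Variables (t E : R).
Hypothesis t1 : 1 < t.
Hypothesis tE : t <= E.

Let t0 : 0 < t := lt_trans ltr01 t1.
Let E0 : 0 < E := lt_le_trans t0 tE.

Lemma scale_bracket (x : R) : 1 <= x -> exists N, Rn N <= x < Rn N.+1.
Proof.
move=> x1.
have ex : exists n, x < Rn n.
  exists (Num.truncn x).+1; apply: lt_le_trans (truncnS_gt x) _.
  apply: le_trans (Rn_ge_exp ms _); apply: le_trans (_ : 2 ^+ (Num.truncn x).+1 <= _).
    by rewrite -natrX ler_nat ltnW// ltn_expl.
  by rewrite lerXn2r// ?nnegrE ?ler0n// ?(ms_rm ms)// (le_trans _ (ms_rm ms)).
case: (ex_minnP ex) => -[|n]; first by rewrite (ms_R0 ms) ltNge x1.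
move=> h hmin; exists n; rewrite h andbT leNgt; apply/negP => /hmin.
by rewrite ltnn.
Qed.

Let gm0 : 0 < gm := lt_trans ltr01 (ms_gm ms).
Let gM0 : 0 < gM := lt_le_trans gm0 (ms_gM ms).
Let rm0 : 0 < rm := lt_le_trans (@ltr0Sn R 1) (ms_rm ms).
Let rM0 : 0 < rM := lt_le_trans rm0 (ms_rM ms).
Let a0 : 0 < ln gm := ln_gt0 (ms_gm ms).
Let L0 : 0 < ln t := ln_gt0 t1.
Let p0 : 0 < ln rm.
Proof. by apply: ln_gt0; apply: lt_le_trans (ms_rm ms); rewrite ltr1n. Qed.
Let aA : ln gm <= ln gM.
Proof. by rewrite ler_ln ?posrE//; exact: (ms_gM ms). Qed.
Let pP : ln rm <= ln rM.
Proof. by rewrite ler_ln ?posrE//; exact: (ms_rM ms). Qed.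
Let Ap : ln gM < ln rm.
Proof. by rewrite ltr_ln ?posrE. Qed.

Lemma ln_sqrt (x : R) : 0 < x -> ln (Num.sqrt x) = ln x / 2.
Proof.
move=> x0; have s0 : 0 < Num.sqrt x by rewrite sqrtr_gt0.
by rewrite -[in RHS](sqr_sqrtr (ltW x0)) lnXn// -(mulr_natr (ln _) 2) mulfK// pnatr_eq0.
Qed.

(** Bracketing sqrt t between R_N and R_(N+1) gives N <= ln t / (2 ln rm) and the exponent ln gM /
    ln rm. The stated exponent is no smaller, since gm <= gM decreases its denominator, which stays
    positive because gM < rm and gm > 1. Using layer N + 1 costs the term 2 ln gM. *)
Lemma exponent_upper (C : R) : 1 <= C ->
  (forall N, Num.sqrt t <= Rn N -> E <= C * (gam N ^+ 2 * t)) ->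
  ln E / ln t - 1 <=
    ln gM / (ln rm + ln (gm / gM)) + (ln C + 2 * ln gM) / ln t.
Proof.
move=> C1 hE; have C0 : 0 < C by exact: lt_le_trans C1.
have s1 : 1 <= Num.sqrt t by rewrite -[leLHS]sqrtr1 ler_wsqrtr// ltW.
have [N /andP[N1 N2]] := scale_bracket s1.
have h1 : ln rm *+ N <= ln t / 2.
  rewrite -lnXn// -ln_sqrt// ler_ln ?posrE ?sqrtr_gt0// ?exprn_gt0//.
  exact: le_trans (Rn_ge_exp ms N) N1.
have h2 : ln E <= ln C + (ln gM *+ N.+1 *+ 2 + ln t).
  have g0 := gam_gt0 ms N.+1.
  have : ln E <= ln (C * (gam N.+1 ^+ 2 * t)).
    by rewrite ler_ln ?posrE ?mulr_gt0 ?exprn_gt0//; exact: hE (ltW N2).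
  rewrite lnM ?posrE ?mulr_gt0 ?exprn_gt0// lnM ?posrE ?exprn_gt0// lnXn//.
  move=> h; apply: le_trans h _; rewrite lerD2l lerD2r lerMn2r.
  rewrite -(lnXn _ gM0) ler_ln ?posrE ?exprn_gt0//; exact: (gam_le_exp ms).
rewrite ln_div ?posrE//.
set e := ln gM / _.
have den : 0 < ln rm + (ln gm - ln gM) by move: a0 Ap; lra.
have he : e * (ln rm + (ln gm - ln gM)) = ln gM by rewrite divfK// gt_eqF.
have e0 : 0 <= e by rewrite divr_ge0 ?(ltW den)//; move: aA a0; lra.
have e1 : ln gM <= e * ln rm.
  by rewrite -[leLHS]he ler_wpM2l//; move: aA; lra.
have e2 : ln gM *+ N <= e * (ln t / 2).
  apply: le_trans (_ : e * (ln rm *+ N) <= _); last by rewrite ler_wpM2l.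
  by rewrite mulrnAr lerMn2r e1 orbT.
rewrite -(ler_pM2r L0) mulrBl mulrDl !divfK ?gt_eqF// mul1r.
rewrite (mulrS (ln gM) N) in h2; move: (ln gM *+ N) e2 h2 => v e2 h2; lra.
Qed.

(** Bracketing sqrt t / q gives sqrt t < q rM^(N+1) and the exponent ln gm / ln rM, which is at
    least the stated one. The loss of one layer costs 2 ln gm. *)
Lemma exponent_lower (q B : R) : 1 <= q -> 1 <= B ->
  (forall N, q * Rn N <= Num.sqrt t -> gam N ^+ 2 * t <= B * E) ->
  ln gm / (ln rM + ln (gM / gm)) -
    (2 * ln q * ln gm / ln rM + 2 * ln gm + ln B) / ln t <= ln E / ln t - 1.
Proof.
move=> q1 B1 hE; have q0 : 0 < q by exact: lt_le_trans q1.
have B0 : 0 < B by exact: lt_le_trans B1.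
have s0 : 0 < Num.sqrt t by rewrite sqrtr_gt0.
have P0 := lt_le_trans p0 pP.
have lq := ln_ge0 q1; have lB := ln_ge0 B1.
rewrite ln_div ?posrE//.
set e := ln gm / _; set u := 2 * ln q * ln gm / ln rM.
have den : 0 < ln rM + (ln gM - ln gm) by move: P0 aA; lra.
have he : e * (ln rM + (ln gM - ln gm)) = ln gm by rewrite divfK// gt_eqF.
have e0 : 0 <= e by rewrite divr_ge0 ?(ltW den)// ltW.
have e1 : e * ln rM <= ln gm.
  by rewrite -[leRHS]he ler_wpM2l//; move: aA; lra.
have hu : u * ln rM = 2 * ln q * ln gm by rewrite divfK// gt_eqF.
rewrite -(ler_pM2r L0) !mulrBl !divfK ?gt_eqF// mul1r.
have LE : ln t <= ln E by rewrite ler_ln ?posrE.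
(* If sqrt t < q no scale is available. The noise alone gives E >= t, so the shifted exponent is
   nonnegative, and ln t < 2 ln q lets the correction [u] cover all of e ln t. *)
have [qs|sq] := leP q (Num.sqrt t); last first.
  have h : ln t / 2 <= ln q by rewrite -ln_sqrt// ler_ln ?posrE// ltW.
  have : e * ln t <= u.
    rewrite -(ler_pM2r P0) hu mulrAC.
    apply: le_trans (_ : ln gm * ln t <= _); first by rewrite ler_wpM2r// ltW.
    by rewrite mulrC ler_wpM2r ?(ltW a0)//; move: h; lra.
  move: a0 lB LE; lra.
have x1 : 1 <= Num.sqrt t / q by rewrite ler_pdivlMr// mul1r.
have [N /andP[N1 N2]] := scale_bracket x1.
have h1 : ln t / 2 <= ln q + ln rM *+ N.+1.
  rewrite -lnXn// -lnM ?posrE ?exprn_gt0// -ln_sqrt// ler_ln ?posrE ?mulr_gt0 ?exprn_gt0//.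
  rewrite mulrC -ler_pdivrMr//; exact: le_trans (ltW N2) (Rn_le_exp ms _).
have h2 : ln gm *+ N *+ 2 + ln t <= ln B + ln E.
  have g0 := gam_gt0 ms N.
  have : ln (gam N ^+ 2 * t) <= ln (B * E).
    rewrite ler_ln ?posrE ?mulr_gt0 ?exprn_gt0//; apply: hE.
    by rewrite mulrC -ler_pdivlMr.
  rewrite lnM ?posrE ?exprn_gt0// lnM ?posrE// lnXn//.
  apply: le_trans; rewrite lerD2r lerMn2r.
  rewrite -(lnXn _ gm0) ler_ln ?posrE ?exprn_gt0//; exact: (gam_ge_exp ms).
have h3 : e * ln t <= u + 2 * (ln gm *+ N.+1).
  (* The exponent without the ratio gM / gm; multiplying [h1] by it turns ln q into u / 2. *)
  have [w wP] : exists w, w = ln gm / ln rM by exists (ln gm / ln rM).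
  have wa : w * ln rM = ln gm by rewrite wP divfK// gt_eqF.
  have w0 : 0 <= w by rewrite wP divr_ge0// ltW.
  have ew : e <= w by rewrite -(ler_pM2r P0) wa.
  have uw : u = 2 * ln q * w by rewrite /u wP mulrA.
  apply: le_trans (_ : w * ln t <= _); first by rewrite ler_wpM2r// ltW.
  have := ler_wpM2l w0 h1.
  by rewrite mulrDr mulrnAr wa uw; lra.
rewrite (mulrS (ln gm) N) in h3; move: (ln gm *+ N) h3 h2 => v h3 h2; lra.
Qed.

End Exponents.

Section Threshold.
Context (R : realType).

Lemma small_interactions (gM K0 K1 rm : R) : 0 < gM -> 0 <= K0 -> 0 <= K1 ->
  1 + gM + 20 * (K0 * K1) * (1 + gM) < rm ->
  20 * (K0 * K1) <= rm - 1 /\ 20 * (K0 * K1) * gM <= rm - gM.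
Proof.
move=> g0 k0 k1; have k : 0 <= K0 * K1 by rewrite mulr_ge0.
have kg : 0 <= (K0 * K1) * gM by rewrite mulr_ge0// ltW.
by rewrite mulrDr mulr1 => h; split; lra.
Qed.

End Threshold.

Theorem theorem3p1 (R : realType) :
  (* arguments of rho0: gamma_min, gamma_max, K0, K1 *)
  exists rho0 : R -> R -> R -> R -> R,
  (* arguments of t0: gamma_min, gamma_max, R_1, K0, K1 *)
  exists t0 : R -> R -> R -> R -> R -> R,
  (* arguments of C1 and C2:
     rho_min, gamma_min, gamma_max, rho_max, K0, K1 *)
  exists C1 C2 : R -> R -> R -> R -> R -> R -> R,
  forall (r : nat -> int) (gamma : nat -> R) (hn : nat -> R -> R),
    shear_data r gamma hn ->
    let rhom := rho_min R r in let rhoM := rho_max R r in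
    let gm := gamma_min gamma in let gM := gamma_max gamma in
    let k0 := K0 hn in let k1 := K1 hn in
    gM < rhom ->
    rho0 gm gM k0 k1 < rhom ->
  forall (d : measure_display) (T : measurableType d) (P : probability T R)
    (W y : R -> T -> 'rV[R]_2),
    brownian_motion P W ->
    sde_solution P (shear_stream_matrix r gamma hn) W y ->
  exists nu : R -> R,
  forall t : R, t0 gm gM (scale R r 1) k0 k1 < t ->
    ('E_P[(fun w => `|y t w 0 1| ^+ 2)%R])%E = (t `^ (1 + nu t))%:E /\
    ln gm / (ln rhoM + ln (gM / gm)) - C1 rhom gm gM rhoM k0 k1 / ln t
      <= nu t
      <= ln gM / (ln rhom + ln (gm / gM)) + C2 rhom gm gM rhoM k0 k1 / ln t.
Proof.
(* The terms 1 and gM leave at least 20 k0 k1 (1 + gM) in both rm - 1 and rm - gM. The time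
   threshold 1 only makes ln t positive; small times are absorbed by C1. *)
exists (fun gm gM k0 k1 => 1 + gM + 20 * (k0 * k1) * (1 + gM)), (fun _ _ _ _ _ => 1).
(* The ratio between sqrt t and R_N demanded by [variance_lower]. *)
pose q (k0 : R) : R := 16 * (4 * k0 ^+ 2 + 1).
pose C (rhom gm gM k0 k1 : R) : R := 1 +
  (5 * (k1 * tail_rate gM rhom) ^+ 2 + 40 * (k0 * (gm / (gm - 1))) ^+ 2).
exists (fun rhom gm gM rhoM k0 k1 =>
  2 * ln (q k0) * ln gm / ln rhoM + 2 * ln gm + ln (1 + k0 ^+ 2)).
exists (fun rhom gm gM rhoM k0 k1 => ln (C rhom gm gM k0 k1) + 2 * ln gM).
move=> r gamma hn sd rhom rhoM gm gM k0 k1 gMrm rho0 d T P W y hW hy.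
have ms := shear_data_multiscale sd.
have gM0 : 0 < gM by apply: lt_le_trans (ms_gM ms); exact: lt_trans (ms_gm ms).
have [s1 s2] := small_interactions gM0 (K0_ge0 ms) (K1_ge0 ms) rho0.
(* The identity E = t^(1 + nu) leaves no other choice of nu for t > 1. *)
exists (fun t => ln (fine 'E_P[(fun w => `|y t w 0 1| ^+ 2)%R]) / ln t - 1) => t t1.
have t0 : 0 < t := lt_trans ltr01 t1.
(* [profile] applied to these data unfolds to [shear_profile], which is how this serves in
   [second_moment]. *)
have dh := profile_antiderivative ms gMrm.
have bdh := profile'_bound ms gMrm.
have ch := profile'_continuous ms gMrm.
have [Z [mZ ZG Zint ->]] := second_moment hW hy dh ch t0 bdh.
have hb := bm_coordinate_scalar_bm hW 0.
have bc := bm_path_continuous hW.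
set V := Ex P _; have V0 : 0 <= V by apply: Ex_ge0 => w; exact: sqr_ge0.
rewrite [fine _]/=.
have tE : t <= t + V by rewrite lerDl.
have L0 : 0 < ln t := ln_gt0 t1.
have E0 : 0 < t + V by exact: lt_le_trans tE.
split.
  by congr EFin; rewrite /powR gt_eqF// [1 + _]addrC subrK divfK ?gt_eqF// lnK.
have k2 : 0 <= k0 ^+ 2 := sqr_ge0 _.
apply/andP; split.
  apply: (exponent_lower ms t1 tE); [rewrite /q; lra|lra|].
  move=> N Nt; apply: le_trans (variance_lower hb ms gMrm t0 mZ ZG Zint bc s1 s2 Nt) _.
  (* Both factors are enlarged: V to t + V, and k0^2 to 1 + k0^2, which is at least 1 as
     [exponent_lower] asks. *)
  apply: ler_pM => //; first by rewrite /k0 lerDr.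
  by rewrite lerDr ltW.
apply: (exponent_upper ms gMrm t1 tE).
  by rewrite lerDl addr_ge0// mulr_ge0// sqr_ge0.
move=> N Nt; have hv := variance_upper hb ms gMrm t0 mZ ZG Zint bc Nt.
(* The summand 1 of [C] pays for the noise term t, since gamma_N >= 1. *)
rewrite /C mulrDl mul1r lerD//; apply: ler_peMl; first exact: ltW.
apply: exprn_ege1; apply: le_trans (gam_ge_exp ms N).
by apply: exprn_ege1; exact: ltW (ms_gm ms).
Qed.
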